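(* Let $(M,\omega)$ be a noncompact symplectic manifold and let $\gamma \colon [0,\infty) \to M$ be a proper embedding such that $(M,\omega)$ is $\gamma$-wide. Then $(M,\omega)$ is symplectomorphic to $(M \setminus \operatorname{im}\gamma,\ \omega|_{M\setminus \operatorname{im}\gamma})$.
   Context: Let $2n = \dim M$. On $\mathbb{R}^{2n}$ with coordinates $(x_1,y_1,\dotsc,x_n,y_n)$ let $\omega_0 = dx_1\wedge dy_1 + \dotsb + dx_n\wedge dy_n$, and let $\gamma_0 \colon [0,\infty)\to\mathbb{R}^{2n}$ be $\gamma_0(s) = (0,\dotsc,0,s,0)$ (so $x_n = s$ and all other coordinates vanish). $\mathbb{B}_0^{d}(\varepsilon)$ denotes the open ball of radius $\varepsilon$ centered at $0$ in $\mathbb{R}^d$, and $\mathbb{B}_0^{2n-2}(\varepsilon)\times\mathbb{R}^2$ is regarded as an open subset of $\mathbb{R}^{2n}$, with the factor $\mathbb{R}^2$ in the coordinates $(x_n,y_n)$. For a proper embedding $\gamma$ of the ray $[0,\infty)$ into $M$, the $\gamma$-width of $(M,\omega)$ is the supremum of the numbers $\pi\varepsilon^2>0$ such that there exists a symplectic embedding $j \colon (\mathbb{B}_0^{2n-2}(\varepsilon)\times\mathbb{R}^2,\omega_0)\hookrightarrow (M,\omega)$ with $j\circ\gamma_0 = \gamma$. $(M,\omega)$ is called $\gamma$-wide if its $\gamma$-width is positive, i.e. if such a $j$ exists for some $\varepsilon>0$. *)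

(* Defs.v *)
From HB Require Import structures.
From mathcomp Require Import all_boot all_order all_algebra.
From mathcomp Require Import all_classical all_reals all_analysis.
From mathcomp Require Import zify.
Set Implicit Arguments.
Unset Strict Implicit.
Unset Printing Implicit Defensive.
Import Order.TTheory GRing.Theory Num.Theory.
Import numFieldNormedType.Exports.
Local Open Scope classical_set_scope.
Local Open Scope ring_scope.

(* U is meant to be open: C^(k+1) means differentiable on U with all
   directional derivatives of class C^k on U. *)
Fixpoint Ck_on {R : realType} {V W : normedModType R} (k : nat) (U : set V)
    (f : V -> W) : Prop :=
  match k with
  | 0 => forall x, U x -> {for x, continuous f}
  | k'.+1 => (forall x, U x -> differentiable f x) /\
             (forall v, Ck_on k' U ('D_v f))
  end.

Definition smooth_on {R : realType} {V W : normedModType R} (U : set V)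
    (f : V -> W) : Prop := forall k, Ck_on k U f.

Definition topological_embedding {S T : topologicalType} (f : S -> T) : Prop :=
  [/\ injective f, continuous f &
      forall U : set S, open U -> exists2 V : set T, open V & U = f @^-1` V].

(* coord i is only meaningful on dom i *)
Record chartedSpace (R : realType) (d : nat) := ChartedSpace {
  carrier :> topologicalType;
  chart : Type;
  dom : chart -> set carrier;
  coord : chart -> carrier -> 'rV[R]_d }.

(* The function h restricted to D (a subset of dom i), read in the chart i:
   h \o (coord i)^-1 on coord i @` D, and 0 elsewhere. *)
Definition in_chart {R : realType} {d : nat} {M : chartedSpace R d}
    {W : normedModType R} (i : chart M) (D : set M) (h : M -> W) : 'rV[R]_d -> W :=
  fun z => xget 0 [set h x | x in [set x | D x /\ coord i x = z]].

Section SmoothMaps.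
Context {R : realType} {d e : nat} {M : chartedSpace R d} {N : chartedSpace R e}.
Implicit Types f : M -> N.

Definition local_dom f (i : chart M) (j : chart N) : set M :=
  dom i `&` f @^-1` dom j.

(* coord j \o f \o (coord i)^-1 *)
Definition local_expr f i j : 'rV[R]_d -> 'rV[R]_e :=
  in_chart i (local_dom f i j) (coord j \o f).

Definition smooth_map f : Prop :=
  continuous f /\
  forall i j, smooth_on (coord i @` local_dom f i j) (local_expr f i j).

Definition immersion f : Prop :=
  forall i j x, local_dom f i j x ->
    forall u, 'd (local_expr f i j) (coord i x) u = 0 -> u = 0.

Definition smooth_embedding f : Prop :=
  [/\ smooth_map f, immersion f & topological_embedding f].

End SmoothMaps.

Definition smooth_manifold {R : realType} {d : nat} (M : chartedSpace R d) : Prop :=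
  [/\ hausdorff_space M, @second_countable M,
      forall x : M, exists i : chart M, dom i x,
      forall i : chart M,
        [/\ open (dom i), {in dom i &, injective (coord i)},
            forall x, dom i x -> {for x, continuous (coord i)} &
            forall U, open U -> U `<=` dom i -> open (coord i @` U)] &
      forall i j : chart M,
        smooth_on (coord i @` (dom i `&` dom j)) (local_expr (@idfun M) i j)].

(* A 2-form w is given by its components: for x in dom i, the entry (a, b) of
   form i x is w_x(d/dz_a, d/dz_b) in the coordinates z = coord i. *)
Record formedSpace (R : realType) (d : nat) := FormedSpace {
  base :> chartedSpace R d;
  form : chart base -> base -> 'M[R]_d }.

Definition bilin {R : realType} {d : nat} (A : 'M[R]_d) (u v : 'rV[R]_d) : R :=
  (u *m A *m v^T) 0 0.

(* f^* w_N = w_M *)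
Definition preserves_form {R : realType} {d e : nat} {M : formedSpace R d}
    {N : formedSpace R e} (f : M -> N) : Prop :=
  forall (i : chart M) (j : chart N) x, local_dom f i j x ->
    forall u v, let df := 'd (local_expr f i j) (coord i x) in
      bilin (form j (f x)) (df u) (df v) = bilin (form i x) u v.

(* The components of dw for the 2-form w = \sum_(a < b) w_ab dz_a /\ dz_b. *)
Definition ext_deriv {R : realType} {d : nat} (w : 'rV[R]_d -> 'M[R]_d)
    (z : 'rV[R]_d) (a b c : 'I_d) : R :=
  let partial k l m := 'D_(delta_mx 0 k) (fun y => w y l m) z in
  partial a b c + partial b c a + partial c a b.

(* The first clause is the transformation law making the components in the
   various charts those of a single 2-form on M. *)
Definition symplectic_form {R : realType} {d : nat} (M : formedSpace R d) : Prop :=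
  [/\ preserves_form (@idfun M),
      forall (i : chart M) x, dom i x -> forall u, bilin (form i x) u u = 0,
      forall (i : chart M) x, dom i x ->
        forall u, (forall v, bilin (form i x) u v = 0) -> u = 0,
      forall i : chart M,
        smooth_on (coord i @` dom i) (in_chart i (dom i) (form i)) &
      forall (i : chart M) z, (coord i @` dom i) z ->
        forall a b c, ext_deriv (in_chart i (dom i) (form i)) z a b c = 0].

Definition symplectic_manifold {R : realType} {d : nat} (M : formedSpace R d) : Prop :=
  smooth_manifold M /\ symplectic_form M.

Definition symplectic_embedding {R : realType} {d e : nat} {M : formedSpace R d}
    {N : formedSpace R e} (f : M -> N) : Prop :=
  smooth_embedding f /\ preserves_form f.

Definition symplectomorphic {R : realType} {d : nat} (M N : formedSpace R d) : Prop :=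
  exists (f : M -> N) (g : N -> M),
    [/\ cancel f g, cancel g f, smooth_map f, smooth_map g & preserves_form f].

(* U with the subspace topology, the restricted charts and the restricted form. *)
Definition restriction {R : realType} {d : nat} (M : formedSpace R d) (U : set M) :
    formedSpace R d :=
  @FormedSpace R d
    (@ChartedSpace R d (set_type U) (chart M)
      (fun i => set_val @^-1` dom i) (fun i => coord i \o set_val))
    (fun i => form i \o set_val).

Section StandardModel.
Context (R : realType) (n : nat).

(* The half-dimension is n.+1; the coordinate x_k (resp. y_k), 0 <= k <= n, has
   index k.*2 (resp. k.*2.+1), so the last pair is (x_n, y_n). *)
Definition ix (k : nat) : 'I_(n.*2.+2) := inord k.*2.
Definition iy (k : nat) : 'I_(n.*2.+2) := inord k.*2.+1.

(* \sum_k dx_k /\ dy_k *)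
Definition omega0 : 'M[R]_(n.*2.+2) :=
  \sum_(k < n.+1) (delta_mx (ix k) (iy k) - delta_mx (iy k) (ix k)).

Definition standard_space : formedSpace R n.*2.+2 :=
  @FormedSpace R n.*2.+2
    (@ChartedSpace R n.*2.+2 'rV[R]_(n.*2.+2) unit (fun=> setT) (fun=> idfun))
    (fun _ _ => omega0).

Definition cylinder (e : R) : set 'rV[R]_(n.*2.+2) :=
  [set z | \sum_(k < n) (z 0 (ix k) ^+ 2 + z 0 (iy k) ^+ 2) < e ^+ 2].

Definition standard_cylinder (e : R) : formedSpace R n.*2.+2 :=
  @restriction R n.*2.+2 standard_space (cylinder e).

Definition ray : topologicalType := set_type [set s : R | 0 <= s].

Definition gamma0 (s : ray) : 'rV[R]_(n.*2.+2) := set_val s *: delta_mx 0 (ix n).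

Lemma gamma0_cylinder (e : {posnum R}) (s : ray) : cylinder e%:num (gamma0 s).
Proof.
rewrite /cylinder /= big1 ?exprn_gt0// => k _.
have ne (a : nat) : (a < n.*2)%N -> (inord a == ix n) = false.
  by move=> an; apply/negbTE; rewrite -val_eqE /= !inordK; lia.
have kn := ltn_ord k.
by rewrite !mxE /ix /iy !ne ?mulr0 ?expr0n ?addr0//; lia.
Qed.

Definition gamma0_in (e : {posnum R}) (s : ray) : standard_cylinder e%:num :=
  SigSub (mem_set (gamma0_cylinder e s)).

End StandardModel.

Section Wideness.
Context {R : realType} {n : nat} {M : formedSpace R n.*2.+2}.

(* Smooth embedding of the manifold with boundary [0, oo[: near each parameter s
   the curve read in a chart extends to a smooth curve g on an open subset of
   the line; the derivative at s of any such extension is the velocity. *)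
Definition smooth_ray_embedding (gamma : ray R -> M) : Prop :=
  topological_embedding gamma /\
  forall (s : ray R) (i : chart M), dom i (gamma s) ->
    exists (V : set R) (g : R -> 'rV[R]_(n.*2.+2)),
      [/\ open V, V (set_val s), smooth_on V g,
          forall t : ray R, V (set_val t) ->
            dom i (gamma t) /\ g (set_val t) = coord i (gamma t) &
          'D_1 g (set_val s) != 0].

Definition proper_embedding (gamma : ray R -> M) : Prop :=
  smooth_ray_embedding gamma /\
  forall K : set M, compact K -> compact (gamma @^-1` K).

Definition width (gamma : ray R -> M) : \bar R :=
  ereal_sup [set (pi * e%:num ^+ 2)%:E | e in [set e : {posnum R} |
    exists j : standard_cylinder n e%:num -> M,
      symplectic_embedding j /\ j \o gamma0_in n e = gamma]].

Definition wide (gamma : ray R -> M) : Prop := (0 < width gamma)%E.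

End Wideness.

(* Main.v *)
(** On R^{2n} write x = x_n, z' for the first n - 1 pairs of coordinates and Y for
    the conjugate momentum of x.  The generating function
    S(z', x, Y) = x Y - Y B(x, |z'|^2 + Y^2), with r = |z'|^2 + Y^2, yields two maps
      alpha (z', x, Y) = (z', x, Y (1 - B_x)),
      beta (z', x, Y) = (e^{2 i Y B_r} z', x - B - 2 Y^2 B_r, Y)
    that pull omega_0 back to the same form.  Both are injective, with invertible
    differential, as soon as 1 - B_x - 2 v B_xr > 0 for 0 <= v <= r.  If moreover
    x - B(x, 0) increases to an unattained limit 0 while B(., r) vanishes for large x
    whenever r > 0, then alpha is onto whereas beta misses exactly the ray
    z' = 0, Y = 0, x >= 0.  Hence beta o alpha^{-1} is a symplectomorphism of R^{2n}
    onto the complement of the ray.  It is the identity off the support of B, which can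
    be confined to a neighbourhood of the ray that gets thinner and thinner towards
    infinity.  As gamma is proper, the image of such a neighbourhood under the
    embedding of the cylinder is closed in M, so the conjugated map extends by the
    identity to the required symplectomorphism of M onto the complement of gamma. *)
Require Import Defs.
From HB Require Import structures.
From mathcomp Require Import all_boot all_order all_algebra.
From mathcomp Require Import all_classical all_reals all_analysis.
From mathcomp Require Import ring lra zify.
Import Defs.
Set Implicit Arguments.
Unset Strict Implicit.
Unset Printing Implicit Defensive.
Import Order.TTheory GRing.Theory Num.Theory.
Import numFieldNormedType.Exports.
Local Open Scope classical_set_scope.
Local Open Scope ring_scope.

(** * Iterated directional derivatives and smoothness *)

(** The maps alpha and beta read S in mixed coordinates, old x and new Y, so no implicit equation
    has to be solved; z' is rotated explicitly because S sees it only through $|z'|^2$. The obstacle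
    is the positivity of $1 - B_x - 2 v B_{xr}$. On the axis B(x, 0) grows like x, while the
    available neighbourhood of the ray may shrink arbitrarily fast, so B has to be cut off in r at
    radii that depend on x. Replacing one cut-off q by a thinner one while x crosses a unit interval
    near k puts into $2 v B_{xr}$ a term of size k times $r q'(r)$. For an ordinary cut-off $r
    q'(r)$ does not become small with the radius, being invariant under rescaling of r. Therefore
    the cut-off is made in the logarithm of r: spreading it from $\eta$ to $e^{1/\rho}\eta$ makes $r
    q'(r)$ of order $\rho$. The rate $\rho$ is taken of order 1/k, and $\eta$ stays free to be as
    small as the geometry of M demands. The corresponding term in $B_x$ has the favourable sign,
    because the cut-offs decrease with k. *)

Lemma open_preimage_on {S T : topologicalType} (f : S -> T) (A : set S) (B : set T) :
  open A -> open B -> (forall x, A x -> {for x, continuous f}) -> open (A `&` f @^-1` B).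
Proof.
move=> oA oB cf; rewrite openE => x [Ax Bfx].
apply: filterI; first exact: open_nbhs_nbhs.
by apply: (cf x Ax); exact: open_nbhs_nbhs.
Qed.

Lemma near_preimage {S T : topologicalType} (f : S -> T) x (B : set T) :
  {for x, continuous f} -> open B -> B (f x) -> \forall y \near x, B (f y).
Proof. by move=> cf oB Bfx; apply: cf; exact: open_nbhs_nbhs. Qed.

Section Differentials.
Context {R : realType} {V W : normedModType R}.

(** Replaces the little-o by an inequality, the form in which inverse maps and flat functions at 0
    are differentiated below. *)
Lemma is_diff_eps (f : V -> W) x (L : {linear V -> W}) : continuous L ->
  (forall e, 0 < e -> \forall h \near (0 : V), `|f (h + x) - f x - L h| <= e * `|h|) ->
  is_diff x f L.
Proof.
move=> cL fL.
have H : f \o shift x = cst (f x) + L +o_ (0 : V) id.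
  apply/eqaddoP => e e0; near=> h.
  have : `|f (h + x) - f x - L h| <= e * `|h| by near: h; exact: fL.
  by rewrite -[f (h + x) - _ - _]addrA -opprD.
have dE := diff_unique cL H.
by split => //; apply/diff_locallyP; rewrite dE.
Unshelve. all: by end_near. Qed.

Lemma diff_eps (f : V -> W) x : differentiable f x ->
  forall e, 0 < e -> \forall h \near (0 : V),
    `|f (h + x) - f x - 'd f x h| <= e * `|h|.
Proof.
move=> /diff_locally H e e0.
move/eqaddoP : H => /(_ e e0) H; near=> h.
have : `|((f \o shift x) - (cst (f x) + 'd f x)) h| <= e * `|h| by near: h.
by rewrite -addrA -opprD.
Unshelve. all: by end_near. Qed.

Lemma near_eq_differentiable (f g : V -> W) x : {near x, f =1 g} ->
  differentiable f x -> differentiable g x.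
Proof.
move=> fg df; suff : is_diff x g ('d f x) by case.
apply: is_diff_eps; first exact: diff_continuous.
move=> e e0; have H := diff_eps df e0.
have fgx : f x = g x by exact: (nbhs_singleton fg).
have fgs : \forall h \near (0 : V), f (h + x) = g (h + x).
  by move: fg; rewrite (near_shift (0 : V)) /=; apply: filterS => h; rewrite /= subr0.
near=> h; rewrite -(near fgs h) // -fgx.
by near: h.
Unshelve. all: by end_near. Qed.

Lemma near_eq_diff (f g : V -> W) x v : {near x, f =1 g} ->
  differentiable f x -> 'd g x v = 'd f x v.
Proof.
move=> fg df; have dg := near_eq_differentiable fg df.
by rewrite -!deriveE // (near_eq_derive v fg).
Qed.

Lemma continuous_near_dist (f : V -> W) x e : {for x, continuous f} -> 0 < e ->
  \forall y \near x, `|f y - f x| <= e.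
Proof. by move=> /cvgrPdistC_le; apply. Qed.

End Differentials.

Section CkCalculus.
Context {R : realType} {V : normedModType R}.
Implicit Types (W : normedModType R) (U : set V).

Lemma open_near U x (P : V -> Prop) : open U -> U x ->
  (forall y, U y -> P y) -> \forall y \near x, P y.
Proof. by move=> oU Ux UP; apply: filterS UP _; exact: open_nbhs_nbhs. Qed.

Lemma Ck_on_ext W k U (f g : V -> W) : open U -> (forall x, U x -> f x = g x) ->
  Ck_on k U f -> Ck_on k U g.
Proof.
move=> oU; elim: k f g => [|k IH] f g fg /=.
  move=> cf x Ux; have fgx := fg _ Ux.
  rewrite /prop_for /continuous_at -fgx; apply: cvg_trans (cf x Ux).
  by apply: near_eq_cvg; apply: open_near oU Ux _ => y Uy; rewrite fg.
move=> [df Df]; split => [x Ux|v].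
  by apply: near_eq_differentiable (df x Ux); exact: open_near oU Ux _.
apply: (IH ('D_v f)) (Df v) => x Ux.
by apply: near_eq_derive; exact: open_near oU Ux _.
Qed.

Lemma Ck_on_sub W k U U' (f : V -> W) : U' `<=` U -> Ck_on k U f -> Ck_on k U' f.
Proof.
move=> U'U; elim: k f => [|k IH] f /= => [cf x /U'U /cf //|[df Df]].
by split => [x /U'U /df //|v]; exact: IH.
Qed.

(** [Ck_on] consists of pointwise conditions on iterated derivatives taken in the whole space, so it
    can be checked around each point separately. *)
Lemma Ck_on_local W k U (f : V -> W) :
  (forall x, U x -> exists V', [/\ open V', V' x & Ck_on k V' f]) -> Ck_on k U f.
Proof.
elim: k f => [|k IH] f /= H.
  by move=> x /H [V' [_ V'x]]; apply.
split => [x /H[V' [_ V'x [+ _]]]|v]; first exact.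
by apply: IH => x /H[V' [oV' V'x [_ Df]]]; exists V'.
Qed.

Lemma Ck_onW W k U (f : V -> W) : Ck_on k.+1 U f -> Ck_on k U f.
Proof.
elim: k f => [|k IH] f /= [df Df].
  by move=> x Ux; exact/differentiable_continuous/df.
by split => // v; exact: IH (Df v).
Qed.

Lemma Ck_on_cst W k U (c : W) : Ck_on k U (cst c).
Proof.
elim: k c => [|k IH] c /=; first by move=> x _; exact: cst_continuous.
split => [x _|v]; first exact: differentiable_cst.
suff -> : 'D_v (cst c) = cst (0 : W) :> (V -> W) by [].
by apply/funext => x; rewrite derive_cst.
Qed.

Lemma Ck_on_linear W k U (L : {linear V -> W}) : continuous L -> Ck_on k U L.
Proof.
case: k => [|k] cL /=; first by move=> x _; exact: cL.
split => [x _|v]; first exact: linear_differentiable.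
suff -> : 'D_v L = cst (L v) :> (V -> W) by exact: Ck_on_cst.
apply/funext => x; rewrite deriveE; last exact: linear_differentiable.
by rewrite diff_lin.
Qed.

Lemma Ck_onD W k U (f g : V -> W) : open U ->
  Ck_on k U f -> Ck_on k U g -> Ck_on k U (fun x => f x + g x).
Proof.
move=> oU; elim: k f g => [|k IH] f g /=.
  by move=> cf cg x Ux; apply: cvgD; [exact: cf|exact: cg].
move=> [df Df] [dg Dg]; split => [x Ux|v].
  by apply: differentiableD; [exact: df|exact: dg].
apply: Ck_on_ext (IH _ _ (Df v) (Dg v)) => // x Ux.
rewrite -[RHS]/('D_v (f + g) x) deriveD //; apply: diff_derivable; [exact: df|exact: dg].
Qed.

Lemma Ck_onL W W' k U (f : V -> W) (L : {linear W -> W'}) : open U -> continuous L ->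
  Ck_on k U f -> Ck_on k U (L \o f).
Proof.
move=> oU cL; elim: k f => [|k IH] f /=.
  by move=> cf x Ux; apply: continuous_comp; [exact: cf|exact: cL].
move=> [df Df]; split => [x Ux|v].
  by apply: differentiable_comp; [exact: df|exact: linear_differentiable].
apply: Ck_on_ext (IH _ (Df v)) => // x Ux.
have dfx := df x Ux; have dLx := linear_differentiable (f x) cL.
rewrite /= [RHS]deriveE; last exact: differentiable_comp.
by rewrite diff_comp // diff_lin //= deriveE.
Qed.

Lemma Ck_onM k U (f g : V -> R) : open U ->
  Ck_on k U f -> Ck_on k U g -> Ck_on k U (fun x => f x * g x).
Proof.
move=> oU; elim: k f g => [|k IH] f g.
  by move=> cf cg x Ux; apply: cvgM; [exact: cf|exact: cg].
move=> Hf Hg; have [df Df] := Hf; have [dg Dg] := Hg; split => [x Ux|v].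
  by apply: differentiableM; [exact: df|exact: dg].
apply: Ck_on_ext (Ck_onD oU (IH _ _ (Ck_onW Hf) (Dg v)) (IH _ _ (Ck_onW Hg) (Df v))) => // x Ux.
by rewrite -[RHS]/('D_v (f * g) x) deriveM //; apply: diff_derivable; [exact: df|exact: dg].
Qed.

Lemma Ck_on_sum W k U (I : Type) (r : seq I) (P : pred I) (F : I -> V -> W) : open U ->
  (forall i, P i -> Ck_on k U (F i)) -> Ck_on k U (fun x => \sum_(i <- r | P i) F i x).
Proof.
move=> oU HF; elim: r => [|i r IH].
  apply: Ck_on_ext (Ck_on_cst k U (0 : W)) => // x _.
  by rewrite big_nil.
case Pi : (P i).
  apply: Ck_on_ext (Ck_onD oU (HF _ Pi) IH) => // x _; by rewrite big_cons Pi.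
by apply: Ck_on_ext IH => // x _; rewrite big_cons Pi.
Qed.

Lemma Ck_on_prod k U (I : Type) (r : seq I) (P : pred I) (F : I -> V -> R) : open U ->
  (forall i, P i -> Ck_on k U (F i)) -> Ck_on k U (fun x => \prod_(i <- r | P i) F i x).
Proof.
move=> oU HF; elim: r => [|i r IH].
  by apply: Ck_on_ext (Ck_on_cst k U (1 : R)) => // x _; rewrite big_nil.
case Pi : (P i).
  by apply: Ck_on_ext (Ck_onM oU (HF _ Pi) IH) => // x _; rewrite big_cons Pi.
by apply: Ck_on_ext IH => // x _; rewrite big_cons Pi.
Qed.

Lemma Ck_on_coord m k U (f : V -> 'rV[R]_m) i : open U ->
  Ck_on k U f -> Ck_on k U (fun x => f x 0 i).
Proof.
move=> oU Hf.
have cl : linear (fun N : 'rV[R]_m => N 0 i) by move=> a u v; rewrite !mxE.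
pose Lc := GRing.isLinear.Build _ _ _ _ _ cl.
pose L : {linear 'rV[R]_m -> R} := HB.pack (fun N : 'rV[R]_m => N 0 i) Lc.
exact: (Ck_onL (L := L) oU (@coord_continuous _ _ _ _ _) Hf).
Qed.

Lemma Ck_on_row m k U (f : V -> 'rV[R]_m) : open U ->
  (forall i, Ck_on k U (fun x => f x 0 i)) -> Ck_on k U f.
Proof.
move=> oU Hf.
have H i : Ck_on k U (fun x => f x 0 i *: delta_mx 0 i : 'rV[R]_m).
  have cl : linear (fun a : R => a *: delta_mx 0 i : 'rV[R]_m).
    by move=> a u v; rewrite scalerDl scalerA.
  pose Lc := GRing.isLinear.Build _ _ _ _ _ cl.
  pose L : {linear R -> 'rV[R]_m} := HB.pack (fun a : R => a *: delta_mx 0 i : 'rV[R]_m) Lc.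
  by apply: (Ck_onL (L := L) oU _ (Hf i)) => /=; exact: scalel_continuous.
apply: Ck_on_ext (@Ck_on_sum _ k U _ (index_enum 'I_m) xpredT _ oU (fun i _ => H i)) => // x _.
by rewrite [RHS]row_sum_delta.
Qed.

End CkCalculus.

Lemma diff_compE {R : realType} {U V W : normedModType R} (f : U -> V) (g : V -> W) x u :
  differentiable f x -> differentiable g (f x) ->
  'd (fun y => g (f y)) x u = 'd g (f x) ('d f x u).
Proof. by move=> df dg; rewrite diff_comp. Qed.

Lemma diff_comp3E {R : realType} {U V W X : normedModType R} (f : U -> V) (g : V -> W)
    (h : W -> X) x y u :
  f x = y -> differentiable f x -> differentiable g y -> differentiable h (g y) ->
  'd (fun z => h (g (f z))) x u = 'd h (g y) ('d g y ('d f x u)).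
Proof.
move=> <- df dg dh.
have dgf : differentiable (fun z => g (f z)) x by exact: differentiable_comp.
apply: etrans (diff_compE u dgf dh) _.
by apply: (congr1 ('d h (g (f x)))); exact: diff_compE.
Qed.

Section Compositions.
Context {R : realType} {V : normedModType R}.
Implicit Types (U : set V).

Lemma diff_sum_partial m (g : 'rV[R]_m -> R) y w : differentiable g y ->
  'd g y w = \sum_i w 0 i * 'D_(delta_mx 0 i) g y.
Proof.
move=> dg; rewrite [in LHS](row_sum_delta w) linear_sum; apply: eq_bigr => i _.
by rewrite linearZ /= deriveE.
Qed.

Lemma derive_coord m (f : V -> 'rV[R]_m) x v i : differentiable f x ->
  'D_v f x 0 i = 'D_v (fun y => f y 0 i) x.
Proof.
by move=> df; rewrite derive_mx ?mxE //; exact: diff_derivable.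
Qed.

(** The chain rule writes the derivative as a finite sum of products of a derivative of a coordinate
    of [f] with a partial derivative of [g] composed with [f]; the induction on [k] applies to the
    latter. *)
Lemma Ck_on_comp m k U (U' : set 'rV[R]_m) (f : V -> 'rV[R]_m) (g : 'rV[R]_m -> R) :
  open U -> (forall x, U x -> U' (f x)) ->
  Ck_on k U f -> Ck_on k U' g -> Ck_on k U (g \o f).
Proof.
move=> oU UU'; elim: k g => [|k IH] g.
  by move=> cf cg x Ux; apply: continuous_comp; [exact: cf|exact/cg/UU'].
move=> Hf [dg Dg]; have [df Df] := Hf; split => [x Ux|v].
  by apply: differentiable_comp; [exact: df|exact/dg/UU'].
have H i : Ck_on k U (fun x => 'D_v f x 0 i * ('D_(delta_mx 0 i) g \o f) x).
  apply: Ck_onM => //; first exact: (Ck_on_coord i oU (Df v)).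
  by apply: IH; [exact: Ck_onW|exact: Dg].
apply: Ck_on_ext (@Ck_on_sum _ _ _ k U _ (index_enum 'I_m) xpredT _ oU (fun i _ => H i)) => // x Ux.
have dfx := df x Ux; have dgx := dg _ (UU' x Ux).
rewrite [RHS]deriveE; last exact: differentiable_comp.
rewrite diff_comp //= diff_sum_partial //; apply: eq_bigr => i _.
by rewrite deriveE.
Qed.

Lemma Ck_on_compR k U (U' : set R) (f : V -> R) (g : R -> R) :
  open U -> (forall x, U x -> U' (f x)) ->
  Ck_on k U f -> Ck_on k U' g -> Ck_on k U (g \o f).
Proof.
move=> oU UU'; elim: k g => [|k IH] g.
  by move=> cf cg x Ux; apply: continuous_comp; [exact: cf|exact/cg/UU'].
move=> Hf [dg Dg]; have [df Df] := Hf; split => [x Ux|v].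
  by apply: differentiable_comp; [exact: df|exact/dg/UU'].
have H : Ck_on k U (fun x => 'D_v f x * ('D_1 g \o f) x).
  by apply: Ck_onM; [|exact: Df|apply: IH; [exact: Ck_onW|exact: Dg]].
apply: Ck_on_ext H => // x Ux.
have dfx := df x Ux; have dgx := dg _ (UU' x Ux).
rewrite [RHS]deriveE; last exact: differentiable_comp.
by rewrite diff_comp //= diff1E //= derive1E deriveE.
Qed.

End Compositions.

Section OneVariable.
Context {R : realType}.

Lemma Ck_on_derive1 k (U : set R) (f f' : R -> R) : open U ->
  (forall x, U x -> is_derive x 1 f (f' x)) -> Ck_on k U f' -> Ck_on k.+1 U f.
Proof.
move=> oU df Hf'; have dif x : U x -> differentiable f x.
  by move=> /df [? _]; exact/derivable1_diffP.
split => // v; apply: Ck_on_ext (Ck_onM oU (Ck_on_cst k U v) Hf') => // x Ux.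
have dfx := dif x Ux; have [_ <-] := df x Ux.
by rewrite [RHS]deriveE // diff1E // derive1E.
Qed.

End OneVariable.

Section SmoothCalculus.
Context {R : realType} {V : normedModType R}.
Implicit Types (W : normedModType R) (U : set V).

Lemma smooth_on_ext W U (f g : V -> W) : open U -> (forall x, U x -> f x = g x) ->
  smooth_on U f -> smooth_on U g.
Proof. by move=> oU fg Hf k; exact: Ck_on_ext (Hf k). Qed.

Lemma smooth_on_sub W U U' (f : V -> W) : U' `<=` U -> smooth_on U f -> smooth_on U' f.
Proof. by move=> UU' Hf k; exact: Ck_on_sub (Hf k). Qed.

Lemma smooth_on_local W U (f : V -> W) :
  (forall x, U x -> exists V', [/\ open V', V' x & smooth_on V' f]) -> smooth_on U f.
Proof.
by move=> H k; apply: Ck_on_local => x /H [V' [oV V'x Hf]]; exists V'; split.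
Qed.

Lemma smooth_on_differentiable W U (f : V -> W) x : smooth_on U f -> U x ->
  differentiable f x.
Proof. by move=> /(_ 1%N) [df _] /df. Qed.

Lemma smooth_on_continuous W U (f : V -> W) x : smooth_on U f -> U x ->
  {for x, continuous f}.
Proof. by move=> /(_ 0%N) /[apply]. Qed.

Lemma smooth_on_derive W U (f : V -> W) v : smooth_on U f -> smooth_on U ('D_v f).
Proof. by move=> Hf k; have [_ Df] := Hf k.+1; exact: Df. Qed.

Lemma smooth_on_cst W U (c : W) : smooth_on U (cst c).
Proof. by move=> k; exact: Ck_on_cst. Qed.

Lemma smooth_onD W U (f g : V -> W) : open U ->
  smooth_on U f -> smooth_on U g -> smooth_on U (fun x => f x + g x).
Proof. by move=> oU Hf Hg k; exact: Ck_onD. Qed.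

Lemma smooth_onM U (f g : V -> R) : open U ->
  smooth_on U f -> smooth_on U g -> smooth_on U (fun x => f x * g x).
Proof. by move=> oU Hf Hg k; exact: Ck_onM. Qed.

Lemma smooth_onN U (f : V -> R) : open U -> smooth_on U f -> smooth_on U (fun x => - f x).
Proof.
move=> oU Hf; have H := smooth_onM oU (smooth_on_cst U (-1 : R)) Hf.
have E x : U x -> cst (-1) x * f x = - f x.
  by rewrite /= mulN1r.
exact: (smooth_on_ext oU E H).
Qed.

Lemma smooth_onB U (f g : V -> R) : open U ->
  smooth_on U f -> smooth_on U g -> smooth_on U (fun x => f x - g x).
Proof. by move=> oU Hf Hg; apply: smooth_onD => //; exact: smooth_onN. Qed.

Lemma smooth_on_sum W U (I : Type) (r : seq I) (P : pred I) (F : I -> V -> W) : open U ->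
  (forall i, P i -> smooth_on U (F i)) -> smooth_on U (fun x => \sum_(i <- r | P i) F i x).
Proof. by move=> oU HF k; apply: Ck_on_sum => // i Pi; exact: HF. Qed.

Lemma smooth_on_coord m U (f : V -> 'rV[R]_m) i : open U ->
  smooth_on U f -> smooth_on U (fun x => f x 0 i).
Proof. by move=> oU Hf k; exact: Ck_on_coord. Qed.

Lemma smooth_on_row m U (f : V -> 'rV[R]_m) : open U ->
  (forall i, smooth_on U (fun x => f x 0 i)) -> smooth_on U f.
Proof. by move=> oU Hf k; apply: Ck_on_row => // i; exact: Hf. Qed.

Lemma smooth_on_compR U (U' : set R) (f : V -> R) (g : R -> R) :
  open U -> (forall x, U x -> U' (f x)) ->
  smooth_on U f -> smooth_on U' g -> smooth_on U (fun x => g (f x)).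
Proof. by move=> oU UU' Hf Hg k; exact: (Ck_on_compR oU UU' (Hf k) (Hg k)). Qed.

Lemma smooth_on_comp m p U (U' : set 'rV[R]_m) (f : V -> 'rV[R]_m)
  (g : 'rV[R]_m -> 'rV[R]_p) :
  open U -> open U' -> (forall x, U x -> U' (f x)) ->
  smooth_on U f -> smooth_on U' g -> smooth_on U (fun x => g (f x)).
Proof.
move=> oU oU' UU' Hf Hg; apply: smooth_on_row => // i k.
by apply: (Ck_on_comp (g := fun y => g y 0 i) oU UU' (Hf k)); exact: Ck_on_coord.
Qed.

End SmoothCalculus.

Lemma smooth_on_id {R : realType} {V : normedModType R} (U : set V) : smooth_on U idfun.
Proof. by move=> k; apply: (@Ck_on_linear R V V k U idfun) => x; exact: cvg_id. Qed.

Lemma Ck_on_inv {R : realType} k : Ck_on k [set x : R | x != 0] (@GRing.inv R).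
Proof.
have oU : open [set x : R | x != 0].
  exact: open_neq.
elim: k => [|k IH].
  by move=> x /= x0; exact: inv_continuous.
have H : Ck_on k [set x : R | x != 0] (fun x => - 1 * (x^-1 * x^-1)).
  by apply: Ck_onM => //; [exact: Ck_on_cst|exact: Ck_onM].
apply: Ck_on_derive1 H => // x /= x0.
apply: is_derive_eq; first exact: is_deriveV.
by rewrite /= mulN1r -expr2 exprVn /GRing.scale /= mulr1.
Qed.

Lemma smooth_on_inv {R : realType} {V : normedModType R} (U : set V) (f : V -> R) : open U ->
  (forall x, U x -> f x != 0) -> smooth_on U f -> smooth_on U (fun x => (f x)^-1).
Proof.
move=> oU f0 Hf; apply: (smooth_on_compR oU f0 Hf) => k; exact: Ck_on_inv.
Qed.

(** * The inverse function theorem *)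

Section RowNorm.
Context {R : realType} {d : nat}.
Implicit Types x : 'rV[R]_d.

Lemma coord_le_norm x i : `|x 0 i| <= `|x|.
Proof.
rewrite [leRHS]/Num.Def.normr /= mx_normrE.
exact: (le_bigmax _ (fun ij : 'I_1 * 'I_d => `|x ij.1 ij.2|) (0, i)).
Qed.

Lemma norm_le_coord x c : 0 <= c -> (forall i, `|x 0 i| <= c) -> `|x| <= c.
Proof.
move=> c0 H; rewrite [leLHS]/Num.Def.normr /= mx_normrE; apply: bigmax_le => //= -[i j] _ /=.
by rewrite (ord1 i).
Qed.

Lemma norm_mulmx_le e (B : 'M[R]_(d, e)) :
  exists2 K, 0 < K & forall y : 'rV[R]_d, `|y *m B| <= K * `|y|.
Proof.
have S0 : 0 <= \sum_i \sum_j `|B i j| by apply: sumr_ge0 => i _; exact: sumr_ge0.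
exists (1 + \sum_i \sum_j `|B i j|); first by rewrite ltr_pwDl.
move=> y; rewrite [leLHS]/Num.Def.normr /= mx_normrE.
apply: bigmax_le => [|[i j] _ /=].
  by apply: mulr_ge0 => //; rewrite addr_ge0.
rewrite (ord1 i) mxE (le_trans (ler_norm_sum _ _ _))//.
apply: (@le_trans _ _ (\sum_k \sum_l `|B k l| * `|y|)).
  apply: ler_sum => k _; rewrite normrM mulrC (bigD1 j) //=.
  rewrite -[leLHS]addr0 lerD //; last by apply: sumr_ge0 => l _; rewrite mulr_ge0.
  by rewrite ler_wpM2l // coord_le_norm.
rewrite (eq_bigr (fun k => (\sum_l `|B k l|) * `|y|)); last by move=> k _; rewrite mulr_suml.
by rewrite -mulr_suml ler_wpM2r // lerDr.
Qed.

Lemma continuous_mulmx e (B : 'M[R]_(d, e)) : continuous (fun y : 'rV[R]_d => y *m B).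
Proof.
have [K K0 HK] := norm_mulmx_le B.
move=> x; apply/(@cvgrPdist_le _ _ _ (nbhs x)) => eps e0.
near=> y; rewrite -mulmxBl (le_trans (HK _)) // -ler_pdivlMl //.
near: y; apply/nbhs_ballP; exists (K^-1 * eps) => [|y] /=.
  by rewrite mulr_gt0 // invr_gt0.
by rewrite -ball_normE /= => /ltW.
Unshelve. all: by end_near. Qed.

End RowNorm.

Section MeanValue.
Context {R : realType}.

Lemma is_derive_line {V W : normedModType R} (g : V -> W) x v (t : R) :
  differentiable g (t *: v + x) ->
  is_derive t 1 (fun s => g (s *: v + x)) ('D_v g (t *: v + x)).
Proof.
move=> dg; have E h : (h *: (1 : R) + t) *: v + x = h *: v + (t *: v + x).
  by rewrite scalerDl -scalerA scale1r addrA.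
have F : (fun h : R => h^-1 *: (((fun s => g (s *: v + x)) \o shift t) (h *: 1) - g (t *: v + x)))
    = (fun h => h^-1 *: ((g \o shift (t *: v + x)) (h *: v) - g (t *: v + x))).
  by apply/funext => h /=; rewrite E.
apply: DeriveDef; first by rewrite /derivable F; exact: diff_derivable.
by rewrite /derive F.
Qed.

(** Strict differentiability: the mean value theorem is applied to each coordinate along the segment
    from [y] to [x], which stays in the convex ball, where the partial derivatives differ little
    from those at [x0]. *)
Lemma strict_diff {d : nat} (U : set 'rV[R]_d) (f : 'rV[R]_d -> 'rV[R]_d) x0 e :
  open U -> smooth_on U f -> U x0 -> 0 < e ->
  exists2 r, 0 < r & ball x0 r `<=` U /\ forall x y, ball x0 r x -> ball x0 r y ->
    `|f x - f y - 'd f x0 (x - y)| <= e * `|x - y|.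
Proof.
move=> oU Hf Ux0 e0.
have d0 : 0 < d.+1%:R :> R by rewrite ltr0n.
have nU : \forall p \near x0, U p by exact: (open_nbhs_nbhs (conj oU Ux0)).
(* The error is shared among the [d] partial derivatives; the divisor [d.+1] is nonzero in dimension
   0 too. *)
have nD : \forall p \near x0, forall ij : 'I_d * 'I_d,
    `|'D_(delta_mx 0 ij.1) f p 0 ij.2 - 'D_(delta_mx 0 ij.1) f x0 0 ij.2| <= e / d.+1%:R.
  apply: (@filter_forall _ _ _ (nbhs x0) (nbhs_filter x0)) => -[i j] /=.
  have C := smooth_on_continuous (smooth_on_coord j oU (smooth_on_derive (delta_mx 0 i) Hf)) Ux0.
  by apply: (continuous_near_dist C); exact: divr_gt0.
have /nbhs_ballP[r /= r0 Hr] := @filterI _ _ (nbhs_filter x0) _ _ nU nD.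
exists r => //; split => [p /Hr[]//|x y xr yr].
set v := x - y.
have seg s : 0 <= s <= 1 -> ball x0 r (s *: v + y).
  move=> /andP[s0 s1]; rewrite -ball_normE /=.
  have -> : x0 - (s *: v + y) = s *: (x0 - x) + (1 - s) *: (x0 - y).
    rewrite /v !scalerBr scalerBl scalerBl !scale1r.
    by apply/matrixP => a b; rewrite !mxE; ring.
  move: xr yr; rewrite -!ball_normE /= => xr yr.
  rewrite (le_lt_trans (ler_normD _ _)) // !normrZ (ger0_norm s0) ger0_norm ?subr_ge0 //.
  set A := `|x0 - x| in xr *; set B := `|x0 - y| in yr *.
  have [AB|BA] := leP A B.
    by apply: le_lt_trans yr; nra.
  by apply: le_lt_trans xr; nra.
have Ud p : ball x0 r p -> differentiable f p.
  by move=> /Hr [Up _]; exact: smooth_on_differentiable Hf Up.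
apply: norm_le_coord; first by rewrite mulr_ge0 // ltW.
move=> j; rewrite !mxE.
have dl (s : R) : s \in `]0, 1[%R ->
    is_derive s 1 (fun s => f (s *: v + y) 0 j) ('D_v f (s *: v + y) 0 j).
  rewrite in_itv /= => /andP[s0 s1].
  have dfs : differentiable f (s *: v + y) by apply/Ud/seg; rewrite !ltW.
  rewrite derive_coord //; apply: (is_derive_line (g := fun p => f p 0 j)).
  apply: (differentiable_comp (f := f) (g := fun p : 'rV[R]_d => p 0 j)) => //.
  exact: differentiable_coord.
have cl : {within `[0, 1], continuous (fun s : R => f (s *: v + y) 0 j)}.
  apply: continuous_in_subspaceT => s; rewrite inE /= in_itv /= => s01.
  apply: (continuous_comp (f := fun s : R => f (s *: v + y)) (g := fun p : 'rV[R]_d => p 0 j));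
    last exact: coord_continuous.
  apply: (continuous_comp (f := fun s : R => s *: v + y) (g := f)).
    by apply: cvgD; [exact: scalel_continuous|exact: cvg_cst].
  by apply: differentiable_continuous; exact/Ud/seg.
have [c] := MVT (ltr01 : 0 < 1 :> R) dl cl.
rewrite in_itv /= subr0 mulr1 scale1r scale0r add0r /v subrK => /andP[c0 c1] ->.
set p := c *: _ + y; have pr : ball x0 r p by apply: seg; rewrite !ltW.
have [_ Hp] := Hr _ pr.
have Ud0 : differentiable f x0 by apply: Ud; exact: ballxx.
have dE q : differentiable f q -> 'D_v f q 0 j = \sum_i v 0 i * 'D_(delta_mx 0 i) f q 0 j.
  move=> dq; rewrite deriveE // [in LHS](row_sum_delta v) linear_sum summxE.
  by apply: eq_bigr => i _; rewrite linearZ mxE deriveE.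
have dE0 : ('d f x0 v : 'rV[R]_d) 0 j = \sum_i v 0 i * 'D_(delta_mx 0 i) f x0 0 j.
  by rewrite -(dE _ Ud0) (deriveE v Ud0).
rewrite (dE _ (Ud _ pr)) dE0.
rewrite -sumrB (le_trans (ler_norm_sum _ _ _)) //.
apply: (@le_trans _ _ (\sum_(i < d) `|v| * (e / d.+1%:R))).
  apply: ler_sum => i _; rewrite -mulrBr normrM ler_pM // ?coord_le_norm //.
  exact: (Hp (i, j)).
have H : e / d.+1%:R * d%:R <= e.
  by rewrite mulrAC ler_pdivrMr // ler_pM2l // ler_nat.
rewrite sumr_const card_ord -[leLHS]mulr_natr -[leLHS]mulrA [leRHS]mulrC.
by apply: ler_wpM2l.
Qed.

End MeanValue.

Section InverseFunction.
Context {R : realType} {d : nat}.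
Implicit Types (U : set 'rV[R]_d) (f : 'rV[R]_d -> 'rV[R]_d).

Definition regular_at f x := forall u, 'd f x u = 0 -> u = 0.

Lemma regular_jacobian f x : regular_at f x -> jacobian f x \in unitmx.
Proof.
move=> Hx; rewrite -row_free_unit -kermx_eq0.
apply/eqP/row_matrixP => i; rewrite row0; apply: Hx.
by rewrite -mul_rV_lin1 -row_mul mulmx_ker row0.
Qed.

Lemma diff_jacobian f x u : 'd f x u = u *m jacobian f x.
Proof. by rewrite /jacobian mul_rV_lin1. Qed.

(** An invertible Jacobian expands lengths by at least $1/K$, where $K$ bounds its inverse; strict
    differentiability with error $1/(2K)$ leaves half of this. *)
Lemma regular_local_bound U f x0 : open U -> smooth_on U f -> U x0 -> regular_at f x0 ->
  exists2 r, 0 < r & ball x0 r `<=` U /\ exists2 c, 0 < c &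
    forall x y, ball x0 r x -> ball x0 r y -> c * `|x - y| <= `|f x - f y|.
Proof.
move=> oU Hf Ux0 /regular_jacobian Ju.
have [K K0 HK] := norm_mulmx_le (invmx (jacobian f x0)).
have e0 : 0 < (2 * K)^-1 by rewrite invr_gt0 mulr_gt0.
have [r r0 [rU Hr]] := strict_diff oU Hf Ux0 e0.
exists r => //; split => //; exists ((2 * K)^-1) => // x y xr yr.
have := Hr x y xr yr; rewrite diff_jacobian.
have := HK ((x - y) *m jacobian f x0); rewrite mulmxK //.
set v := (x - y) *m _; set A := f x - f y => H1 H2.
have H3 : `|v| <= `|A| + `|A - v|.
  by rewrite -{1}(subKr A v) (le_trans (ler_normB _ _)).
have H4 : K^-1 * `|x - y| <= `|v| by rewrite ler_pdivrMl.
have -> : (2 * K)^-1 = 2^-1 * K^-1 by rewrite invfM.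
move: H2; rewrite invfM; set k := K^-1 in H4 *; set D := `|x - y| in H4 *.
by move=> H2; lra.
Qed.

(* For y close to [f x0] the squared Euclidean distance from [f x] to y is minimised over
   a small closed ball at an interior point; there the derivative vanishes, and since
   the differential is onto, [f x = y]. *)
Lemma regular_nbhs_image U f x0 : open U -> smooth_on U f -> U x0 ->
  (forall x, U x -> regular_at f x) -> nbhs (f x0) (f @` U).
Proof.
move=> oU Hf Ux0 Hreg.
have [r r0 [rU [c c0 Hc]]] := regular_local_bound oU Hf Ux0 (Hreg _ Ux0).
pose rho := r / 2.
have rho0 : 0 < rho by rewrite divr_gt0.
pose B := [set x : 'rV[R]_d | `|x0 - x| <= rho].
have Br x : B x -> ball x0 r x.
  rewrite -ball_normE /B /= => H; apply: le_lt_trans H _.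
  by rewrite /rho ltr_pdivrMr // ltr_pMr // ltr1n.
have Bc : compact B.
  apply: bounded_closed_compact.
    exists (`|x0| + rho); split; first exact: num_real.
    move=> M HM x Bx; apply: ltW; apply: le_lt_trans HM.
    have -> : x = x0 - (x0 - x) by rewrite subKr.
    by rewrite (le_trans (ler_normB _ _)) // lerD.
  have -> : B = closed_ball x0 rho by rewrite closed_ballE.
  exact: closed_ball_closed.
(* The divisor accommodates the maximum norm: on the sphere of radius [rho] some coordinate of
   [f x - y] exceeds $(d+1)\eta$, so the squared distance exceeds $(d+1)^2\eta^2$, whereas at the
   centre it is at most $d\,\eta^2$. *)
pose eta := c * rho / (d.+2%:R).
have d2 : 0 < d.+2%:R :> R by rewrite ltr0n.
have eta0 : 0 < eta by rewrite divr_gt0 // mulr_gt0.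
apply/nbhs_ballP; exists eta => //= y; rewrite -ball_normE /= => yeta.
pose E (x : 'rV[R]_d) : R := \sum_i (f x 0 i - y 0 i) ^+ 2.
have fd x : U x -> differentiable f x by move=> Ux; exact: smooth_on_differentiable Hf Ux.
have Ed x v : U x -> is_derive x v E (\sum_i 2 * (f x 0 i - y 0 i) * 'D_v f x 0 i).
  move=> Ux.
  have := @is_derive_sum _ _ _ d (fun i x => (f x 0 i - y 0 i) ^+ 2) x v
    (fun i => 2 * (f x 0 i - y 0 i) * 'D_v f x 0 i).
  have -> : \sum_(i < d) (fun x => (f x 0 i - y 0 i) ^+ 2) = E.
    by apply/funext => z; rewrite fct_sumE.
  apply=> i.
  have dfi : is_derive x v (fun x => f x 0 i) ('D_v f x 0 i).
    apply: DeriveDef; last by rewrite derive_coord //; exact: fd.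
    apply: diff_derivable; apply: (differentiable_comp (f := f) (g := fun p : 'rV[R]_d => p 0 i)).
      exact: fd.
    exact: differentiable_coord.
  have -> : (fun x => (f x 0 i - y 0 i) ^+ 2) = ((fun x => f x 0 i) - cst (y 0 i)) ^+ 2.
    by apply/funext => z; rewrite /= exprfctE.
  apply: is_derive_eq.
  by rewrite /= subr0 expr1 /GRing.scale /= !mulr_natl.
have Edif x : U x -> differentiable E x.
  move=> Ux.
  have -> : E = \sum_(i < d) ((fun x => f x 0 i) - cst (y 0 i)) ^+ 2.
    by apply/funext => z; rewrite fct_sumE; apply: eq_bigr => i _; rewrite exprfctE.
  apply: differentiable_sum => i; apply: differentiableX; apply: differentiableB => //.
  apply: (differentiable_comp (f := f) (g := fun p : 'rV[R]_d => p 0 i)).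
    exact: fd.
  exact: differentiable_coord.
have Ec : {within B, continuous E}.
  apply: continuous_in_subspaceT => x; rewrite inE => Bx.
  exact/differentiable_continuous/Edif/rU/Br.
have B0 : B !=set0 by exists x0; rewrite /B /= subrr normr0 ltW.
have [m] := EVT_min_rV B0 Bc Ec; rewrite inE => Bm minm.
have Ex0 : E x0 <= d%:R * eta ^+ 2.
  rewrite /E (le_trans (ler_sum _ (G := fun=> eta ^+ 2) _)) ?sumr_const ?card_ord ?mulr_natl //.
  move=> i _; rewrite -real_normK ?num_real // lerXn2r ?nnegrE // ?ltW //.
  apply: le_lt_trans yeta; have := coord_le_norm (f x0 - y) i; by rewrite !mxE.
have mint : `|x0 - m| < rho.
  rewrite lt_neqAle; apply/andP; split; last exact: Bm.
  apply/eqP => mrho.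
  have H1 : c * rho <= `|f x0 - f m|.
    by rewrite -mrho; apply: Hc; [exact: ballxx|exact: Br].
  have H2 : `|f x0 - f m| <= `|f x0 - y| + `|f m - y|.
    by rewrite -(subrKA y) (le_trans (ler_normD _ _)) // lerD2l distrC.
  have H3 : (d.+1%:R * eta) < `|f m - y|.
    have : c * rho = d.+2%:R * eta by rewrite /eta [RHS]mulrC divfK // gt_eqF.
    rewrite -[d.+2%:R]natr1; lra.
  have [i Hi] : exists i, d.+1%:R * eta < `|(f m - y) 0 i|.
    apply: contrapT => /forallNP Hn.
    have : `|f m - y| <= d.+1%:R * eta.
      apply: norm_le_coord; first by rewrite mulr_ge0 // ltW.
      by move=> i; rewrite leNgt; exact/negP/Hn.
    by rewrite leNgt H3.
  have H4 : (d.+1%:R * eta) ^+ 2 < E m.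
    apply: (@lt_le_trans _ _ ((f m 0 i - y 0 i) ^+ 2)).
      rewrite -[ltRHS]real_normK ?num_real // ltrXn2r // ?nnegrE ?mulr_ge0 // ?ltW //.
      by move: Hi; rewrite !mxE.
    by rewrite /E (bigD1 i) //= lerDl sumr_ge0 // => j _; exact: sqr_ge0.
  have := minm x0; rewrite inE => /(_ _); rewrite /B /= subrr normr0 => /(_ (ltW rho0)).
  apply/negP; rewrite -ltNge (le_lt_trans Ex0) // (le_lt_trans _ H4) //.
  have dd : d%:R <= d.+1%:R ^+ 2 :> R by rewrite -natrX ler_nat (leq_trans (leqnSn d)) // leq_pmull.
  move: (eta) dd => t dd; rewrite [leRHS]exprMn; apply: ler_wpM2r => //; exact: sqr_ge0.
have Um : U m by exact/rU/Br.
exists m => //; apply/eqP; rewrite -subr_eq0; apply/eqP.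
have Dm v : \sum_i 2 * (f m 0 i - y 0 i) * 'D_v f m 0 i = 0.
  have [t0 t00 Ht] : exists2 t0, 0 < t0 & forall t, `|t| < t0 -> B (t *: v + m).
    exists ((rho - `|x0 - m|) / (1 + `|v|)).
      by rewrite divr_gt0 ?subr_gt0 // ltr_pwDl.
    move=> t; rewrite ltr_pdivlMr; last by rewrite ltr_pwDl.
    move=> Ht; rewrite /B /=.
    have -> : x0 - (t *: v + m) = (x0 - m) - t *: v by rewrite opprD addrCA addrC.
    rewrite (le_trans (ler_normB _ _)) // normrZ.
    have : 0 <= `|t| by []. have : 0 <= `|v| by []. move: Ht; nra.
  have dg : is_derive (0 : R) 1 (fun s : R => E (s *: v + m)) 0.
    apply: (@derive1_at_min _ _ (- t0) t0 0).
    - by lra.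
    - move=> t; rewrite in_itv /= -ltr_norml => tt.
      have Ut : U (t *: v + m) by exact/rU/Br/Ht.
      by have [] := is_derive_line (Edif _ Ut).
    - by rewrite in_itv /=; lra.
    - move=> t; rewrite in_itv /= -ltr_norml => tt; rewrite scale0r add0r.
      by apply: minm; rewrite inE; exact: Ht.
  have := is_derive_line (g := E) (x := m) (v := v) (t := 0).
  rewrite scale0r add0r => /(_ (Edif _ Um)) [_].
  by have [_ ->] := dg; have [_ ->] := Ed _ v Um.
have surj : 'D_((f m - y) *m invmx (jacobian f m)) f m = f m - y.
  rewrite deriveE ?diff_jacobian ?mulmxKV //; last exact: fd.
  exact/regular_jacobian/Hreg.
have := Dm ((f m - y) *m invmx (jacobian f m)); rewrite surj.
have -> : \sum_i 2 * (f m 0 i - y 0 i) * (f m - y) 0 i = 2 * \sum_i (f m 0 i - y 0 i) ^+ 2.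
  by rewrite mulr_sumr; apply: eq_bigr => i _; rewrite !mxE; ring.
move=> /eqP; rewrite mulf_eq0 pnatr_eq0 /= psumr_eq0; last by move=> i _; exact: sqr_ge0.
move=> /allP H; apply/rowP => i; have := H i (mem_index_enum i).
by rewrite sqrf_eq0 !mxE => /eqP.
Qed.

Lemma regular_open_image U f : open U -> smooth_on U f ->
  (forall x, U x -> regular_at f x) -> open (f @` U).
Proof.
move=> oU Hf Hreg; rewrite openE => _ [x Ux <-].
exact: (regular_nbhs_image oU Hf Ux Hreg).
Qed.

Lemma smooth_on_det m U (A : 'rV[R]_d -> 'M[R]_m) : open U ->
  (forall i j, smooth_on U (fun x => A x i j)) -> smooth_on U (fun x => \det (A x)).
Proof.
move=> oU HA k; rewrite /determinant; apply: Ck_on_sum => // s _.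
apply: Ck_onM => //; first exact: Ck_on_cst.
by apply: Ck_on_prod => // i _; exact: HA.
Qed.

(** Cramer's rule: each entry is a cofactor divided by the determinant. *)
Lemma smooth_on_invmx m U (A : 'rV[R]_d -> 'M[R]_m) : open U ->
  (forall i j, smooth_on U (fun x => A x i j)) -> (forall x, U x -> A x \in unitmx) ->
  forall i j, smooth_on U (fun x => invmx (A x) i j).
Proof.
move=> oU HA HU i j.
have Hadj : smooth_on U (fun x => (\adj (A x)) i j).
  have H : smooth_on U (fun x => (-1) ^+ (j + i) * \det (row' j (col' i (A x)))).
    apply: smooth_onM => //; first exact: smooth_on_cst.
    apply: smooth_on_det => // a b k.
    by apply: Ck_on_ext (HA (lift j a) (lift i b) k) => // x _; rewrite !mxE.
  by move=> k; apply: Ck_on_ext (H k) => // x _; rewrite mxE /cofactor.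
have Hdet : smooth_on U (fun x => (\det (A x))^-1).
  apply: smooth_on_inv => //; last exact: smooth_on_det.
  by move=> x /HU; rewrite unitmxE unitfE.
move=> k; apply: Ck_on_ext (smooth_onM oU Hdet Hadj k) => // x Ux.
by rewrite /invmx (HU x Ux) [RHS]mxE.
Qed.

Section Inverse.
Variables (U : set 'rV[R]_d) (f g : 'rV[R]_d -> 'rV[R]_d).
Hypotheses (oU : open U) (Hf : smooth_on U f).
Hypotheses (Hreg : forall x, U x -> regular_at f x) (gK : forall x, U x -> g (f x) = x).

(** Put $h = f(z) - f(x)$. The linearisation error of [f] is at most $K^{-1} e c\,|z - x|$; the
    inverse matrix multiplies it by at most $K$, and $c\,|z - x| \le |h|$, which leaves $e\,|h|$.
    The local openness of [f] provides such a [z] in both balls for every small [h]. *)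
Lemma is_diff_inverse x : U x -> is_diff (f x) g (mulmxr (invmx (jacobian f x))).
Proof.
move=> Ux; have [r r0 [rU [c c0 Hc]]] := regular_local_bound oU Hf Ux (Hreg Ux).
apply: is_diff_eps; first exact: continuous_mulmx.
move=> e e0; have [K K0 HK] := norm_mulmx_le (invmx (jacobian f x)).
have e1 : 0 < K^-1 * e * c by rewrite !mulr_gt0 // invr_gt0.
have [r' r'0 [r'U Hr']] := strict_diff oU Hf Ux e1.
have nI : nbhs (f x) (f @` (ball x r `&` ball x r')).
  apply: (@regular_nbhs_image (ball x r `&` ball x r')).
  - by apply: openI; exact: ball_open.
  - by apply: smooth_on_sub Hf => z [] /rU.
  - by split; exact: ballxx.
  - by move=> z [] /rU /Hreg.
have : \forall h \near (0 : 'rV[R]_d), (f @` (ball x r `&` ball x r')) (h + f x).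
  have /nbhs_ballP[s /= s0 Hs] := nI; apply/nbhs_ballP; exists s => // h hs; apply: (Hs (h + f x)).
  by move: hs; rewrite -!ball_normE /= sub0r normrN opprD addrCA subrr addr0 normrN.
apply: filterS => h [z [zr zr'] fz]; rewrite -fz gK; last exact: rU.
have -> : h = f z - f x by rewrite fz addrK.
rewrite gK //= -{1}(mulmxK (regular_jacobian (Hreg Ux)) (z - x)) -mulmxBl.
rewrite (le_trans (HK _)) // -ler_pdivlMl // -normrN opprB -diff_jacobian.
apply: le_trans (Hr' _ _ zr' (ballxx x r'0)) _.
rewrite -!mulrA; apply: ler_wpM2l; first by rewrite ltW // invr_gt0.
apply: ler_wpM2l; first exact: ltW.
by apply: Hc => //; exact: ballxx.
Qed.

(** Bootstrapping: the differential of [g] is the inverse Jacobian of [f] composed with [g], so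
    class $C^k$ of [g] gives class $C^k$ of its derivatives. *)
Lemma smooth_on_inverse : smooth_on (f @` U) g.
Proof.
have oV := regular_open_image oU Hf Hreg.
have dg y : (f @` U) y -> differentiable g y.
  by move=> [x Ux <-]; have [] := is_diff_inverse Ux.
have HJ : forall i j, smooth_on U (fun x => jacobian f x i j).
  move=> i j k; apply: Ck_on_ext (smooth_on_coord j oU (smooth_on_derive (delta_mx 0 i) Hf) k) => // x Ux.
  by rewrite deriveE ?mxE //; exact: smooth_on_differentiable Hf Ux.
have HI := smooth_on_invmx oU HJ (fun x Ux => regular_jacobian (Hreg Ux)).
elim=> [y Vy|k IH]; first exact/differentiable_continuous/dg.
split => // v; apply: Ck_on_row => // j.
have H i : Ck_on k (f @` U) (fun y => v 0 i * ((fun x => invmx (jacobian f x) i j) \o g) y).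
  apply: Ck_onM => //; first exact: Ck_on_cst.
  apply: (Ck_on_comp oV _ IH (HI i j k)) => _ [x Ux <-]; by rewrite gK.
apply: Ck_on_ext (@Ck_on_sum _ _ _ k _ _ (index_enum 'I_d) xpredT _ oV (fun i _ => H i)) => // _ [x Ux <-].
rewrite deriveE; last by apply: dg; exists x.
by have [_ ->] := is_diff_inverse Ux; rewrite /= mxE gK.
Qed.

End Inverse.
End InverseFunction.

(** * Cut-off functions *)

Section ChainRule.
Context {R : realType}.

Lemma derivable1_differentiable {W : normedModType R} (g : R -> W) t :
  derivable g t 1 -> differentiable g t.
Proof. by move/derivable1_diffP. Qed.

Lemma derive_line0 {V W : normedModType R} (f : V -> W) x v :
  'D_1 (fun h : R => f (h *: v + x)) 0 = 'D_v f x.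
Proof.
have E : (fun h : R => h^-1 *: (((fun h : R => f (h *: v + x)) \o shift 0) (h *: 1) - f (0 *: v + x)))
    = (fun h => h^-1 *: ((f \o shift x) (h *: v) - f x)).
  by apply/funext => h /=; rewrite addr0 scale0r add0r /GRing.scale /= mulr1.
by rewrite /derive E.
Qed.

(** As [f] is only assumed derivable along [v], the one-variable chain rule is applied to its
    restriction to the line through [x]. *)
Lemma is_derive_compR {V : normedModType R} (f : V -> R) (g : R -> R) x v df dg :
  is_derive x v f df -> is_derive (f x) 1 g dg ->
  is_derive x v (fun y => g (f y)) (df * dg).
Proof.
move=> [fd fE] [gd gE].
pose l := fun h : R => f (h *: v + x).
have l0 : l 0 = f x by rewrite /l scale0r add0r.
have dl : derivable l 0 1 := (derivable1P f x v).1 fd.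
have dlE : 'D_1 l 0 = df := etrans (derive_line0 f x v) fE.
have dg0 : differentiable g (l 0) :=
  eq_ind_r (fun z => differentiable g z) (derivable1_differentiable gd) l0.
have dl0 : differentiable l 0 := derivable1_differentiable dl.
have dgl : differentiable (g \o l) 0 by exact: differentiable_comp.
apply: DeriveDef.
  apply: (derivable1P _ _ _).2; apply: (derivable1_diffP _ _).2; exact: dgl.
rewrite -derive_line0 -[LHS]/('D_1 (g \o l) 0).
have gl : derivable g (l 0) 1 := eq_ind_r (fun z => derivable g z 1) gd l0.
have E := derive1_comp dl gl.
by rewrite !derive1E dlE in E; rewrite E mulrC l0 gE.
Qed.

Lemma is_derive_addR {V : normedModType R} (f g : V -> R) x v df dg :
  is_derive x v f df -> is_derive x v g dg ->
  is_derive x v (fun y => f y + g y) (df + dg).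
Proof. by move=> H1 H2; exact: is_deriveD. Qed.

Lemma is_derive_oppR {V : normedModType R} (f : V -> R) x v df :
  is_derive x v f df -> is_derive x v (fun y => - f y) (- df).
Proof. by move=> H1; exact: is_deriveN. Qed.

Lemma is_derive_subR {V : normedModType R} (f g : V -> R) x v df dg :
  is_derive x v f df -> is_derive x v g dg ->
  is_derive x v (fun y => f y - g y) (df - dg).
Proof. by move=> H1 H2; exact: is_deriveB. Qed.

Lemma is_derive_mulR {V : normedModType R} (f g : V -> R) x v df dg :
  is_derive x v f df -> is_derive x v g dg ->
  is_derive x v (fun y => f y * g y) (df * g x + f x * dg).
Proof.
move=> H1 H2; apply: is_derive_eq (is_deriveM H1 H2) _.
by rewrite /GRing.scale /= addrC [df * _]mulrC.
Qed.

Lemma is_derive_invR {V : normedModType R} (f : V -> R) x v df :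
  f x != 0 -> is_derive x v f df ->
  is_derive x v (fun y => (f y)^-1) (- df / f x ^+ 2).
Proof.
move=> f0 H1; have H2 : is_derive (f x) 1 (@GRing.inv R) (- (f x) ^- 2).
  apply: is_derive_eq; first exact: is_deriveV.
  by rewrite /= /GRing.scale /= mulr1.
by apply: is_derive_eq (is_derive_compR H1 H2) _; rewrite mulrN mulNr.
Qed.

Lemma smooth_on_ln : smooth_on [set x : R | 0 < x] (@ln R).
Proof.
have o : open [set x : R | 0 < x] by exact: open_gt.
case=> [|k]; first by move=> x x0; exact: continuous_ln.
apply: (Ck_on_derive1 (f' := fun x => x^-1)) => //.
by apply: Ck_on_sub (Ck_on_inv k) => x /= x0; rewrite gt_eqF.
Qed.

(** Each function is the derivative of the other up to sign, hence a simultaneous induction. *)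
Lemma smooth_on_sin_cos (U : set R) : smooth_on U sin /\ smooth_on U cos.
Proof.
suff H k : Ck_on k setT (@sin R) /\ Ck_on k setT (@cos R).
  by split=> k; have [H1 H2] := H k; apply: Ck_on_sub; [|exact: H1|..|exact: H2].
have oT : open [set: R] by exact: openT.
elim: k => [|k [IHs IHc]].
  by split=> x _; [exact: continuous_sin|exact: continuous_cos].
split; first by apply: Ck_on_derive1 IHc.
apply: (Ck_on_derive1 (f' := fun x => - sin x)) => //.
apply: Ck_on_ext (Ck_onM oT (Ck_on_cst k _ (-1 : R)) IHs) => // x _.
by rewrite /= mulN1r.
Qed.

End ChainRule.

Section Flat.
Context {R : realType}.

(* The functions t^{-k} e^{-1/t} span a space closed under differentiation; this is what
   makes e^{-1/t} smooth at 0. *)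
Definition flat_pow k (t : R) : R := if 0 < t then t^-1 ^+ k * expR (- t^-1) else 0.

Lemma flat_pow_ge0 k t : 0 <= flat_pow k t.
Proof.
rewrite /flat_pow; case: ifPn => // t0.
by rewrite mulr_ge0 ?expR_ge0 // exprn_ge0 // invr_ge0 ltW.
Qed.

Lemma flat_pow_npos k t : t <= 0 -> flat_pow k t = 0.
Proof. by rewrite /flat_pow leNgt => /negbTE ->. Qed.

(** From $e^v \ge v^{k+2}/(k+2)!$ at $v = 1/t$. The quadratic bound forces the derivative at 0 to
    vanish. *)
Lemma flat_pow_le k t : 0 < t -> flat_pow k t <= k.+2`!%:R * t ^+ 2.
Proof.
move=> t0; rewrite /flat_pow t0 expRN.
have v0 : 0 < t^-1 by rewrite invr_gt0.
have H := expR_ge1Dxn k.+1 (ltW v0).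
have f0 : 0 < k.+2`!%:R :> R by rewrite ltr0n fact_gt0.
have E : t^-1 ^+ k = t^-1 ^+ k.+2 * t ^+ 2.
  by rewrite -addn2 exprD -mulrA -exprMn mulVf ?expr1n ?mulr1 // gt_eqF.
rewrite ler_pdivrMr ?expR_gt0 // E [leRHS]mulrAC ler_pM2r ?exprn_gt0 //.
rewrite [leRHS]mulrC -ler_pdivrMr //.
by apply: le_trans H; rewrite lerDr.
Qed.

Lemma is_derive_flat_pow k (t : R) :
  is_derive t 1 (flat_pow k) (flat_pow k.+2 t - k%:R * flat_pow k.+1 t).
Proof.
have [t0|t0|->] := ltgtP t 0.
- rewrite !flat_pow_npos ?ltW // mulr0 subr0.
  apply: (near_eq_is_derive (f := cst 0)).
  apply: (open_near (open_lt (y:=0)) t0) => y /= y0.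
  by rewrite flat_pow_npos // ltW.
- have tn : t != 0 by rewrite gt_eqF.
  have d1 : is_derive t 1 (fun s : R => s^-1) (- 1 / t ^+ 2) by exact: is_derive_invR.
  have d2 : is_derive t 1 (fun s : R => expR (- s^-1)) (- (- 1 / t ^+ 2) * expR (- t^-1)).
    by apply: is_derive_compR; exact: is_derive_oppR.
  have d3 : is_derive t 1 (fun s : R => s^-1 ^+ k) ((- 1 / t ^+ 2) * (k%:R * t^-1 ^+ k.-1)).
    apply: (is_derive_compR (g := fun s => s ^+ k)) => //.
    apply: DeriveDef; first exact: exprn_derivable.
    by rewrite exp_derive /GRing.scale /= mulr1.
  have E : flat_pow k.+2 t - k%:R * flat_pow k.+1 t =
      - 1 / t ^+ 2 * (k%:R * t^-1 ^+ k.-1) * expR (- t^-1) +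
      t^-1 ^+ k * (- (- 1 / t ^+ 2) * expR (- t^-1)).
    rewrite /flat_pow t0 -[(t ^+ 2)^-1]exprVn.
    by case: k {d3} => [|k] /=; rewrite !exprS; ring.
  rewrite E; apply: near_eq_is_derive (is_derive_mulR d3 d2).
  apply: (open_near (open_gt (y:=0)) t0) => y /= y0.
  by rewrite /flat_pow y0.
- rewrite !flat_pow_npos // mulr0 subr0.
  suff : is_diff (0 : R) (flat_pow k) (cst 0 : R -> R).
    move=> [fd fE]; apply: DeriveDef; first exact: diff_derivable.
    by rewrite deriveE // fE.
  have := @is_diff_eps _ R R (flat_pow k) 0 (\0)%R.
  apply; first exact: cst_continuous.
  move=> e e0.
  have c0 : 0 < k.+2`!%:R :> R by rewrite ltr0n fact_gt0.
  near=> h.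
  rewrite addr0 (flat_pow_npos k (lexx 0)) subr0 /= subr0 ger0_norm ?flat_pow_ge0 //.
  have [h0|h0] := leP h 0; first by rewrite flat_pow_npos // mulr_ge0 // ltW.
  apply: le_trans (flat_pow_le _ h0) _; rewrite gtr0_norm // expr2 mulrA.
  apply: ler_wpM2r; first exact: ltW.
  rewrite [leLHS]mulrC -ler_pdivlMr //.
  apply: le_trans (ler_norm _) _; near: h.
  apply/nbhs_ballP; exists (e / k.+2`!%:R); first by rewrite /= divr_gt0.
  by move=> y; rewrite -ball_normE /= sub0r normrN => /ltW.
Unshelve. all: by end_near. Qed.

Lemma smooth_on_flat_pow k (U : set R) : smooth_on U (flat_pow k).
Proof.
suff H m : Ck_on m setT (flat_pow k) by move=> m; exact: Ck_on_sub (H m).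
have oT : open [set: R] by exact: openT.
elim: m k => [|m IH] k.
  move=> x _; apply: differentiable_continuous; apply: derivable1_differentiable.
  by have [] := is_derive_flat_pow k x.
apply: (Ck_on_derive1 oT (fun x _ => is_derive_flat_pow k x)).
have H := Ck_onD oT (IH k.+2) (Ck_onM oT (Ck_on_cst m _ (- k%:R : R)) (IH k.+1)).
apply: Ck_on_ext H => // x _.
by rewrite /= mulNr.
Qed.

Definition flat := flat_pow 0.
Definition flat' := flat_pow 2.

Lemma is_derive_flat (t : R) : is_derive t 1 flat (flat' t).
Proof. by apply: is_derive_eq (is_derive_flat_pow 0 t) _; rewrite mul0r subr0. Qed.

Lemma flat_lt1 t : flat t < 1.
Proof.
rewrite /flat /flat_pow; case: ifP => // t0.
by rewrite expr0 mul1r expR_lt1 oppr_lt0 invr_gt0.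
Qed.

Lemma sqr_flat' t : t ^+ 2 * flat' t = flat t.
Proof.
rewrite /flat /flat' /flat_pow; case: ifP => [t0|_]; last by rewrite mulr0.
by rewrite mulrA -exprMn mulfV ?gt_eqF // expr1n expr0.
Qed.

(** From $1 + v^2/2 \le e^v$ at $v = 1/t$. The constant is generous; it only enters [chi_lip]. *)
Lemma flat'_le t : flat' t <= 24.
Proof.
have [t0|t0] := leP t 0; first by rewrite /flat' flat_pow_npos.
rewrite /flat' /flat_pow t0 expRN ler_pdivrMr ?expR_gt0 //.
have v0 : 0 < t^-1 by rewrite invr_gt0.
have := expR_ge1Dxn 1 (ltW v0); rewrite (_ : 2`! = 2%N) //.
have : 0 <= t^-1 ^+ 2 by exact: sqr_ge0.
lra.
Qed.

Lemma flat_homo s t : s <= t -> flat s <= flat t.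
Proof.
move=> st; have [s0|s0] := leP s 0; first by rewrite {1}/flat flat_pow_npos // flat_pow_ge0.
rewrite /flat /flat_pow s0 (lt_le_trans s0 st) !expr0 !mul1r ler_expR lerN2.
by rewrite lef_pV2 // posrE ?(lt_le_trans s0 st).
Qed.

End Flat.

Section Cutoff.
Context {R : realType}.
Local Notation e := (expR 1 : R).

(* Equal to 1 for u <= 0 and to 0 for u >= 1. *)
Definition chi (u : R) := e * flat (1 - e * flat u).
Definition chi' (u : R) := - (e ^+ 2 * flat' (1 - e * flat u) * flat' u).
(** A bound for $|\chi'|$; the summand 1 makes it at least 1, which keeps [rate] at most 1. *)
Definition chi_lip : R := 1 + e ^+ 2 * 24 * 24.

Lemma expR1_flat1 : e * flat 1 = 1.
Proof. by rewrite /flat /flat_pow ltr01 invr1 expr0 mul1r expRxMexpNx_1. Qed.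

Lemma is_derive_chi (u : R) : is_derive u 1 chi (chi' u).
Proof.
have d1 : is_derive u 1 (fun s => e * flat s) (e * flat' u).
  apply: is_derive_eq (is_derive_mulR (is_derive_cst e _ _) (is_derive_flat u)) _.
  by rewrite mul0r add0r.
have d2 : is_derive u 1 (fun s => 1 - e * flat s) (- (e * flat' u)).
  apply: is_derive_eq (is_derive_subR (is_derive_cst (1 : R) _ _) d1) _.
  by rewrite sub0r.
have d3 := is_derive_compR d2 (is_derive_flat _).
apply: is_derive_eq (is_derive_mulR (is_derive_cst e _ _) d3) _.
by rewrite mul0r add0r /= /chi'; ring.
Qed.

Lemma smooth_on_chi U : open U -> smooth_on U chi.
Proof.
move=> oU; apply: smooth_onM => //; first exact: smooth_on_cst.
apply: (smooth_on_compR (U' := setT) oU) => //; last exact: smooth_on_flat_pow.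
apply: smooth_onB => //; first exact: smooth_on_cst.
by apply: smooth_onM => //; [exact: smooth_on_cst|exact: smooth_on_flat_pow].
Qed.

Lemma chi_npos (u : R) : u <= 0 -> chi u = 1.
Proof. by move=> u0; rewrite /chi {2}/flat flat_pow_npos // mulr0 subr0 expR1_flat1. Qed.

Lemma chi'_npos u : u <= 0 -> chi' u = 0.
Proof. by move=> u0; rewrite /chi' [flat' u]flat_pow_npos // mulr0 oppr0. Qed.

Lemma flat_ge1 (u : R) : 1 <= u -> 1 - e * flat u <= 0.
Proof.
by move=> u1; rewrite subr_le0 -[leLHS]expR1_flat1 ler_pM2l ?expR_gt0 // flat_homo.
Qed.

Lemma chi_ge1 (u : R) : 1 <= u -> chi u = 0.
Proof. by move=> /flat_ge1 u1; rewrite /chi {1}/flat flat_pow_npos // mulr0. Qed.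

Lemma chi'_ge1 u : 1 <= u -> chi' u = 0.
Proof. by move=> /flat_ge1 u1; rewrite /chi' [flat' (1 - _)]flat_pow_npos // mulr0 mul0r oppr0. Qed.

Lemma chi_bounds (u : R) : 0 <= chi u <= 1.
Proof.
rewrite /chi mulr_ge0 ?expR_ge0 ?flat_pow_ge0 //= -[leRHS]expR1_flat1.
rewrite ler_pM2l ?expR_gt0 // flat_homo // gerBl mulr_ge0 ?expR_ge0 //.
exact: flat_pow_ge0.
Qed.

Lemma chi'_bounds u : - chi_lip <= chi' u <= 0.
Proof.
rewrite /chi' /chi_lip lerN2 oppr_le0.
have e0 : 0 <= e ^+ 2 by exact: sqr_ge0.
have A := flat_pow_ge0 2 (1 - e * flat u); have B := flat_pow_ge0 2 u.
have A' := flat'_le (1 - e * flat u); have B' := flat'_le u.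
rewrite -/(flat' _) in A; rewrite -/(flat' _) in B.
rewrite !mulr_ge0 // andbT.
apply: (@le_trans _ _ (e ^+ 2 * 24 * 24)); last by lra.
by apply: ler_pM => //; [exact: mulr_ge0|apply: ler_wpM2l].
Qed.

Lemma chi_lip_ge1 : (1 : R) <= chi_lip.
Proof. by rewrite /chi_lip lerDl; apply: mulr_ge0 => //; apply: mulr_ge0 => //; exact: sqr_ge0. Qed.

(* For t >= 0, [t - push t = t / (1 + t * flat t)] is increasing with supremum 1, not
   attained since [t * (1 - flat t) < 1]; for t <= 0, [push t = 0]. *)
Definition push (t : R) := t - t / (1 + t * flat t).
Definition push' (t : R) := 1 - (1 - flat t) / (1 + t * flat t) ^+ 2.

Lemma push_den (t : R) : 1 <= 1 + t * flat t.
Proof.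
rewrite lerDl; have [t0|t0] := leP t 0; first by rewrite /flat flat_pow_npos // mulr0.
by apply: mulr_ge0; [exact: ltW|exact: flat_pow_ge0].
Qed.

Lemma push_den_gt0 (t : R) : 0 < 1 + t * flat t.
Proof. exact: lt_le_trans (push_den t). Qed.

Lemma is_derive_push (t : R) : is_derive t 1 push (push' t).
Proof.
have d1 : is_derive t 1 (fun s => 1 + s * flat s) (flat t + t * flat' t).
  apply: is_derive_eq (is_derive_addR (is_derive_cst (1 : R) _ _)
    (is_derive_mulR (is_derive_id t 1) (is_derive_flat t))) _.
  by rewrite add0r mul1r.
have n0 : 1 + t * flat t != 0 by rewrite gt_eqF // push_den_gt0.
have d2 := is_derive_mulR (is_derive_id t 1) (is_derive_invR (f := fun s : R => 1 + s * flat s) n0 d1).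
apply: is_derive_eq (is_derive_subR (is_derive_id t 1) d2) _.
(* Once [flat t] is written as $t^2$ times [flat' t], the identity is one between rational functions
   of [t] and [flat' t]. *)
rewrite /push' /= mul1r -(sqr_flat' t); move: n0; rewrite -(sqr_flat' t) => n0.
by field.
Qed.

Lemma smooth_on_push U : open U -> smooth_on U push.
Proof.
move=> oU; have Hid : smooth_on U (fun t : R => t) by exact: smooth_on_id.
apply: smooth_onB => //; apply: smooth_onM => //; apply: smooth_on_inv => //.
  by move=> t _; rewrite gt_eqF // push_den_gt0.
apply: smooth_onD => //; first exact: smooth_on_cst.
by apply: smooth_onM => //; exact: smooth_on_flat_pow.
Qed.

Lemma push_npos (t : R) : t <= 0 -> push t = 0 /\ push' t = 0.
Proof.
move=> t0; rewrite /push /push' /flat flat_pow_npos // mulr0 addr0 expr1n subr0.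
by rewrite !divr1 !subrr.
Qed.

Lemma push_bounds (t : R) : 0 <= t -> 0 <= push t <= t.
Proof.
move=> t0; have D := push_den t; have D0 := push_den_gt0 t.
rewrite /push subr_ge0 gerBl ler_pdivrMr // ler_peMr //=.
by rewrite divr_ge0 // ltW.
Qed.

Lemma push'_bounds t : 0 <= push' t < 1.
Proof.
rewrite /push' subr_ge0 gtrBl; have D := push_den t; have D0 := push_den_gt0 t.
have f1 := flat_lt1 t.
rewrite divr_gt0 ?subr_gt0 ?exprn_gt0 // andbT ler_pdivrMr ?exprn_gt0 // mul1r.
apply: (@le_trans _ _ 1); first by rewrite gerBl; exact: flat_pow_ge0.
exact: exprn_ege1.
Qed.

Lemma push_range (t : R) : t - push t < 1 /\ (0 <= t -> t / (1 + t) <= t - push t).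
Proof.
rewrite /push subKr; have D0 := push_den_gt0 t; have f1 := flat_lt1 t.
have f0 : 0 <= flat t := flat_pow_ge0 0 t.
split; last first.
  move=> t0; rewrite ler_wpM2l // lef_pV2 ?posrE // ?ltr_pwDl // lerD2l.
  by rewrite ler_piMr // ltW.
rewrite ltr_pdivrMr // mul1r.
have [t0|t0] := leP t 0; first by rewrite /flat flat_pow_npos // mulr0 addr0; exact: le_lt_trans t0 ltr01.
suff : t * (1 - flat t) < 1 by rewrite mulrBr mulr1; lra.
(* The strict inequality $1 - 1/t < e^{-1/t}$ is what keeps the supremum from being attained. *)
have H := expR_gt1Dx (x := - t^-1).
rewrite /flat /flat_pow t0 expr0 mul1r.
have {H} : 1 - t^-1 < expR (- t^-1) by apply: H; rewrite oppr_eq0 invr_eq0 gt_eqF.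
move=> H; apply: (@lt_le_trans _ _ (t * t^-1)); last by rewrite divff // gt_eqF.
rewrite ltr_pM2l //; lra.
Qed.

End Cutoff.

(** * Locally finite sums of products *)

Section LocallyFiniteSums.
Context {R : realType}.
Implicit Types (w q : nat -> R -> R).

(** For each [i] the vanishing is required on an open half-line, so the property passes to
    derivatives. *)
Definition locally_finite w := forall i t, t + 1 < i%:R -> w i t = 0.

(* The series of all [w i t * q i r] for a locally finite [w]: the terms beyond
   |t| + 2 vanish. *)
Definition bsum w q (t r : R) := \sum_(i < (Num.truncn `|t|).+3) w i t * q i r.

(** Lets a single number of terms serve all parameters near a given one, so that the series can be
    differentiated term by term. *)
Lemma bsumE N w q t r : locally_finite w -> t + 1 < N%:R ->
  bsum w q t r = \sum_(i < N) w i t * q i r.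
Proof.
move=> lw tN.
have H M : t + 1 < M%:R -> forall m, \sum_(i < M + m) w i t * q i r = \sum_(i < M) w i t * q i r.
  move=> tM; elim=> [|m IH]; first by rewrite addn0.
  rewrite addnS big_ord_recr /= IH lw ?mul0r ?addr0 //.
  by apply: lt_le_trans tM _; rewrite ler_nat leq_addr.
have tT : t + 1 < (Num.truncn `|t|).+3%:R.
  have : `|t| < (Num.truncn `|t|).+1%:R by exact: truncnS_gt.
  have := ler_norm t; rewrite -[_.+3]addn2 natrD; lra.
by rewrite /bsum -(H _ tN (Num.truncn `|t|).+3) addnC H.
Qed.

Definition deriv_seq w i := 'D_1 (w i).

Lemma locally_finite_deriv w : locally_finite w -> locally_finite (deriv_seq w).
Proof.
move=> lw i t ti; rewrite /deriv_seq.
have -> : 'D_1 (w i) t = 'D_1 (cst 0) t; last by rewrite derive_cst.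
apply: near_eq_derive; apply: (open_near (open_lt (y := i%:R - 1))) => [|y] /=.
  by rewrite ltrBrDr.
by rewrite ltrBrDr => /lw.
Qed.

Section Smooth.
Variables (w q : nat -> R -> R).
Hypotheses (lw : locally_finite w).
Hypotheses (sw : forall i, smooth_on setT (w i)) (sq : forall i, smooth_on setT (q i)).

Lemma deriv_seqP (v : nat -> R -> R) i (t : R) : smooth_on setT (v i) ->
  is_derive t 1 (v i) (deriv_seq v i t).
Proof.
move=> sv; apply: DeriveDef => //; apply: diff_derivable.
exact: (smooth_on_differentiable sv).
Qed.

Lemma smooth_on_bsum (V : normedModType R) (U : set V) (T r : V -> R) : open U ->
  smooth_on U T -> smooth_on U r -> smooth_on U (fun z => bsum w q (T z) (r z)).
Proof.
move=> oU sT sr; apply: smooth_on_local => z Uz.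
pose N := (Num.truncn `|T z|).+3.
have tT : T z + 1 < N%:R.
  have : `|T z| < (Num.truncn `|T z|).+1%:R by exact: truncnS_gt.
  have := ler_norm (T z); rewrite /N -[_.+3]addn2 natrD; lra.
pose U' := U `&` T @^-1` [set t | t < N%:R - 1].
have oU' : open U'.
  apply: open_preimage_on => //.
  by move=> x Ux; exact: smooth_on_continuous sT Ux.
exists U'; split => //.
  by split => //=; rewrite ltrBrDr.
have H : smooth_on U' (fun x => \sum_(i < N) w i (T x) * q i (r x)).
  have sub : U' `<=` U by move=> x [].
  apply: smooth_on_sum => // i _; apply: smooth_onM => //.
    exact: (smooth_on_compR oU' (fun _ _ => I) (smooth_on_sub sub sT) (sw i)).
  exact: (smooth_on_compR oU' (fun _ _ => I) (smooth_on_sub sub sr) (sq i)).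
apply: (smooth_on_ext oU' _ H) => x [_] /=; rewrite ltrBrDr => TN.
by rewrite (bsumE (N := N)).
Qed.

(** Continuity of [T], which a directional derivative does not give, keeps [T z] below [N - 1] for
    [z] near [x], so the sum there has a fixed number of terms. *)
Lemma is_derive_bsum (V : normedModType R) (T r : V -> R) x v dT dr :
  {for x, continuous T} ->
  is_derive x v T dT -> is_derive x v r dr ->
  is_derive x v (fun z => bsum w q (T z) (r z))
    (bsum (deriv_seq w) q (T x) (r x) * dT + bsum w (deriv_seq q) (T x) (r x) * dr).
Proof.
move=> cT HT Hr.
pose N := (Num.truncn `|T x|).+3.
have tT : T x + 1 < N%:R.
  have : `|T x| < (Num.truncn `|T x|).+1%:R by exact: truncnS_gt.
  have := ler_norm (T x); rewrite /N -[_.+3]addn2 natrD; lra.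
have H : is_derive x v (\sum_(i < N) (fun z => w i (T z) * q i (r z)))
   (\sum_(i < N) (dT * deriv_seq w i (T x) * q i (r x) + w i (T x) * (dr * deriv_seq q i (r x)))).
  apply: is_derive_sum => i; apply: is_derive_mulR; apply: is_derive_compR => //; exact: deriv_seqP.
have E : bsum (deriv_seq w) q (T x) (r x) * dT + bsum w (deriv_seq q) (T x) (r x) * dr =
   \sum_(i < N) (dT * deriv_seq w i (T x) * q i (r x) + w i (T x) * (dr * deriv_seq q i (r x))).
  rewrite !(bsumE (N := N)) //; last exact: locally_finite_deriv.
  rewrite big_split /= !mulr_suml; congr (_ + _); apply: eq_bigr => i _; ring.
rewrite E; apply: near_eq_is_derive H.
have nT : \forall z \near x, T z < N%:R - 1.
  apply: (near_preimage (B := [set t : R | t < N%:R - 1]) cT); first exact: open_lt.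
  by rewrite /= ltrBrDr.
apply: filterS nT => z; rewrite ltrBrDr => zN.
by rewrite fct_sumE (bsumE (N := N)).
Qed.

End Smooth.
End LocallyFiniteSums.

(** * The generating function *)

Section Profile.
Context {R : realType}.
Local Notation C := (@chi_lip R).

(* [push t * C <= (i + 1) * C] on [i, i + 1], so by [rate_le] the derivative of [radial i]
   is too small to spoil the positivity in [twist_gt0]. *)
Definition rate (i : nat) : R := (8 * C ^+ 2 * i.+1%:R)^-1.

Lemma rate_gt0 i : 0 < rate i.
Proof.
have C1 := chi_lip_ge1 (R := R).
have C0 : 0 < C by exact: lt_le_trans C1.
rewrite invr_gt0; apply: mulr_gt0; last by rewrite ltr0n.
by apply: mulr_gt0 => //; exact: exprn_gt0.
Qed.

Lemma rate_le i : 4 * C * rate i * (i.+1%:R * C) = 2^-1.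
Proof.
have C1 := chi_lip_ge1 (R := R); have C0 : C != 0 by rewrite gt_eqF // (lt_le_trans _ C1).
have i0 : i.+1%:R != 0 :> R by rewrite pnatr_eq0.
by rewrite /rate; move: (i.+1%:R) C i0 C0 => x y x0 y0; field; rewrite x0 y0.
Qed.

Lemma rate_le1 i : rate i <= 1.
Proof.
have C1 := chi_lip_ge1 (R := R).
have C2 : 1 <= C ^+ 2 by exact: exprn_ege1.
have i1 : 1 <= i.+1%:R :> R by rewrite ler1n.
rewrite invf_le1; last by rewrite -invr_gt0 rate_gt0.
nra.
Qed.

(* [push] times a partition of unity: on [k, k + 1] only the weights k and k + 1 are
   nonzero. *)
Definition weight (i : nat) (t : R) := push t * (chi (t - i%:R) - chi (t - i%:R + 1)).
Definition weight' (i : nat) (t : R) := push' t * (chi (t - i%:R) - chi (t - i%:R + 1)) +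
  push t * (chi' (t - i%:R) - chi' (t - i%:R + 1)).

Lemma locally_finite_weight : locally_finite weight.
Proof.
move=> i t ti; rewrite /weight !chi_npos ?subrr ?mulr0 //; lra.
Qed.

Lemma smooth_on_weight i U : open U -> smooth_on U (weight i).
Proof.
move=> oU; apply: smooth_onM => //; first exact: smooth_on_push.
have Hid : smooth_on U (fun t : R => t) by exact: smooth_on_id.
have H1 : smooth_on U (fun t : R => t - i%:R).
  by apply: smooth_onB => //; exact: smooth_on_cst.
have H2 : smooth_on U (fun t : R => t - i%:R + 1).
  by apply: smooth_onD => //; exact: smooth_on_cst.
apply: smooth_onB => //.
  by apply: (smooth_on_compR (U' := setT) oU) => //; apply: smooth_on_chi; exact: openT.
by apply: (smooth_on_compR (U' := setT) oU) => //; apply: smooth_on_chi; exact: openT.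
Qed.

Lemma is_derive_weight i (t : R) : is_derive t 1 (weight i) (weight' i t).
Proof.
have d1 : is_derive t 1 (fun s : R => s - i%:R) 1.
  apply: is_derive_eq (is_derive_subR (is_derive_id t 1) (is_derive_cst (i%:R : R) _ _)) _.
  by rewrite subr0.
have d2 : is_derive t 1 (fun s : R => s - i%:R + 1) 1.
  apply: is_derive_eq (is_derive_addR d1 (is_derive_cst (1 : R) _ _)) _.
  by rewrite addr0.
have d3 := is_derive_compR d1 (is_derive_chi _); have d4 := is_derive_compR d2 (is_derive_chi _).
apply: is_derive_eq (is_derive_mulR (is_derive_push t) (is_derive_subR d3 d4)) _.
by rewrite /weight' !mul1r.
Qed.

Lemma deriv_weight i t : deriv_seq weight i t = weight' i t.
Proof. by rewrite /deriv_seq; have [_ ->] := is_derive_weight i t. Qed.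

Variable eta : nat -> R.
Hypothesis eta0 : forall i, 0 < eta i.
(** At this radius the argument of [chi] in [radial] has reached 1. The ratio to [eta i] depends on
    [i] alone, so [eta i] can be chosen as small as needed. *)
Definition top i := eta i * expR (rate i)^-1.
(** The next cut-off has already vanished where the present one starts to decrease: the transition
    zones are nested and disjoint up to end points. *)
Hypothesis top_eta : forall i, top i.+1 <= eta i.
Hypothesis top_le : forall i, top i <= i.+1%:R^-1.

(* Decreases from 1 on [0, eta i] to 0 on [top i, +oo).  The logarithmic scale makes
   [r * radial' i r] as small as the factor [rate i]. *)
Definition radial (i : nat) (r : R) := chi (rate i * ln (1 + (r / eta i) ^+ 2) - 1).
Definition radial' (i : nat) (r : R) :=
  rate i * (2 * r / (eta i ^+ 2 + r ^+ 2)) * chi' (rate i * ln (1 + (r / eta i) ^+ 2) - 1).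

Lemma radial_den i r : 0 < 1 + (r / eta i) ^+ 2.
Proof. by rewrite ltr_pwDl // sqr_ge0. Qed.

Lemma smooth_on_radial i U : open U -> smooth_on U (radial i).
Proof.
move=> oU; apply: (smooth_on_compR (U' := setT) oU) => //; last first.
  by apply: smooth_on_chi; exact: openT.
apply: smooth_onB => //; last exact: smooth_on_cst.
apply: smooth_onM => //; first exact: smooth_on_cst.
have Hid : smooth_on U (fun t : R => t) by exact: smooth_on_id.
have H : smooth_on U (fun r : R => 1 + (r * (eta i)^-1) * (r * (eta i)^-1)).
  apply: smooth_onD => //; first exact: smooth_on_cst.
  by apply: smooth_onM => //; apply: smooth_onM => //; exact: smooth_on_cst.
exact: (smooth_on_compR (f := fun r : R => 1 + (r / eta i) ^+ 2) (g := @ln R) oU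
  (fun r _ => radial_den i r) H smooth_on_ln).
Qed.

Lemma is_derive_radial i (r : R) : is_derive r 1 (radial i) (radial' i r).
Proof.
have d0 : is_derive r 1 (fun s : R => s / eta i) ((eta i)^-1).
  apply: is_derive_eq (is_derive_mulR (is_derive_id r 1) (is_derive_cst ((eta i)^-1) _ _)) _.
  by rewrite mul1r mulr0 addr0.
have d1 : is_derive r 1 (fun s : R => 1 + (s / eta i) ^+ 2) (2 * r / eta i ^+ 2).
  apply: is_derive_eq (is_derive_addR (is_derive_cst (1 : R) _ _) (is_derive_mulR d0 d0)) _.
  by have e0 := eta0 i; field; rewrite gt_eqF.
have d2 := is_derive_compR d1 (is_derive1_ln (radial_den i r)).
have d3 := is_derive_subR (is_derive_mulR (is_derive_cst (rate i) r 1) d2) (is_derive_cst (1 : R) _ _).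
apply: is_derive_eq (is_derive_compR d3 (is_derive_chi _)) _.
rewrite /radial' /= mul0r add0r subr0; congr (_ * _ * _).
have e0 := eta0 i; have := radial_den i r; move: (eta i) e0 => y y0 Hy; field.
rewrite !gt_eqF //; apply: ltr_pwDl; [exact: exprn_gt0|exact: sqr_ge0].
Qed.

Lemma deriv_radial i r : deriv_seq radial i r = radial' i r.
Proof. by rewrite /deriv_seq; have [_ ->] := is_derive_radial i r. Qed.

(** Here $\ln(1 + s^2) \le s^2 \le 1$ for $s = r/\eta_i$, and the rate is at most 1, so the argument
    of [chi] is not positive. *)
Lemma radial_low i r : 0 <= r <= eta i -> radial i r = 1 /\ radial' i r = 0.
Proof.
move=> /andP[r0 rb]; have e0 := eta0 i.
have H : rate i * ln (1 + (r / eta i) ^+ 2) - 1 <= 0.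
  rewrite subr_le0; have L : ln (1 + (r / eta i) ^+ 2) <= 1.
    apply: le_trans (le_ln1Dx _) _; first by rewrite (lt_le_trans _ (sqr_ge0 _)) // ltrN10.
    rewrite exprn_ile1 //; first by rewrite divr_ge0 // ltW.
    by rewrite ler_pdivrMr // mul1r.
  have L0 : 0 <= ln (1 + (r / eta i) ^+ 2) by rewrite ln_ge0 // lerDl sqr_ge0.
  have := rate_le1 i; have := rate_gt0 i; nra.
by rewrite /radial /radial' chi_npos // chi'_npos // mulr0.
Qed.

Lemma radial_high i r : top i <= r -> radial i r = 0 /\ radial' i r = 0.
Proof.
move=> rt; have e0 := eta0 i; have b0 := rate_gt0 i.
have H : 1 <= rate i * ln (1 + (r / eta i) ^+ 2) - 1.
  have rE : expR (rate i)^-1 <= r / eta i by rewrite ler_pdivlMr // mulrC.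
  have rE2 : expR (2 * (rate i)^-1) <= 1 + (r / eta i) ^+ 2.
    rewrite expRM_natl; apply: (@le_trans _ _ ((r / eta i) ^+ 2)); last by rewrite lerDr.
    by rewrite lerXn2r // nnegrE ?expR_ge0 // (le_trans _ rE) // expR_ge0.
  have : 2 * (rate i)^-1 <= ln (1 + (r / eta i) ^+ 2).
    by rewrite -[leLHS]expRK ler_ln // posrE ?expR_gt0 // radial_den.
  move=> /(ler_wpM2l (ltW b0)); rewrite mulrCA mulfV ?gt_eqF // mulr1; lra.
by rewrite /radial /radial' chi_ge1 // chi'_ge1 // mulr0.
Qed.

(** The factor $4 v r/(\eta_i^2 + r^2)$ is at most 4 at every scale; what remains is the slope
    [rate i] of the logarithmic argument times a bound for [chi']. *)
Lemma radial'_bounds i r v : 0 <= v <= r ->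
  - (4 * C * rate i) <= 2 * v * radial' i r <= 0.
Proof.
move=> /andP[v0 vr]; rewrite /radial'.
set c := chi' _; have /andP[c1 c2] : - C <= c <= 0 := chi'_bounds _.
have e0 := eta0 i; have b0 := rate_gt0 i; have r0 := le_trans v0 vr.
set s := 2 * v * (2 * r / (eta i ^+ 2 + r ^+ 2)).
have d0 : 0 < eta i ^+ 2 + r ^+ 2 by rewrite ltr_pwDl ?sqr_ge0 // exprn_gt0.
have /andP[s0 s1] : 0 <= s <= 4.
  have n0 : 0 <= 2 * v * (2 * r) by apply: mulr_ge0; exact: mulr_ge0.
  have h0 : 0 <= eta i ^+ 2 by exact: sqr_ge0.
  rewrite /s mulrA; apply/andP; split; first by apply: divr_ge0 => //; exact: ltW.
  rewrite ler_pdivrMr //; move: h0; rewrite (expr2 r); clear -vr v0 r0; nra.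
have -> : 2 * v * (rate i * (2 * r / (eta i ^+ 2 + r ^+ 2)) * c) = rate i * (s * c).
  by rewrite /s; ring.
have : - (4 * C) <= s * c <= 0 by apply/andP; split; nra.
move=> /andP[h1 h2]; apply/andP; split; nra.
Qed.

Lemma radial_bounds i r : 0 <= radial i r <= 1.
Proof. exact: chi_bounds. Qed.

End Profile.

(** * Values of the generating function and the twist condition *)

Section Generating.
Context {R : realType}.
Local Notation C := (@chi_lip R).

Lemma bsum_two (w q : nat -> R -> R) k t r : locally_finite w -> t <= k.+1%:R ->
  (forall i, (i < k)%N -> w i t = 0) -> w k.+2 t = 0 ->
  bsum w q t r = w k t * q k r + w k.+1 t * q k.+1 r.
Proof.
move=> lw tk w0 w2; rewrite (bsumE (N := k.+3)) //; last first.
  by rewrite -(natr1 k.+2) ltrD2r (le_lt_trans tk) // ltr_nat.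
rewrite !big_ord_recr /= w2 mul0r addr0 big1 ?add0r // => i _.
by rewrite w0 ?mul0r // ltn_ord.
Qed.

Lemma weight_two k (t : R) : k%:R <= t <= k.+1%:R ->
  [/\ weight k t = push t * chi (t - k%:R),
      weight k.+1 t = push t * (1 - chi (t - k%:R)),
      weight' k t = push' t * chi (t - k%:R) + push t * chi' (t - k%:R) &
      weight' k.+1 t = push' t * (1 - chi (t - k%:R)) - push t * chi' (t - k%:R)].
Proof.
move=> /andP[kt tk]; rewrite -natr1 in tk.
have E : t - k.+1%:R + 1 = t - k%:R by rewrite -natr1; ring.
rewrite /weight /weight' E.
have H1 : 1 <= t - k%:R + 1 by lra.
have H2 : t - k.+1%:R <= 0 by rewrite -natr1; lra.
by rewrite (chi_ge1 H1) (chi'_ge1 H1) (chi_npos H2) (chi'_npos H2); split; ring.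
Qed.

Lemma weight_out k i (t : R) : k%:R <= t <= k.+1%:R -> (i < k)%N \/ i = k.+2 ->
  weight i t = 0 /\ weight' i t = 0.
Proof.
move=> /andP[kt tk]; rewrite /weight /weight' => -[ik|->].
  have ik' : i%:R + 1 <= k%:R :> R by rewrite natr1 ler_nat.
  have H1 : 1 <= t - i%:R by lra.
  have H2 : 1 <= t - i%:R + 1 by lra.
  by rewrite !chi_ge1 // !chi'_ge1 // subrr !mulr0 addr0.
rewrite -natr1 in tk; have H1 : t - k.+2%:R <= 0 by rewrite -!natr1; lra.
have H2 : t - k.+2%:R + 1 <= 0 by rewrite -!natr1; lra.
by rewrite !chi_npos // !chi'_npos // !subrr !mulr0 addr0.
Qed.

Lemma deriv_seq_weight : deriv_seq (@weight R) = @weight' R.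
Proof. by apply/funext => i; apply/funext => t; rewrite deriv_weight. Qed.

Lemma locally_finite_weight' : locally_finite (@weight' R).
Proof.
by rewrite -deriv_seq_weight; apply: locally_finite_deriv; exact: locally_finite_weight.
Qed.

Lemma bsum_weight (q : nat -> R -> R) k t r : k%:R <= t <= k.+1%:R ->
  bsum weight q t r =
    push t * (chi (t - k%:R) * q k r + (1 - chi (t - k%:R)) * q k.+1 r) /\
  bsum weight' q t r =
    push' t * (chi (t - k%:R) * q k r + (1 - chi (t - k%:R)) * q k.+1 r) +
    push t * chi' (t - k%:R) * (q k r - q k.+1 r).
Proof.
move=> kt; have /andP[_ tk] := kt; have [E1 E2 E3 E4] := weight_two kt.
have W i (H : (i < k)%N \/ i = k.+2) := weight_out kt H.
rewrite (@bsum_two weight q k t r (@locally_finite_weight R) tk); first last.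
- by have [] := W _ (or_intror (erefl k.+2)).
- by move=> i ik; have [] := W i (or_introl ik).
rewrite (@bsum_two weight' q k t r locally_finite_weight' tk); first last.
- by have [] := W _ (or_intror (erefl k.+2)).
- by move=> i ik; have [] := W i (or_introl ik).
by rewrite E1 E2 E3 E4; split; ring.
Qed.

Lemma nat_interval (t : R) : 0 <= t -> exists k, k%:R <= t <= k.+1%:R.
Proof.
move=> t0; exists (Num.truncn t); have /andP[-> /ltW] := truncn_itv t0.
by [].
Qed.

Lemma bsum_npos (q : nat -> R -> R) t r : t <= 0 ->
  bsum weight q t r = 0 /\ bsum weight' q t r = 0.
Proof.
move=> t0; have [p p'] := push_npos t0; rewrite /bsum; split; apply: big1 => i _.
  by rewrite /weight p !mul0r.
by rewrite /weight' p p' !mul0r addr0 mul0r.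
Qed.

Variable eta : nat -> R.
Hypothesis eta0 : forall i, 0 < eta i.
Hypothesis top_eta : forall i, top eta i.+1 <= eta i.
Hypothesis top_le : forall i, top eta i <= i.+1%:R^-1.

Local Notation q := (radial eta).
Local Notation q' := (radial' eta).

Lemma deriv_seq_radial : deriv_seq q = q'.
Proof. by apply/funext => i; apply/funext => t; rewrite deriv_radial. Qed.

Lemma eta_top i : eta i <= top eta i.
Proof.
rewrite /top ler_peMr ?(ltW (eta0 _)) // ltW // expR_gt1 invr_gt0; exact: rate_gt0.
Qed.

Lemma bsum_high k t r : k%:R <= t <= k.+1%:R -> top eta k <= r ->
  [/\ bsum weight q t r = 0, bsum weight' q t r = 0, bsum weight q' t r = 0 &
      bsum weight' q' t r = 0].
Proof.
move=> kt kr; have kr' : top eta k.+1 <= r.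
  by rewrite (le_trans (top_eta k)) // (le_trans (eta_top k)).
have [a1 a2] := radial_high eta0 kr; have [b1 b2] := radial_high eta0 kr'.
have [-> ->] := bsum_weight q r kt; have [-> ->] := bsum_weight q' r kt.
by rewrite a1 a2 b1 b2 subrr !mulr0 addr0 !mulr0 addr0.
Qed.

(** All cut-offs equal 1 at $r = 0$ and the weights add up to [push], so the axis feels the full
    push. *)
Lemma bsum_zero t : bsum weight q t 0 = push t /\ bsum weight q' t 0 = 0 .
Proof.
have H i := radial_low (i := i) eta0 (r := 0).
have L i : q i 0 = 1 /\ q' i 0 = 0 by apply: H; rewrite lexx ltW.
have [t0|/ltW/nat_interval[k kt]] := leP t 0.
  have [-> _] := bsum_npos q 0 t0; have [-> _] := bsum_npos q' 0 t0.
  by have [-> _] := push_npos t0.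
have [-> _] := bsum_weight q 0 kt; have [-> _] := bsum_weight q' 0 kt.
have [-> ->] := L k; have [-> ->] := L k.+1.
by rewrite !mulr1 !mulr0 addr0 mulr0 addrCA subrr addr0 mulr1.
Qed.

(** The outer radii are at most $1/(k+1)$, so a fixed positive [r] lies outside all of them from
    some index on. *)
Lemma bsum_far r : 0 < r -> exists K, forall t, K <= t ->
  bsum weight q t r = 0 /\ bsum weight q' t r = 0.
Proof.
move=> r0; exists (Num.truncn r^-1).+2%:R => t Kt.
have [k kt] := nat_interval (le_trans (ler0n R _) Kt).
have /andP[_ tk] := kt.
have kr : top eta k <= r.
  rewrite (le_trans (top_le k)) // invf_ple ?posrE //.
  apply: le_trans (ltW (truncnS_gt _)) _; rewrite ler_nat.
  by have := le_trans Kt tk; rewrite ler_nat ltnS; apply: leqW.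
by have [] := bsum_high kt kr.
Qed.

Lemma bsum_large t r : 1 <= r ->
  [/\ bsum weight q t r = 0, bsum weight' q t r = 0, bsum weight q' t r = 0 &
      bsum weight' q' t r = 0].
Proof.
move=> r1; have [t0|/ltW/nat_interval[k kt]] := leP t 0.
  by have [-> ->] := bsum_npos q r t0; have [-> ->] := bsum_npos q' r t0.
apply: bsum_high kt _; rewrite (le_trans (top_le k)) // (le_trans _ r1) //.
by rewrite invf_le1 ?ltr0n // ler1n.
Qed.

(** Here [X], [s], [A], [c] stand for [push'], [chi], [push], [chi'], and [a], [b] for $q_i + 2 v
    q_i'$ at $i = k$ and $k+1$. If $a = 1$, the last term helps, since $c \le 0$ and $b \le 1$. If
    $b = 0$, only a negative [a] can hurt, and then $A c a \le m L d = 1/2$. *)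
Lemma twist_arith (X s A c m L d a b : R) : 0 <= X < 1 -> 0 <= s <= 1 -> 0 <= A <= m ->
  - L <= c <= 0 -> 0 <= d -> d * (m * L) = 2^-1 -> a <= 1 -> b <= 1 ->
  a = 1 \/ (b = 0 /\ - d <= a) ->
  0 < 1 - X * (s * a + (1 - s) * b) - A * c * (a - b).
Proof.
move=> /andP[p0 p1] /andP[s0 s1] /andP[a0 am] /andP[c0 c1] d0 dE a1 b1.
have Ac0 : A * c <= 0 by rewrite mulr_ge0_le0.
case=> [->|[-> ad]].
  have H1 : s * 1 + (1 - s) * b <= 1.
    have : 0 <= (1 - s) * (1 - b) by apply: mulr_ge0; rewrite subr_ge0.
    lra.
  have H2 : X * (s * 1 + (1 - s) * b) <= X by rewrite -[leRHS]mulr1 ler_wpM2l.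
  have H3 : (A * c) * (1 - b) <= 0 by rewrite mulr_le0_ge0 // subr_ge0.
  lra.
rewrite mulr0 addr0 subr0.
have [a00|a00] := leP 0 a.
  have H1 : X * (s * a) <= X by rewrite ler_piMr // mulr_ile1.
  have H2 : A * c * a <= 0 by rewrite mulr_le0_ge0.
  lra.
have H1 : X * (s * a) <= 0 by rewrite mulr_ge0_le0 // mulr_ge0_le0 // ltW.
have L0 : - c <= L by lra.
have HA : - (A * c) <= m * L by rewrite -mulrN ler_pM //; lra.
have H2 : A * c * a <= 2^-1.
  rewrite -dE -mulrNN mulrC ler_pM //; lra.
lra.
Qed.

(* With [B = bsum weight (radial eta)], the quantity 1 - B_x - 2 v B_xr.  Between k and
   k + 1 only the terms k and k + 1 matter, and since [top (k + 1) <= eta k], for every r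
   either [radial k] is 1 or [radial (k + 1)] is 0 near r. *)
Lemma twist_gt0 t r v : 0 <= v <= r ->
  0 < 1 - bsum weight' q t r - 2 * v * bsum weight' q' t r.
Proof.
move=> vr; have [t0|t0] := leP t 0.
  by have [_ ->] := bsum_npos q r t0; have [_ ->] := bsum_npos q' r t0; rewrite mulr0 !subr0.
have [k kt] := nat_interval (ltW t0).
have [_ ->] := bsum_weight q r kt; have [_ ->] := bsum_weight q' r kt.
have /andP[a0 at'] := push_bounds (ltW t0).
have /andP[_ tk] := kt; have /andP[v0 vr'] := vr; have r0 := le_trans v0 vr'.
have /andP[q0 q1] := radial_bounds eta k r; have /andP[Q0 Q1] := radial_bounds eta k.+1 r.
have /andP[d0 d1] := radial'_bounds eta0 k vr.
have /andP[D0 D1] := radial'_bounds eta0 k.+1 vr.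
have C1 := chi_lip_ge1 (R := R).
have d00 : 0 <= 4 * C * rate k.
  by rewrite mulr_ge0 ?(ltW (rate_gt0 k)) // mulr_ge0 // (le_trans _ C1).
have H : q k r + 2 * v * q' k r = 1 \/
    q k.+1 r + 2 * v * q' k.+1 r = 0 /\ - (4 * C * rate k) <= q k r + 2 * v * q' k r.
  have [re|er] := leP r (eta k); [left|right].
    have [-> ->] : q k r = 1 /\ q' k r = 0 by apply: radial_low; rewrite ?r0.
    by rewrite mulr0 addr0.
  have [-> ->] : q k.+1 r = 0 /\ q' k.+1 r = 0.
    by apply: radial_high => //; rewrite (le_trans (top_eta k)) // ltW.
  by have := lerD q0 d0; rewrite add0r mulr0 addr0.
have K1 : q k r + 2 * v * q' k r <= 1 by have := lerD q1 d1; rewrite addr0.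
have K2 : q k.+1 r + 2 * v * q' k.+1 r <= 1 by have := lerD Q1 D1; rewrite addr0.
have A1 : 0 <= push t <= k.+1%:R by rewrite a0 (le_trans at').
have := twist_arith (push'_bounds t) (chi_bounds (t - k%:R)) A1 (chi'_bounds (t - k%:R)) d00
  (rate_le k) K1 K2 H.
move: (q k r) (q k.+1 r) (q' k r) (q' k.+1 r) (push' t) (push t) (chi _) (chi' _).
clear => a b c d X A s e; congr (0 < _); ring.
Qed.

End Generating.

(** * The model map on the standard space *)

Section PairedCoordinates.
Context {R : realType} {n : nat}.
Local Notation vec := 'rV[R]_(n.*2.+2).
Implicit Types (z u v : vec).

Definition xco z k := z 0 (ix n k).
Definition yco z k := z 0 (iy n k).

Definition of_pairs (f g : nat -> R) : vec :=
  \row_(i < n.*2.+2) if odd i then g i./2 else f i./2.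

Lemma xco_of_pairs f g k : (k <= n)%N -> xco (of_pairs f g) k = f k.
Proof.
move=> kn; rewrite /xco mxE /ix inordK; last by lia.
by rewrite odd_double doubleK.
Qed.

Lemma yco_of_pairs f g k : (k <= n)%N -> yco (of_pairs f g) k = g k.
Proof.
move=> kn; rewrite /yco mxE /iy inordK; last by lia.
by rewrite /= odd_double uphalf_double.
Qed.

Lemma pair_index (i : 'I_(n.*2.+2)) :
  exists2 k, (k <= n)%N & i = ix n k \/ i = iy n k.
Proof.
have i2 := ltn_ord i; exists i./2; first by lia.
case: (boolP (odd i)) => oi; [right|left]; apply: val_inj; rewrite /= inordK; lia.
Qed.

Lemma pairs_ext z z' : (forall k, (k <= n)%N -> xco z k = xco z' k) ->
  (forall k, (k <= n)%N -> yco z k = yco z' k) -> z = z'.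
Proof.
move=> Hx Hy; apply/rowP => i; have [k kn [->|->]] := pair_index i.
  exact: Hx.
exact: Hy.
Qed.

Lemma bilin_omega0 u v : bilin (omega0 R n) u v =
  \sum_(k < n.+1) (xco u k * yco v k - yco u k * xco v k).
Proof.
rewrite /bilin /omega0 mulmx_sumr mulmx_suml summxE; apply: eq_bigr => k _.
rewrite mulmxBr mulmxBl !mxE; congr (_ - _).
  rewrite (bigD1 (iy n k)) //= big1 ?addr0 => [|j jk].
    rewrite !mxE (bigD1 (ix n k)) //= big1 ?addr0 => [|i ik].
      by rewrite !mxE !eqxx mulr1.
    by rewrite !mxE (negbTE ik) mulr0.
  rewrite !mxE big1 ?mul0r // => i _.
  by rewrite !mxE (negbTE jk) andbF mulr0.
rewrite (bigD1 (ix n k)) //= big1 ?addr0 => [|j jk].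
  rewrite !mxE (bigD1 (iy n k)) //= big1 ?addr0 => [|i ik].
    by rewrite !mxE !eqxx mulr1.
  by rewrite !mxE (negbTE ik) mulr0.
rewrite !mxE big1 ?mul0r // => i _.
by rewrite !mxE (negbTE jk) andbF mulr0.
Qed.

Lemma bilin_omega0_last u v : bilin (omega0 R n) u v =
  \sum_(k < n) (xco u k * yco v k - yco u k * xco v k) + (xco u n * yco v n - yco u n * xco v n).
Proof. by rewrite bilin_omega0 big_ord_recr. Qed.

Lemma omega0_nondegenerate u : (forall v, bilin (omega0 R n) u v = 0) -> u = 0.
Proof.
move=> H; have ne (i j : nat) : (i <= n)%N -> (j <= n)%N ->
    (ix n i == iy n j) = false /\ (ix n i == ix n j) = (i == j) /\ (iy n i == iy n j) = (i == j).
  move=> i_n j_n; rewrite -!val_eqE /= !inordK; lia.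
have key (k : nat) : (k <= n)%N -> forall v,
    (forall j, (j <= n)%N -> j != k -> xco v j = 0 /\ yco v j = 0) ->
    xco u k * yco v k - yco u k * xco v k = 0.
  move=> kn v Hv; have := H v; rewrite bilin_omega0.
  rewrite (bigD1 (Ordinal (kn : (k < n.+1)%N))) //= big1 ?addr0 // => i ik.
  have [|-> ->] := Hv i (ltn_ord i); first by rewrite -val_eqE in ik.
  by rewrite !mulr0 subrr.
apply: pairs_ext => k kn; rewrite [RHS]mxE.
- have := key k kn (delta_mx 0 (iy n k)).
  rewrite /xco /yco !mxE !eqxx (ne k k kn kn).1 mulr1 mulr0 subr0; apply=> j jn jk.
  by rewrite !mxE (ne j k jn kn).1 (ne j k jn kn).2.2 (negbTE jk).
- have := key k kn (delta_mx 0 (ix n k)).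
  rewrite /xco /yco !mxE !eqxx [iy n k == _]eq_sym (ne k k kn kn).1 mulr1 mulr0 sub0r.
  move=> H0; apply/eqP; rewrite -oppr_eq0; apply/eqP; apply: H0 => j jn jk.
  rewrite !mxE (ne j k jn kn).2.1 (negbTE jk) [iy n j == _]eq_sym (ne k j kn jn).1.
  by [].
Qed.

Lemma smooth_on_xco k U : open U -> smooth_on U (xco^~ k).
Proof. by move=> oU; apply: smooth_on_coord => //; exact: smooth_on_id. Qed.

Lemma smooth_on_yco k U : open U -> smooth_on U (yco^~ k).
Proof. by move=> oU; apply: smooth_on_coord => //; exact: smooth_on_id. Qed.

Lemma is_derive_xco k z u : is_derive z u (xco^~ k) (xco u k).
Proof.
have d : differentiable (fun z : vec => z 0 (ix n k)) z by exact: differentiable_coord.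
apply: DeriveDef; first exact: diff_derivable.
by rewrite -[LHS](derive_coord (f := idfun)) ?derive_id.
Qed.

Lemma is_derive_yco k z u : is_derive z u (yco^~ k) (yco u k).
Proof.
have d : differentiable (fun z : vec => z 0 (iy n k)) z by exact: differentiable_coord.
apply: DeriveDef; first exact: diff_derivable.
by rewrite -[LHS](derive_coord (f := idfun)) ?derive_id.
Qed.

Lemma diff_xco (f : vec -> vec) k z u df : differentiable f z ->
  is_derive z u (fun y => xco (f y) k) df -> xco ('d f z u) k = df.
Proof. by move=> dfz [_ <-]; rewrite /xco -derive_coord // deriveE. Qed.

Lemma diff_yco (f : vec -> vec) k z u df : differentiable f z ->
  is_derive z u (fun y => yco (f y) k) df -> yco ('d f z u) k = df.
Proof. by move=> dfz [_ <-]; rewrite /yco -derive_coord // deriveE. Qed.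

Lemma smooth_on_pairs U (f : vec -> vec) : open U ->
  (forall k, (k <= n)%N -> smooth_on U (fun z => xco (f z) k)) ->
  (forall k, (k <= n)%N -> smooth_on U (fun z => yco (f z) k)) -> smooth_on U f.
Proof.
move=> oU Hx Hy; apply: smooth_on_row => // i; have [k kn [->|->]] := pair_index i.
  exact: Hx.
exact: Hy.
Qed.

End PairedCoordinates.

Section ModelMaps.
Context {R : realType} (n : nat) (eta : nat -> R).
Hypothesis eta0 : forall i, 0 < eta i.
Hypothesis top_eta : forall i, top eta i.+1 <= eta i.
Hypothesis top_le : forall i, top eta i <= i.+1%:R^-1.
Local Notation vec := 'rV[R]_(n.*2.+2).
Local Notation w := (@weight R).
Local Notation w' := (@weight' R).
Local Notation q := (radial eta).
Local Notation q' := (radial' eta).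
Implicit Types (z u v : vec).

(* The shift makes the push start at x_n = -1, hence the missing ray at x_n = 0. *)
Definition axial z : R := xco z n + 1.
Definition transverse z : R := \sum_(k < n) (xco z k ^+ 2 + yco z k ^+ 2).
Definition radius2 z : R := transverse z + yco z n ^+ 2.
Definition coef (a b : nat -> R -> R) z : R := bsum a b (axial z) (radius2 z).
Definition angle z : R := 2 * yco z n * coef w q' z.

(* With B = [coef w q]: alpha is (z', x, Y) |-> (z', x, S_x) and beta rotates z' by the
   angle 2 Y B_r and maps (x, Y) to (S_Y, Y). *)
Definition alpha z : vec := of_pairs (xco z)
  (fun k => if k == n then yco z n * (1 - coef w' q z) else yco z k).

Definition beta z : vec := of_pairs
  (fun k => if k == n then xco z n - coef w q z - 2 * yco z n ^+ 2 * coef w q' z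
            else cos (angle z) * xco z k - sin (angle z) * yco z k)
  (fun k => if k == n then yco z n else sin (angle z) * xco z k + cos (angle z) * yco z k).

Lemma smooth_on_axial U : open U -> smooth_on U axial.
Proof.
move=> oU; apply: smooth_onD => //; first exact: smooth_on_xco.
exact: smooth_on_cst.
Qed.

Lemma smooth_on_transverse U : open U -> smooth_on U transverse.
Proof.
move=> oU; apply: smooth_on_sum => // k _; apply: smooth_onD => //; apply: smooth_onM => //.
- exact: smooth_on_xco.
- exact: smooth_on_xco.
- exact: smooth_on_yco.
- exact: smooth_on_yco.
Qed.

Lemma smooth_on_radius2 U : open U -> smooth_on U radius2.
Proof.
move=> oU; apply: smooth_onD => //; first exact: smooth_on_transverse.
by apply: smooth_onM => //; exact: smooth_on_yco.
Qed.

Lemma smooth_w i : smooth_on setT (w i).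
Proof. by apply: smooth_on_weight; exact: openT. Qed.
Lemma smooth_w' i : smooth_on setT (w' i).
Proof. by rewrite -deriv_seq_weight; apply: smooth_on_derive; exact: smooth_w. Qed.
Lemma smooth_q i : smooth_on setT (q i).
Proof. by apply: smooth_on_radial => //; exact: openT. Qed.
Lemma smooth_q' i : smooth_on setT (q' i).
Proof. by rewrite -deriv_seq_radial //; apply: smooth_on_derive; exact: smooth_q. Qed.

Lemma smooth_on_coef a b U : open U -> locally_finite a ->
  (forall i, smooth_on setT (a i)) -> (forall i, smooth_on setT (b i)) ->
  smooth_on U (coef a b).
Proof.
move=> oU la sa sb; apply: smooth_on_bsum => //.
  exact: smooth_on_axial.
exact: smooth_on_radius2.
Qed.

Definition dtransverse z u : R := \sum_(k < n) (xco z k * xco u k + yco z k * yco u k).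
Definition dradius2 z u : R := 2 * dtransverse z u + 2 * yco z n * yco u n.

Lemma is_derive_axial z u : is_derive z u axial (xco u n).
Proof.
by apply: is_derive_eq (is_derive_addR (is_derive_xco n z u) (is_derive_cst (1 : R) _ _)) _; rewrite addr0.
Qed.

Lemma is_derive_radius2 z u : is_derive z u radius2 (dradius2 z u).
Proof.
have H : is_derive z u (\sum_(k < n) (fun y => xco y k ^+ 2 + yco y k ^+ 2))
    (\sum_(k < n) (2 * (xco z k * xco u k + yco z k * yco u k))).
  apply: is_derive_sum => k.
  apply: is_derive_eq (is_derive_addR (is_derive_mulR (is_derive_xco k z u) (is_derive_xco k z u))
    (is_derive_mulR (is_derive_yco k z u) (is_derive_yco k z u))) _.
  ring.
rewrite -mulr_sumr in H.
have -> : radius2 = (fun y => (\sum_(k < n) (fun y => xco y k ^+ 2 + yco y k ^+ 2)) y + yco y n ^+ 2).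
  by apply/funext => y; rewrite fct_sumE.
apply: is_derive_eq (is_derive_addR H (is_derive_mulR (is_derive_yco n z u) (is_derive_yco n z u))) _.
by rewrite /dradius2 /dtransverse; ring.
Qed.

Lemma is_derive_coef a b z u : locally_finite a ->
  (forall i, smooth_on setT (a i)) -> (forall i, smooth_on setT (b i)) ->
  is_derive z u (coef a b)
    (coef (deriv_seq a) b z * xco u n + coef a (deriv_seq b) z * dradius2 z u).
Proof.
move=> la sa sb; apply: is_derive_bsum => //.
- exact: (smooth_on_continuous (smooth_on_axial (@openT _))).
- exact: is_derive_axial.
- exact: is_derive_radius2.
Qed.

Local Notation Bxx := (coef (deriv_seq w') q).
Local Notation Brr := (coef w (deriv_seq q')).

Definition dangle z u : R := 2 * yco u n * coef w q' z +
  2 * yco z n * (coef w' q' z * xco u n + Brr z * dradius2 z u).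

Definition dalpha_y z u : R := yco u n * (1 - coef w' q z) -
  yco z n * (Bxx z * xco u n + coef w' q' z * dradius2 z u).

Definition dbeta_x z u : R := xco u n - (coef w' q z * xco u n + coef w q' z * dradius2 z u)
  - (4 * yco z n * yco u n * coef w q' z +
     2 * yco z n ^+ 2 * (coef w' q' z * xco u n + Brr z * dradius2 z u)).

Lemma is_derive_wq z u : is_derive z u (coef w q)
  (coef w' q z * xco u n + coef w q' z * dradius2 z u).
Proof.
have := is_derive_coef z u (@locally_finite_weight R) smooth_w smooth_q.
by rewrite deriv_seq_weight deriv_seq_radial.
Qed.

Lemma is_derive_w'q z u : is_derive z u (coef w' q)
  (Bxx z * xco u n + coef w' q' z * dradius2 z u).
Proof.
have := is_derive_coef z u (@locally_finite_weight' R) smooth_w' smooth_q.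
by rewrite deriv_seq_radial.
Qed.

Lemma is_derive_wq' z u : is_derive z u (coef w q')
  (coef w' q' z * xco u n + Brr z * dradius2 z u).
Proof.
have := is_derive_coef z u (@locally_finite_weight R) smooth_w smooth_q'.
by rewrite deriv_seq_weight.
Qed.

Lemma is_derive_angle z u : is_derive z u angle (dangle z u).
Proof.
apply: is_derive_eq (is_derive_mulR (is_derive_mulR (is_derive_cst (2 : R) z u)
  (is_derive_yco n z u)) (is_derive_wq' z u)) _.
by rewrite /dangle /=; ring.
Qed.

Lemma smooth_alpha : smooth_on setT alpha.
Proof.
have oT : open [set: vec] by exact: openT.
apply: smooth_on_pairs => // k kn.
  apply: (smooth_on_ext oT _ (smooth_on_xco k oT)) => z _.
  by rewrite xco_of_pairs.
have H : smooth_on setT (fun z => if k == n then yco z n * (1 - coef w' q z) else yco z k).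
  case: eqP => _; last exact: smooth_on_yco.
  apply: smooth_onM => //; first exact: smooth_on_yco.
  apply: smooth_onB => //; first exact: smooth_on_cst.
  by apply: smooth_on_coef => //; [exact: locally_finite_weight'|exact: smooth_w'|exact: smooth_q].
by apply: (smooth_on_ext oT _ H) => z _; rewrite yco_of_pairs.
Qed.

Lemma smooth_beta : smooth_on setT beta.
Proof.
have oT : open [set: vec] by exact: openT.
have swq' : smooth_on setT (coef w q').
  by apply: smooth_on_coef => //; [exact: locally_finite_weight|exact: smooth_w|exact: smooth_q'].
have sa : smooth_on setT angle.
  apply: smooth_onM => //; apply: smooth_onM => //; first exact: smooth_on_cst.
  exact: smooth_on_yco.
have [s c] := @smooth_on_sin_cos R setT.
have ss : smooth_on setT (fun z => sin (angle z)) by exact: (smooth_on_compR oT (fun _ _ => I) sa s).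
have sc : smooth_on setT (fun z => cos (angle z)) by exact: (smooth_on_compR oT (fun _ _ => I) sa c).
have sx k : smooth_on setT (fun z : vec => xco z k) by exact: smooth_on_xco.
have sy k : smooth_on setT (fun z : vec => yco z k) by exact: smooth_on_yco.
apply: smooth_on_pairs => // k kn.
  have H : smooth_on setT (fun z => if k == n
      then xco z n - coef w q z - 2 * yco z n ^+ 2 * coef w q' z
      else cos (angle z) * xco z k - sin (angle z) * yco z k).
    case: eqP => _; last by apply: smooth_onB => //; exact: smooth_onM.
    apply: smooth_onB => //.
      apply: smooth_onB => //.
      by apply: smooth_on_coef => //; [exact: locally_finite_weight|exact: smooth_w|exact: smooth_q].
    apply: smooth_onM => //; apply: smooth_onM => //; first exact: smooth_on_cst.
    exact: (smooth_onM oT (sy n) (sy n)).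
  by apply: (smooth_on_ext oT _ H) => z _; rewrite xco_of_pairs.
have H : smooth_on setT (fun z => if k == n then yco z n
    else sin (angle z) * xco z k + cos (angle z) * yco z k).
  by case: eqP => _ //; apply: smooth_onD => //; exact: smooth_onM.
by apply: (smooth_on_ext oT _ H) => z _; rewrite yco_of_pairs.
Qed.

Lemma diff_alpha z u : 'd alpha z u = of_pairs (xco u)
  (fun k => if k == n then dalpha_y z u else yco u k).
Proof.
have da := smooth_on_differentiable smooth_alpha (I : setT z).
apply: pairs_ext => k kn; rewrite ?xco_of_pairs ?yco_of_pairs //.
  apply: diff_xco => //.
  have -> : (fun y => xco (alpha y) k) = xco^~ k by apply/funext => y; rewrite xco_of_pairs.
  exact: is_derive_xco.
apply: diff_yco => //.
have -> : (fun y => yco (alpha y) k) =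
    (fun y => if k == n then yco y n * (1 - coef w' q y) else yco y k).
  by apply/funext => y; rewrite yco_of_pairs.
case: eqP => _; last exact: is_derive_yco.
apply: is_derive_eq (is_derive_mulR (is_derive_yco n z u)
  (is_derive_subR (is_derive_cst (1 : R) z u) (is_derive_w'q z u))) _.
by rewrite /dalpha_y /=; ring.
Qed.

Lemma diff_beta z u : 'd beta z u = of_pairs
  (fun k => if k == n then dbeta_x z u else
     cos (angle z) * xco u k - sin (angle z) * yco u k
     - (sin (angle z) * xco z k + cos (angle z) * yco z k) * dangle z u)
  (fun k => if k == n then yco u n else
     sin (angle z) * xco u k + cos (angle z) * yco u k
     + (cos (angle z) * xco z k - sin (angle z) * yco z k) * dangle z u).
Proof.
have db := smooth_on_differentiable smooth_beta (I : setT z).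
have dc := is_derive_compR (is_derive_angle z u) (is_derive_cos (angle z)).
have ds := is_derive_compR (is_derive_angle z u) (is_derive_sin (angle z)).
apply: pairs_ext => k kn; rewrite ?xco_of_pairs ?yco_of_pairs //.
  apply: diff_xco => //.
  have -> : (fun y => xco (beta y) k) = (fun y => if k == n
      then xco y n - coef w q y - 2 * yco y n ^+ 2 * coef w q' y
      else cos (angle y) * xco y k - sin (angle y) * yco y k).
    by apply/funext => y; rewrite xco_of_pairs.
  case: eqP => _; last first.
    apply: is_derive_eq (is_derive_subR (is_derive_mulR dc (is_derive_xco k z u))
      (is_derive_mulR ds (is_derive_yco k z u))) _; ring.
  apply: is_derive_eq (is_derive_subR (is_derive_subR (is_derive_xco n z u) (is_derive_wq z u))
    (is_derive_mulR (is_derive_mulR (is_derive_cst (2 : R) z u)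
      (is_derive_mulR (is_derive_yco n z u) (is_derive_yco n z u))) (is_derive_wq' z u))) _.
  by rewrite /dbeta_x /=; ring.
apply: diff_yco => //.
have -> : (fun y => yco (beta y) k) = (fun y => if k == n then yco y n
    else sin (angle y) * xco y k + cos (angle y) * yco y k).
  by apply/funext => y; rewrite yco_of_pairs.
case: eqP => _; first exact: is_derive_yco.
apply: is_derive_eq (is_derive_addR (is_derive_mulR ds (is_derive_xco k z u))
  (is_derive_mulR dc (is_derive_yco k z u))) _; ring.
Qed.

(** This is $d(dS) = 0$, that is, $dx \wedge dS_x = dS_Y \wedge dY + dS_{z'} \wedge dz'$. With
    $\theta = 2 Y B_r$ the last term is $\frac12 d|z'|^2 \wedge d\theta$, exactly the change of the
    standard form in z' under rotation by the variable angle $\theta$; the identity [E] in the proof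
    expresses the latter. *)
Lemma alpha_beta_form z u v : bilin (omega0 R n) ('d alpha z u) ('d alpha z v) =
  bilin (omega0 R n) ('d beta z u) ('d beta z v).
Proof.
apply: etrans (congr2 (bilin (omega0 R n)) (diff_alpha z u) (diff_alpha z v)) _.
apply/esym; apply: etrans (congr2 (bilin (omega0 R n)) (diff_beta z u) (diff_beta z v)) _.
apply/esym; rewrite !bilin_omega0_last.
rewrite !xco_of_pairs // !yco_of_pairs // !eqxx.
set c := cos (angle z); set s := sin (angle z); set tu := dangle z u; set tv := dangle z v.
have cs : c ^+ 2 = 1 - s ^+ 2 by rewrite -(cos2Dsin2 (angle z)) -/c -/s addrK.
have E : \sum_(k < n) (xco u k * yco v k - yco u k * xco v k) +
    (dtransverse z u * tv - dtransverse z v * tu) =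
  \sum_(k < n) ((c * xco u k - s * yco u k - (s * xco z k + c * yco z k) * tu) *
      (s * xco v k + c * yco v k + (c * xco z k - s * yco z k) * tv) -
    (s * xco u k + c * yco u k + (c * xco z k - s * yco z k) * tu) *
      (c * xco v k - s * yco v k - (s * xco z k + c * yco z k) * tv)).
  rewrite /dtransverse 2!mulr_suml -sumrB -big_split /=; apply: eq_bigr => k _.
  move: (xco u k) (yco u k) (xco v k) (yco v k) (xco z k) (yco z k) => a b a' b' x y.
  transitivity ((c ^+ 2 + s ^+ 2) * (a * b' - b * a' +
     ((x * a + y * b) * tv - (x * a' + y * b') * tu))); last by ring.
  by rewrite cs subrK mul1r.
transitivity (\sum_(k < n) (xco u k * yco v k - yco u k * xco v k) +
    (xco u n * dalpha_y z v - dalpha_y z u * xco v n)).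
  congr (_ + _); apply: eq_bigr => k _; have kn := ltn_ord k.
  by rewrite !xco_of_pairs ?(ltnW kn) // !yco_of_pairs ?(ltnW kn) // (ltn_eqF kn).
transitivity (\sum_(k < n) (xco u k * yco v k - yco u k * xco v k) +
    (dtransverse z u * tv - dtransverse z v * tu) +
    (dbeta_x z u * yco v n - yco u n * dbeta_x z v)).
  rewrite -addrA; congr (_ + _).
  rewrite /tu /tv /dalpha_y /dbeta_x /dangle /dradius2; ring.
rewrite E; congr (_ + _); apply: eq_bigr => k _; have kn := ltn_ord k.
by rewrite !xco_of_pairs ?(ltnW kn) // !yco_of_pairs ?(ltnW kn) // (ltn_eqF kn).
Qed.

End ModelMaps.

(** * Monotonicity and bijectivity of the model maps *)

Section Monotone.
Context {R : realType}.
Variables (f f' : R -> R).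
Hypotheses (df : forall x : R, is_derive x 1 f (f' x)) (f'0 : forall x, 0 < f' x).

Lemma derive_continuous : continuous f.
Proof.
move=> x; apply: differentiable_continuous; apply: derivable1_differentiable.
by have [] := df x.
Qed.

Lemma derive_gt0_incr a b : a < b -> f a < f b.
Proof.
move=> ab; have cf : {within `[a, b], continuous f}.
  by apply: continuous_in_subspaceT => x _; exact: derive_continuous.
have [c _ E] := MVT ab (fun x _ => df x) cf.
by rewrite -subr_gt0 E mulr_gt0 // subr_gt0.
Qed.

Lemma derive_gt0_inj : injective f.
Proof.
move=> a b ab; have [H|H|//] := ltgtP a b.
  by have := derive_gt0_incr H; rewrite ab ltxx.
by have := derive_gt0_incr H; rewrite ab ltxx.
Qed.

Lemma derive_gt0_IVT a b y : f a <= y <= f b -> exists x, f x = y.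
Proof.
move=> /andP[ay yb]; have ab : a <= b.
  rewrite leNgt; apply/negP => /derive_gt0_incr.
  by rewrite ltNge (le_trans ay yb).
have cf : {within `[a, b], continuous f}.
  by apply: continuous_in_subspaceT => x _; exact: derive_continuous.
have my : Num.min (f a) (f b) <= y <= Num.max (f a) (f b).
  by rewrite ge_min ay le_max yb orbT.
by have [c _ <-] := IVT ab cf my; exists c.
Qed.

End Monotone.

Section ModelBijections.
Context {R : realType} (n : nat) (eta : nat -> R).
Hypothesis eta0 : forall i, 0 < eta i.
Hypothesis top_eta : forall i, top eta i.+1 <= eta i.
Hypothesis top_le : forall i, top eta i <= i.+1%:R^-1.
Local Notation vec := 'rV[R]_(n.*2.+2).
Local Notation w := (@weight R).
Local Notation w' := (@weight' R).
Local Notation q := (radial eta).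
Local Notation q' := (radial' eta).
Implicit Types (z u : vec).
Local Notation alpha := (@alpha R n eta).
Local Notation beta := (@beta R n eta).

Definition height x rho Y : R := Y * (1 - bsum w' q (x + 1) (rho + Y ^+ 2)).
Definition advance r v x : R := x - bsum w q (x + 1) r - 2 * v * bsum w q' (x + 1) r.

(** The mixed derivative $S_{xY}$ is the slope of $S_x$ in Y and of $S_Y$ in x; hence the expression
    in [is_derive_advance] is the same, with $v = Y^2$, and one positivity statement serves both
    maps. *)
Lemma is_derive_height x rho (Y : R) : is_derive Y 1 (height x rho)
  (1 - bsum w' q (x + 1) (rho + Y ^+ 2) - 2 * Y ^+ 2 * bsum w' q' (x + 1) (rho + Y ^+ 2)).
Proof.
have dr : is_derive Y 1 (fun Y : R => rho + Y ^+ 2) (2 * Y).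
  apply: is_derive_eq (is_derive_addR (is_derive_cst rho Y 1)
    (is_derive_mulR (is_derive_id Y 1) (is_derive_id Y 1))) _.
  by rewrite /=; ring.
have := is_derive_bsum (@locally_finite_weight' R) (@smooth_w' R) (smooth_q eta)
  (@cst_continuous _ _ (x + 1) Y) (is_derive_cst (x + 1) Y 1) dr.
rewrite deriv_seq_radial // mulr0 add0r => db.
apply: is_derive_eq (is_derive_mulR (is_derive_id Y 1)
  (is_derive_subR (is_derive_cst (1 : R) Y 1) db)) _.
by rewrite /=; ring.
Qed.

Lemma is_derive_advance r v (x : R) : is_derive x 1 (advance r v)
  (1 - bsum w' q (x + 1) r - 2 * v * bsum w' q' (x + 1) r).
Proof.
have dT : is_derive x 1 (fun x : R => x + 1) 1.
  by apply: is_derive_eq (is_derive_addR (is_derive_id x 1) (is_derive_cst (1 : R) x 1)) _; rewrite addr0.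
have cT : {for x, continuous (fun x : R => x + 1)}.
  apply: differentiable_continuous; apply: derivable1_differentiable; by have [] := dT.
have := is_derive_bsum (@locally_finite_weight R) (@smooth_w R) (smooth_q eta)
  cT dT (is_derive_cst r x 1).
have := is_derive_bsum (@locally_finite_weight R) (@smooth_w R) (smooth_q' eta0)
  cT dT (is_derive_cst r x 1).
rewrite deriv_seq_weight !mulr0 !addr0 !mulr1 => d1 d2.
apply: is_derive_eq (is_derive_subR (is_derive_subR (is_derive_id x 1) d2)
  (is_derive_mulR (is_derive_cst (2 * v) x 1) d1)) _.
by rewrite /=; ring.
Qed.

Lemma height_slope x rho Y : 0 <= rho ->
  0 < 1 - bsum w' q (x + 1) (rho + Y ^+ 2) - 2 * Y ^+ 2 * bsum w' q' (x + 1) (rho + Y ^+ 2).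
Proof. by move=> rho0; apply: twist_gt0 => //; rewrite sqr_ge0 lerDr. Qed.

Lemma height_inj x rho : 0 <= rho -> injective (height x rho).
Proof.
by move=> rho0; exact: derive_gt0_inj (is_derive_height x rho) (fun Y => height_slope x Y rho0).
Qed.

Lemma height_surj x rho y : 0 <= rho -> exists Y, height x rho Y = y.
Proof.
(* All cut-offs vanish for $r \ge 1$, so [height] is the identity at $\pm(1 + |y|)$ and these points
   enclose [y]. *)
move=> rho0; have far Y : 1 <= Y ^+ 2 -> height x rho Y = Y.
  move=> Y1; have r1 : 1 <= rho + Y ^+ 2 by rewrite (le_trans Y1) // lerDr.
  rewrite /height; have [_ -> _ _] := bsum_large eta0 top_eta top_le (x + 1) r1.
  by rewrite subr0 mulr1.
apply: (derive_gt0_IVT (is_derive_height x rho) (fun Y => height_slope x Y rho0)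
  (a := - (1 + `|y|)) (b := 1 + `|y|)).
have a0 : 0 <= `|y| by [].
have s1 : 1 <= (1 + `|y|) ^+ 2 by rewrite exprn_ege1 // lerDl.
rewrite !far ?sqrrN //; have := ler_norm y; have := ler_norm (- y); rewrite normrN => h1 h2.
by apply/andP; split; lra.
Qed.

Lemma advance_inj r v : 0 <= v <= r -> injective (advance r v).
Proof.
by move=> vr; exact: derive_gt0_inj (is_derive_advance r v) (fun x => twist_gt0 eta0 top_eta (x + 1) vr).
Qed.

Lemma advance0 x : advance 0 0 x = (x + 1 - push (x + 1)) - 1.
Proof. by rewrite /advance; have [-> _] := bsum_zero eta0 (x + 1); ring. Qed.

(** The map is the identity for $x \le -1$ and, when $r > 0$, also for large x. When $r = 0$ it is
    the shifted push, which comes arbitrarily close to 0 from below. *)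
Lemma advance_surj r v y : 0 <= v <= r -> (r = 0 -> y < 0) -> exists x, advance r v x = y.
Proof.
move=> vr Hy; have /andP[v0 r0] := vr.
have mono := derive_gt0_IVT (is_derive_advance r v) (fun x => twist_gt0 eta0 top_eta (x + 1) vr).
have low x : x <= -1 -> advance r v x = x.
  move=> x1; have x0 : x + 1 <= 0 by lra.
  rewrite /advance; have [-> _] := bsum_npos q r x0; have [-> _] := bsum_npos q' r x0.
  by rewrite mulr0 !subr0.
pose a := Num.min (-1) y.
have fa : advance r v a <= y by rewrite low ge_min ?lexx ?orbT.
have [rz|rp] : r = 0 \/ 0 < r by have := le_trans v0 r0; rewrite le_eqVlt => /orP[/eqP|]; auto.
  have y0 := Hy rz; have vz : v = 0 by apply/eqP; rewrite eq_le v0 andbT -rz.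
  (* With this [t], the lower bound $t/(1+t) \ge 1 - 1/t = 1 + y$ shows that the value at $t - 1$ is
     at least [y]. *)
  subst r v; pose t := - y^-1; have t0 : 0 < t by rewrite oppr_gt0 invr_lt0.
  apply: (mono a (t - 1)); rewrite fa /= advance0 subrK.
  have [_ /(_ (ltW t0)) H] := push_range t.
  have H2 : - t^-1 = y by rewrite /t invrN invrK opprK.
  suff : 1 - t^-1 <= t / (1 + t) by lra.
  have t1 : 0 < 1 + t by lra.
  rewrite ler_pdivlMr // mulrBl mul1r mulrDr mulr1 mulVf ?gt_eqF //.
  have : 0 < t^-1 by rewrite invr_gt0.
  lra.
have [K HK] := bsum_far eta0 top_eta top_le rp.
pose b := Num.max K y.
have fb : advance r v b = b.
  rewrite /advance; have [|-> ->] := HK (b + 1); last by rewrite mulr0 !subr0.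
  by rewrite (@le_trans _ _ b) // ?lerDl // le_max lexx.
by apply: (mono a b); rewrite fa fb le_max lexx orbT.
Qed.

End ModelBijections.

Section Model.
Context {R : realType} (n : nat).
Local Notation vec := 'rV[R]_(n.*2.+2).
Implicit Types (z u v : vec).

Definition half_line : set vec := [set z | transverse z = 0 /\ yco z n = 0 /\ 0 <= xco z n].

Lemma transverse_ge0 z : 0 <= transverse z.
Proof. by apply: sumr_ge0 => k _; rewrite addr_ge0 // sqr_ge0. Qed.

Lemma square_le_radius2 z : 0 <= yco z n ^+ 2 <= radius2 z.
Proof. by rewrite sqr_ge0 lerDr transverse_ge0. Qed.

Lemma transverse_pairs (f g f' g' : nat -> R) z :
  (forall k, (k < n)%N -> f k = f' k) -> (forall k, (k < n)%N -> g k = g' k) ->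
  transverse (of_pairs f g : vec) = \sum_(k < n) (f' k ^+ 2 + g' k ^+ 2).
Proof.
move=> Hf Hg; apply: eq_bigr => k _; have kn := ltn_ord k.
by rewrite xco_of_pairs ?(ltnW kn) // yco_of_pairs ?(ltnW kn) // Hf // Hg.
Qed.

Section Maps.
Variable eta : nat -> R.
Hypothesis eta0 : forall i, 0 < eta i.
Hypothesis top_eta : forall i, top eta i.+1 <= eta i.
Hypothesis top_le : forall i, top eta i <= i.+1%:R^-1.
Local Notation alpha := (@alpha R n eta).
Local Notation beta := (@beta R n eta).
Local Notation w := (@weight R).
Local Notation w' := (@weight' R).
Local Notation q := (radial eta).
Local Notation q' := (radial' eta).

Lemma transverse_alpha z : transverse (alpha z) = transverse z.
Proof.
apply: (@transverse_pairs _ _ (xco z) (yco z)) => // k kn; by rewrite (ltn_eqF kn).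
Qed.

Lemma transverse_beta z : transverse (beta z) = transverse z.
Proof.
rewrite /beta (@transverse_pairs _ _
   (fun k => cos (angle eta z) * xco z k - sin (angle eta z) * yco z k)
   (fun k => sin (angle eta z) * xco z k + cos (angle eta z) * yco z k)) //; last 2 first.
- by move=> k kn; rewrite (ltn_eqF kn).
- by move=> k kn; rewrite (ltn_eqF kn).
apply: eq_bigr => k _; have := cos2Dsin2 (angle eta z).
move: (cos _) (sin _) (xco z k) (yco z k) => c s x y cs.
transitivity ((c ^+ 2 + s ^+ 2) * (x ^+ 2 + y ^+ 2)); first by ring.
by rewrite cs mul1r.
Qed.

Lemma yco_alpha z : yco (alpha z) n = height eta (xco z n) (transverse z) (yco z n).
Proof. by rewrite yco_of_pairs // eqxx. Qed.

Lemma xco_beta z : xco (beta z) n = advance eta (radius2 z) (yco z n ^+ 2) (xco z n).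
Proof. by rewrite xco_of_pairs // eqxx. Qed.

Lemma yco_beta z : yco (beta z) n = yco z n.
Proof. by rewrite yco_of_pairs // eqxx. Qed.

(* At fixed x and z', alpha is [height] in Y; at fixed Y and |z'|, beta is [advance] in x
   composed with a rotation of z'. *)
Lemma alpha_inj : injective alpha.
Proof.
move=> z z' E.
have Ex k : (k <= n)%N -> xco z k = xco z' k.
  by move=> kn; have := congr1 (fun y => xco y k) E; rewrite !xco_of_pairs.
have Et : transverse z = transverse z' by rewrite -transverse_alpha E transverse_alpha.
have Ey : yco z n = yco z' n.
  apply: (@height_inj _ _ eta0 top_eta (xco z n) _ (transverse_ge0 z)).
  by rewrite -yco_alpha E yco_alpha Et Ex.
apply: pairs_ext => // k; rewrite leq_eqVlt => /orP[/eqP ->//|kn].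
have := congr1 (fun y => yco y k) E.
by rewrite /= !yco_of_pairs ?(ltnW kn) // (ltn_eqF kn).
Qed.

Lemma alpha_surj t : exists z, alpha z = t.
Proof.
have [Y HY] := height_surj eta0 top_eta top_le (xco t n) (yco t n) (transverse_ge0 t).
have [z zE] : exists z : vec, z = of_pairs (xco t) (fun k => if k == n then Y else yco t k).
  by eexists.
have Et : transverse z = transverse t.
  by rewrite zE; apply: (@transverse_pairs _ _ (xco t) (yco t)) => // k kn; rewrite (ltn_eqF kn).
have zx k : (k <= n)%N -> xco z k = xco t k by move=> kn; rewrite zE xco_of_pairs.
have zy : yco z n = Y by rewrite zE yco_of_pairs // eqxx.
exists z; apply: pairs_ext => k kn; first by rewrite xco_of_pairs // zx.
have [->|kn'] := eqVneq k n.
  by rewrite yco_alpha Et (zx n (leqnn n)) zy.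
by rewrite yco_of_pairs // (negbTE kn') zE yco_of_pairs // (negbTE kn').
Qed.

Lemma rotation_inj (c s a b a' b' : R) : c ^+ 2 + s ^+ 2 = 1 ->
  c * a - s * b = c * a' - s * b' -> s * a + c * b = s * a' + c * b' -> a = a' /\ b = b'.
Proof.
move=> cs e1 e2; split.
  have <- : c * (c * a' - s * b') + s * (s * a' + c * b') = a'.
    by transitivity ((c ^+ 2 + s ^+ 2) * a'); [ring|rewrite cs mul1r].
  rewrite -e1 -e2; transitivity ((c ^+ 2 + s ^+ 2) * a); [by rewrite cs mul1r|ring].
have <- : - s * (c * a' - s * b') + c * (s * a' + c * b') = b'.
  by transitivity ((c ^+ 2 + s ^+ 2) * b'); [ring|rewrite cs mul1r].
rewrite -e1 -e2; transitivity ((c ^+ 2 + s ^+ 2) * b); [by rewrite cs mul1r|ring].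
Qed.

Lemma beta_inj : injective beta.
Proof.
move=> z z' E.
have Ey : yco z n = yco z' n by rewrite -yco_beta E yco_beta.
have Et : transverse z = transverse z' by rewrite -transverse_beta E transverse_beta.
have Er : radius2 z = radius2 z' by rewrite /radius2 Et Ey.
have Ex : xco z n = xco z' n.
  apply: (advance_inj eta0 top_eta (square_le_radius2 z)).
  by rewrite -xco_beta E xco_beta Er Ey.
have Ea : angle eta z = angle eta z' by rewrite /angle /coef /axial Er Ex Ey.
have rest k : (k <= n)%N -> xco z k = xco z' k /\ yco z k = yco z' k.
  rewrite leq_eqVlt => /orP[/eqP ->//|kn].
  have e1 := congr1 (fun y => xco y k) E; have e2 := congr1 (fun y => yco y k) E.
  move: e1 e2; rewrite /= !xco_of_pairs ?(ltnW kn) // !yco_of_pairs ?(ltnW kn) //.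
  rewrite (ltn_eqF kn) Ea; apply: rotation_inj; exact: cos2Dsin2.
by apply: pairs_ext => k /rest [].
Qed.

(** As [transverse] and the last y-coordinate are preserved, only a point of the axis could land
    there, and on the axis the push stays below its supremum. *)
Lemma beta_half_line z : ~ half_line (beta z).
Proof.
rewrite /half_line /= transverse_beta yco_beta xco_beta => -[t0 [y0 +]].
rewrite /radius2 t0 y0 expr0n addr0 advance0 // leNgt => /negP; apply.
by rewrite subr_lt0; have [] := push_range (xco z n + 1).
Qed.

(** Since $|z'|$ and Y are preserved, x can be solved for separately; the rotation angle is then
    known from x, $|z'|$ and Y, and the rotation is undone. *)
Lemma beta_surj t : ~ half_line t -> exists z, beta z = t.
Proof.
move=> tl; have r0 : radius2 t = 0 -> xco t n < 0.
  move=> r0; rewrite ltNge; apply/negP => x0; apply: tl.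
  have T0 := transverse_ge0 t; have Y0 := sqr_ge0 (yco t n).
  move: r0; rewrite /radius2 => r0.
  split; first by apply/eqP; rewrite eq_le T0 andbT; lra.
  by split => //; apply/eqP; rewrite -sqrf_eq0 eq_le Y0 andbT; lra.
have [X HX] := advance_surj eta0 top_eta top_le (square_le_radius2 t) r0.
pose th := 2 * yco t n * bsum w q' (X + 1) (radius2 t).
have [z zE] : exists z : vec, z = of_pairs
  (fun k => if k == n then X else cos th * xco t k + sin th * yco t k)
  (fun k => if k == n then yco t n else - sin th * xco t k + cos th * yco t k).
  by eexists.
have Et : transverse z = transverse t.
  rewrite zE (@transverse_pairs _ _ (fun k => cos th * xco t k + sin th * yco t k)
     (fun k => - sin th * xco t k + cos th * yco t k)) //; last 2 first.
  - by move=> k kn; rewrite (ltn_eqF kn).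
  - by move=> k kn; rewrite (ltn_eqF kn).
  apply: eq_bigr => k _; have := cos2Dsin2 th.
  move: (cos _) (sin _) (xco t k) (yco t k) => c s x y cs.
  transitivity ((c ^+ 2 + s ^+ 2) * (x ^+ 2 + y ^+ 2)); first by ring.
  by rewrite cs mul1r.
have zy : yco z n = yco t n by rewrite zE yco_of_pairs // eqxx.
have zx : xco z n = X by rewrite zE xco_of_pairs // eqxx.
have zr : radius2 z = radius2 t by rewrite /radius2 Et zy.
have za : angle eta z = th by rewrite /angle /coef /axial zr zy zx.
have cs := cos2Dsin2 th.
exists z; apply: pairs_ext => k; rewrite leq_eqVlt => /orP[/eqP ->|kn].
- by rewrite xco_beta zr zy zx.
- rewrite xco_of_pairs ?(ltnW kn) // (ltn_eqF kn) za.
  rewrite zE xco_of_pairs ?(ltnW kn) // (ltn_eqF kn) yco_of_pairs ?(ltnW kn) // (ltn_eqF kn).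
  move: (cos th) (sin th) (xco t k) (yco t k) cs => c s x y cs.
  by transitivity ((c ^+ 2 + s ^+ 2) * x); [ring|rewrite cs mul1r].
- by rewrite yco_beta.
- rewrite yco_of_pairs ?(ltnW kn) // (ltn_eqF kn) za.
  rewrite zE xco_of_pairs ?(ltnW kn) // (ltn_eqF kn) yco_of_pairs ?(ltnW kn) // (ltn_eqF kn).
  move: (cos th) (sin th) (xco t k) (yco t k) cs => c s x y cs.
  by transitivity ((c ^+ 2 + s ^+ 2) * y); [ring|rewrite cs mul1r].
Qed.

Definition support : set vec :=
  [set z | exists k, k%:R <= axial z <= k.+1%:R /\ radius2 z <= top eta k].

Lemma coef_support z : ~ support z ->
  [/\ coef w q z = 0, coef w' q z = 0 & coef w q' z = 0].
Proof.
move=> zs; rewrite /coef; have [t0|/ltW/nat_interval[k kt]] := leP (axial z) 0.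
  have [-> ->] := bsum_npos q (radius2 z) t0.
  by have [-> _] := bsum_npos q' (radius2 z) t0.
have rk : top eta k <= radius2 z.
  by rewrite leNgt; apply/negP => H; apply: zs; exists k; split => //; exact: ltW.
by have [-> -> -> _] := bsum_high eta0 top_eta kt rk.
Qed.

Lemma alpha_support z : ~ support z -> alpha z = z.
Proof.
move=> /coef_support[_ E _]; apply: pairs_ext => k kn; rewrite ?xco_of_pairs ?yco_of_pairs //.
by case: eqP => [->|//]; rewrite E subr0 mulr1.
Qed.

Lemma beta_support z : ~ support z -> beta z = z.
Proof.
move=> /coef_support[E1 _ E2].
have a0 : angle eta z = 0 by rewrite /angle E2 mulr0.
apply: pairs_ext => k kn; rewrite ?xco_of_pairs ?yco_of_pairs //.
  case: eqP => [->|_]; first by rewrite E1 E2 mulr0 !subr0.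
  by rewrite a0 cos0 sin0 mul0r mul1r subr0.
by case: eqP => [->//|_]; rewrite a0 cos0 sin0 mul0r mul1r add0r.
Qed.

(** The differential is triangular; its only diagonal entry different from 1 is the twist quantity
    at $v = Y^2$. *)
Lemma alpha_regular z : regular_at alpha z.
Proof.
move=> u; have E := diff_alpha eta0 z u.
move=> u0; have {E u0} E : of_pairs (xco u)
  (fun k => if k == n then dalpha_y eta z u else yco u k) = 0 :> vec by rewrite -E.
have Ex k : (k <= n)%N -> xco u k = 0.
  by move=> kn; have := congr1 (fun y : vec => xco y k) E; rewrite xco_of_pairs // /xco mxE.
have Ey k : (k < n)%N -> yco u k = 0.
  move=> kn; have := congr1 (fun y : vec => yco y k) E.
  by rewrite yco_of_pairs ?(ltnW kn) // (ltn_eqF kn) /yco mxE.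
have dt0 : dtransverse z u = 0.
  by apply: big1 => k _; have kn := ltn_ord k; rewrite Ex ?(ltnW kn) // Ey // !mulr0 addr0.
have := congr1 (fun y : vec => yco y n) E.
rewrite yco_of_pairs // eqxx /dalpha_y /dradius2 dt0 Ex // [yco 0 n]mxE => H.
have {H} H : yco u n * (1 - coef w' q z - 2 * yco z n ^+ 2 * coef w' q' z) = 0.
  by rewrite -H; ring.
have D0 := twist_gt0 eta0 top_eta (axial z) (square_le_radius2 z).
have un : yco u n = 0 by move/eqP: H; rewrite mulf_eq0 [X in _ || X]gt_eqF // orbF => /eqP.
apply: pairs_ext => k kn; rewrite [RHS]mxE; first exact: Ex.
by move: kn; rewrite leq_eqVlt => /orP[/eqP ->//|]; exact: Ey.
Qed.

(** A vector killed by the differential of [beta] lies in the kernel of the common pulled-back form,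
    which is nondegenerate because [alpha] is regular. *)
Lemma beta_regular z : regular_at beta z.
Proof.
move=> u u0; apply: (@alpha_regular z); apply: omega0_nondegenerate => v.
have Ju := regular_jacobian (@alpha_regular z).
have -> : v = 'd alpha z (v *m invmx (jacobian alpha z)).
  have := diff_jacobian alpha z (v *m invmx (jacobian alpha z)).
  by rewrite mulmxKV.
rewrite alpha_beta_form // u0 /bilin !mul0mx mxE.
by [].
Qed.

Theorem model_symplectomorphism : exists phi psi : vec -> vec,
  [/\ forall z, psi (phi z) = z,
      forall z, ~ half_line z -> phi (psi z) = z,
      forall z, ~ half_line (phi z),
      forall z, transverse (phi z) = transverse z &
      forall z, ~ support z -> phi z = z] /\
  [/\ smooth_on setT phi,
      open (~` half_line) /\ smooth_on (~` half_line) psi &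
      forall z u v, bilin (omega0 R n) ('d phi z u) ('d phi z v) = bilin (omega0 R n) u v].
Proof.
have [ai aK] : exists ai : vec -> vec, forall t, alpha (ai t) = t.
  exists (fun t => xget 0 [set z | alpha z = t]) => t; have [z Hz] := alpha_surj t.
  exact: (@xgetI _ 0 [set z | alpha z = t] z Hz).
have [bi bK] : exists bi : vec -> vec, forall t, ~ half_line t -> beta (bi t) = t.
  exists (fun t => xget 0 [set z | beta z = t]) => t /beta_surj[z Hz].
  exact: (@xgetI _ 0 [set z | beta z = t] z Hz).
have Ka z : ai (alpha z) = z by apply: alpha_inj; rewrite aK.
have Kb z : bi (beta z) = z by apply: beta_inj; rewrite bK //; exact: beta_half_line.
have oT : open [set: vec] by exact: openT.
have sa := @smooth_alpha R n eta; have sb := smooth_beta n eta0.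
have ra : alpha @` setT = setT by apply/seteqP; split => // t _; exists (ai t).
have rb : beta @` setT = ~` half_line.
  apply/seteqP; split => [_ [z _ <-]|t tl]; first exact: beta_half_line.
  by exists (bi t) => //; exact: bK.
have orb : open (~` half_line).
  by rewrite -rb; apply: regular_open_image sb _ => // z _; exact: beta_regular.
have sai : smooth_on setT ai.
  by rewrite -ra; apply: (smooth_on_inverse oT sa) => z _; [exact: alpha_regular|exact: Ka].
have sbi : smooth_on (~` half_line) bi.
  by rewrite -rb; apply: (smooth_on_inverse oT sb) => z _; [exact: beta_regular|exact: Kb].
exists (fun z => beta (ai z)), (fun z => alpha (bi z)); split; split.
- by move=> z; rewrite Kb aK.
- by move=> z zl; rewrite Ka bK.
- by move=> z; exact: beta_half_line.
- by move=> z; rewrite transverse_beta -{2}(aK z) transverse_alpha.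
- move=> z zs; rewrite -{1}(alpha_support zs) Ka; exact: beta_support.
- exact: (smooth_on_comp oT oT (fun _ _ => I) sai sb).
- by split => //; exact: (smooth_on_comp orb oT (fun _ _ => I) sbi sa).
- move=> z u v.
  have dai : differentiable ai z := smooth_on_differentiable sai (I : setT z).
  have db : differentiable beta (ai z) := smooth_on_differentiable sb (I : setT (ai z)).
  have da : differentiable alpha (ai z) := smooth_on_differentiable sa (I : setT (ai z)).
  have Eid x : 'd alpha (ai z) ('d ai z x) = x.
    apply: etrans (esym (diff_compE x dai da)) _.
    have -> : (fun y => alpha (ai y)) = id by apply/funext => y; exact: aK.
    by rewrite diff_val.
  apply: etrans (congr2 (bilin (omega0 R n)) (diff_compE u dai db) (diff_compE v dai db)) _.
  apply: etrans (esym (alpha_beta_form eta0 _ _ _)) _.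
  by apply: f_equal2; exact: Eid.
Qed.

End Maps.
End Model.

(** * Charts *)

Section Charts.
Context {R : realType}.

(** The clause of [smooth_manifold] about single charts, isolated because it is what open
    restrictions and the cylinder are shown to satisfy. *)
Definition good_charts {d : nat} (M : chartedSpace R d) := forall i : chart M,
  [/\ open (dom i), {in dom i &, injective (coord i)},
      forall x, dom i x -> {for x, continuous (coord i)} &
      forall U, open U -> U `<=` dom i -> open (coord i @` U)].

Lemma in_chartE {d : nat} {M : chartedSpace R d} {W : normedModType R} (i : chart M)
    (D : set M) (h : M -> W) x : D x ->
  (forall y, D y -> coord i y = coord i x -> h y = h x) -> in_chart i D h (coord i x) = h x.
Proof.
move=> Dx H; rewrite /in_chart.
have [y [Dy cy] <-] := @xgetI _ 0 [set h x0 | x0 in [set y | D y /\ coord i y = coord i x]] (h x)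
  (ex_intro2 _ _ x (conj Dx erefl) erefl).
exact: H.
Qed.

Lemma good_charts_inj {d : nat} {M : chartedSpace R d} (i : chart M) x y : good_charts M ->
  dom i x -> dom i y -> coord i x = coord i y -> x = y.
Proof. by move=> /(_ i)[_ H _ _] Dx Dy; apply: H; apply: mem_set. Qed.

Section LocalExpr.
Context {d e : nat} {M : chartedSpace R d} {N : chartedSpace R e}.
Hypotheses (gM : good_charts M).
Variable f : M -> N.

Lemma local_exprE i j x : dom i x -> dom j (f x) -> local_expr f i j (coord i x) = coord j (f x).
Proof.
move=> ix jx; rewrite /local_expr in_chartE //= => y [iy _] /(good_charts_inj gM iy ix) ->.
by [].
Qed.

Hypotheses (gN : good_charts N) (cf : continuous f).

Lemma open_local_dom i j : open (local_dom f i j).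
Proof.
have [oi _ _ _] := gM i; have [oj _ _ _] := gN j.
by apply: open_preimage_on => // x _; exact: cf.
Qed.

Lemma open_local_coord i j : open (coord i @` local_dom f i j).
Proof.
have [_ _ _ H] := gM i; apply: H; first exact: open_local_dom.
by move=> x [].
Qed.

(* [h] is defined on an open set of coordinates that need not be the image of the local
   domain; smoothness of a map can thus be tested with any convenient extension. *)
Definition represents (W : set 'rV[R]_d) (h : 'rV[R]_d -> 'rV[R]_e) i j x :=
  [/\ open W, W (coord i x), smooth_on W h &
      forall y, dom i y -> dom j (f y) -> W (coord i y) -> coord j (f y) = h (coord i y)].

Lemma represents_near W h i j x : dom i x -> dom j (f x) -> represents W h i j x ->
  {near coord i x, h =1 local_expr f i j}.
Proof.
move=> ix jx [oW Wx _ H].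
have Ux : (W `&` (coord i @` local_dom f i j)) (coord i x) by split => //; exists x.
apply: (open_near (openI oW (@open_local_coord i j)) Ux).
by move=> z [Wz [y [iy jy] E]]; rewrite -E local_exprE // H // E.
Qed.

Lemma smooth_map_local :
  (forall x i j, dom i x -> dom j (f x) -> exists W h, represents W h i j x) -> smooth_map f.
Proof.
move=> H; split => // i j; apply: smooth_on_local => _ [x [ix jx] <-].
have [W [h [oW Wx sh Hh]]] := H x i j ix jx.
have oV := openI oW (@open_local_coord i j).
exists (W `&` (coord i @` local_dom f i j)); split => //.
  by split => //; exists x.
apply: (smooth_on_ext oV _ (smooth_on_sub (@subIsetl _ _ _) sh)).
by move=> z [Wz [y [iy jy] E]]; rewrite -E local_exprE // Hh // E.
Qed.

Lemma represents_diff W h i j x u : dom i x -> dom j (f x) -> represents W h i j x ->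
  'd (local_expr f i j) (coord i x) u = 'd h (coord i x) u.
Proof.
move=> ix jx rep; have nE := represents_near ix jx rep; have [_ Wx sh _] := rep.
exact: near_eq_diff (smooth_on_differentiable sh Wx).
Qed.

End LocalExpr.

Lemma set_val_continuous {T : topologicalType} (A : set T) : continuous (@set_val T A).
Proof. exact: initial_continuous. Qed.

Lemma set_type_continuous {S T : topologicalType} (A : set T) (f : S -> set_type A) x :
  {for x, continuous (set_val \o f)} -> {for x, continuous f}.
Proof.
move=> cf B; rewrite /= nbhsE => -[_ [[C oC <-] Cx] CB].
have H : nbhs x ((set_val \o f) @^-1` C) by apply: cf; exact: open_nbhs_nbhs.
by apply: (@filterS _ _ (nbhs_filter x)) H => y Cy; exact: CB.
Qed.

Lemma open_set_val {T : topologicalType} (A : set T) (B : set (set_type A)) :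
  open A -> open B -> open (set_val @` B).
Proof.
move=> oA [C oC <-].
have E : [set set_val x | x in (set_val : set_type A -> T) @^-1` C] = A `&` C.
  apply/seteqP; split => [_ [x Cx <-]|x [Ax Cx]].
    by split => //; exact: set_valP.
  by exists (SigSub (mem_set Ax)).
have oAC : open (A `&` C) by exact: openI.
by rewrite -E in oAC.
Qed.

Lemma good_charts_restriction {d : nat} (M : formedSpace R d) (U : set M) :
  good_charts M -> open U -> good_charts (restriction U).
Proof.
move=> gM oU i; have [oi inj_i ci open_i] := gM i; split.
- by apply: open_comp oi => x _; exact: set_val_continuous.
- move=> x y; rewrite !inE /= => ix iy E; apply: val_inj.
  by apply: inj_i E; rewrite inE.
- move=> x ix; apply: continuous_comp; first exact: set_val_continuous.
  exact: ci.
- move=> V oV Vi; rewrite /= -image_comp; apply: open_i; first exact: open_set_val.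
  by move=> _ [x Vx <-]; exact: Vi Vx.
Qed.

End Charts.

(** * Open parametrizations and extension by the identity *)

Section Parametrization.
Context {R : realType} {d : nat} {M : formedSpace R d}.
Local Notation vec := 'rV[R]_d.
Hypothesis gM : good_charts M.
Variables (w : 'M[R]_d) (O : set vec) (jh : vec -> M).
Hypotheses (oO : open O) (jc : forall z, O z -> {for z, continuous jh}).
Hypothesis ji : forall z z', O z -> O z' -> jh z = jh z' -> z = z'.

Definition chart_dom (b : chart M) : set vec := O `&` jh @^-1` dom b.
Definition chart_fun (b : chart M) : vec -> vec := fun z => coord b (jh z).

Hypothesis js : forall b, smooth_on (chart_dom b) (chart_fun b).
Hypothesis jr : forall b z, chart_dom b z -> regular_at (chart_fun b) z.
Hypothesis jf : forall b z u v, chart_dom b z ->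
  bilin (form b (jh z)) ('d (chart_fun b) z u) ('d (chart_fun b) z v) = bilin w u v.

Lemma open_chart_dom b : open (chart_dom b).
Proof. by have [ob _ _ _] := gM b; exact: open_preimage_on. Qed.

Lemma chart_fun_inj b z z' : chart_dom b z -> chart_dom b z' ->
  chart_fun b z = chart_fun b z' -> z = z'.
Proof. by move=> [Oz bz] [Oz' bz'] E; apply: ji => //; exact: good_charts_inj E. Qed.

(** Read in a chart, [jh] is a regular map between spaces of equal dimension, hence open by the
    inverse function theorem. *)
Lemma open_param (V : set vec) : (forall x : M, exists i : chart M, dom i x) ->
  open V -> V `<=` O -> open (jh @` V).
Proof.
move=> cov oV VO; rewrite openE => _ [z Vz <-].
have [b bz] := cov (jh z); have [ob bi bc bo] := gM b.
have oVb : open (V `&` chart_dom b) by apply: openI => //; exact: open_chart_dom.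
have oI : open (chart_fun b @` (V `&` chart_dom b)).
  apply: regular_open_image => //; last by move=> x [_]; exact: jr.
  by apply: smooth_on_sub (js b) => x [].
have H : open (dom b `&` coord b @^-1` (chart_fun b @` (V `&` chart_dom b))).
  exact: open_preimage_on.
apply: (@filterS _ _ (nbhs_filter (jh z))) (open_nbhs_nbhs (conj H _)).
  move=> x [bx [y [Vy [Oy by_]] E]]; exists y => //.
  exact: good_charts_inj E.
by split => //; exists z => //; split => //; split => //; exact: VO.
Qed.

(** Produces the chart expression [h] of the conjugate of [m] by [jh], namely chart j after [jh],
    [m] and a local inverse of [jh] read in chart i; both readings of [jh] preserve the form, so [h]
    does whenever [m] does. *)
Lemma transport (m : vec -> vec) (A : set vec) z0 i j :
  open A -> smooth_on A m -> (forall z, O z -> A z -> O (m z)) ->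
  O z0 -> A z0 -> dom i (jh z0) -> dom j (jh (m z0)) ->
  exists W h, [/\ open W, W (coord i (jh z0)), smooth_on W h,
    forall y, dom i y -> W (coord i y) -> exists z,
      [/\ O z, A z, y = jh z, dom j (jh (m z)) & coord j (jh (m z)) = h (coord i y)] &
    (forall u v, bilin w ('d m z0 u) ('d m z0 v) = bilin w u v) ->
    forall u v, bilin (form j (jh (m z0))) ('d h (coord i (jh z0)) u) ('d h (coord i (jh z0)) v)
      = bilin (form i (jh z0)) u v].
Proof.
move=> oA sm mO Oz0 Az0 iz0 jz0.
(* On this open set the point is visible in chart [i] and its image under [m] in chart [j]. *)
pose U := chart_dom i `&` (A `&` m @^-1` chart_dom j).
have oU : open U.
  apply: openI; first exact: open_chart_dom.
  apply: open_preimage_on => //; first exact: open_chart_dom.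
  by move=> x Ax; exact: smooth_on_continuous sm Ax.
have Uz0 : U z0 by split => //; split => //; split => //; exact: mO.
have sU : smooth_on U (chart_fun i) by apply: smooth_on_sub (js i) => x [].
have rU z : U z -> regular_at (chart_fun i) z by move=> [? _]; exact: jr.
have [k kK] : exists k : vec -> vec, forall z, U z -> k (chart_fun i z) = z.
  exists (fun y => xget 0 [set z | U z /\ chart_fun i z = y]) => z Uz.
  have [Uk Ek] := @xgetI _ 0 [set z' | U z' /\ chart_fun i z' = chart_fun i z] z (conj Uz erefl).
  by case: Uk Uz => ci _ [ci' _]; exact: chart_fun_inj Ek.
have oW := regular_open_image oU sU rU.
have sk := smooth_on_inverse oU sU rU kK.
exists (chart_fun i @` U), (fun y => chart_fun j (m (k y))); split => //.
- by exists z0.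
- have smk : smooth_on (chart_fun i @` U) (fun y => m (k y)).
    by apply: (smooth_on_comp oW oA _ sk sm) => _ [z Uz <-]; rewrite kK //; case: Uz => _ [].
  apply: (smooth_on_comp oW (@open_chart_dom j) _ smk (js j)) => _ [z Uz <-].
  by rewrite kK //; case: Uz => _ [].
- move=> y iy [z Uz E]; have [[Oz iz] [Az [Omz jmz]]] := Uz.
  have yE : y = jh z by apply/esym; exact: good_charts_inj E.
  by exists z; split => //; rewrite yE -/(chart_fun i z) kK.
- move=> Hm u v; rewrite -/(chart_fun i z0).
  have dk : differentiable k (chart_fun i z0).
    by apply: smooth_on_differentiable sk _; exists z0.
  have dm : differentiable m z0 by exact: smooth_on_differentiable sm Az0.
  have dj : differentiable (chart_fun j) (m z0).
    by apply: smooth_on_differentiable (js j) _; case: Uz0 => _ [].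
  have di : differentiable (chart_fun i) z0 by exact: smooth_on_differentiable sU Uz0.
  have E x := diff_comp3E x (kK z0 Uz0) dk dm dj.
  have F x : 'd (chart_fun i) z0 ('d k (chart_fun i z0) x) = x.
    have Ju := regular_jacobian (rU z0 Uz0).
    have [_ kE] := is_diff_inverse oU sU rU kK Uz0.
    have kx : 'd k (chart_fun i z0) x = x *m invmx (jacobian (chart_fun i) z0) by rewrite kE.
    apply: etrans (diff_jacobian _ _ _) _.
    by rewrite kx mulmxKV.
  apply: etrans (f_equal2 (bilin (form j (jh (m z0)))) (E u) (E v)) _.
  rewrite jf; last by case: Uz0 => _ [].
  rewrite Hm -(@jf i z0 _ _ (proj1 Uz0)).
  by apply: f_equal2; exact: F.
Qed.

End Parametrization.

Section Gluing.
Context {R : realType} {d : nat} {M : formedSpace R d}.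
Local Notation vec := 'rV[R]_d.
Hypothesis gM : good_charts M.
Hypothesis cov : forall x : M, exists i : chart M, dom i x.
Hypothesis trans : forall i j : chart M,
  smooth_on (coord i @` (dom i `&` dom j)) (local_expr (@idfun M) i j).
Hypothesis form_id : preserves_form (@idfun M).
Variables (w : 'M[R]_d) (O : set vec) (jh : vec -> M).
Hypotheses (oO : open O) (jc : forall z, O z -> {for z, continuous jh}).
Hypothesis ji : forall z z', O z -> O z' -> jh z = jh z' -> z = z'.
Hypothesis js : forall b, smooth_on (chart_dom O jh b) (chart_fun jh b).
Hypothesis jr : forall b z, chart_dom O jh b z -> regular_at (chart_fun jh b) z.
Hypothesis jf : forall b z u v, chart_dom O jh b z ->
  bilin (form b (jh z)) ('d (chart_fun jh b) z u) ('d (chart_fun jh b) z v) = bilin w u v.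
Variable S : set vec.
Hypotheses (SO : S `<=` O) (cS : closed (jh @` S)).

Section Glue.
Variables (m : vec -> vec) (A : set vec).
Hypotheses (oA : open A) (sm : smooth_on A m).
Hypotheses (mO : forall z, O z -> A z -> O (m z)) (mS : forall z, ~ S z -> m z = z).

(** On the image of [O] the preimage chosen by [xget] exists and is unique, so the default 0 is
    never taken. *)
Definition glue (p : M) : M :=
  if pselect ((jh @` O) p) then jh (m (xget 0 [set z | O z /\ jh z = p])) else p.

Lemma glue_param z : O z -> glue (jh z) = jh (m z).
Proof.
move=> Oz; rewrite /glue; case: pselect => [h|[]] /=; last by exists z.
have [Ok Ek] := @xgetI _ 0 [set z' | O z' /\ jh z' = jh z] z (conj Oz erefl).
by rewrite (ji Ok Oz Ek).
Qed.

Lemma glue_out p : ~ (jh @` S) p -> glue p = p.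
Proof.
move=> pS; have [[z Oz zp]|pO] := pselect ((jh @` O) p).
  have zS : ~ S z by move=> Sz; apply: pS; exists z.
  by rewrite -zp glue_param // mS.
by rewrite /glue; case: pselect.
Qed.

(** Two regions that are open, the first because the image of [S] is closed, the second because [jh]
    is an open map. [glue] is the identity on the first and the conjugate of [m] on the second, and
    the two agree on the overlap. *)
Definition glue_dom : set M := [set p | ~ (jh @` S) p \/ exists z, [/\ O z, A z & jh z = p]].

Lemma open_out : open (~` (jh @` S)).
Proof. exact: closed_openC. Qed.

Lemma glue_continuous p : glue_dom p -> {for p, continuous glue}.
Proof.
move=> [pS|[z [Oz Az <-]]].
  have H : nbhs p (~` (jh @` S)) by apply: open_nbhs_nbhs; split => //; exact: open_out.
  move=> B; rewrite glue_out // => nB.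
  apply: (@filterS _ _ (nbhs_filter p)) (@filterI _ _ (nbhs_filter p) _ _ H nB) => y [yS By].
  by rewrite /= glue_out.
move=> B; rewrite glue_param // nbhsE => -[B' [oB' B'z] B'B].
have oV : open ((O `&` A) `&` (fun z => jh (m z)) @^-1` (B' : set M)).
  pose U := (O `&` A) `&` m @^-1` (O `&` jh @^-1` B').
  have -> : (O `&` A) `&` (fun z => jh (m z)) @^-1` (B' : set M) = U.
    apply/seteqP; split => [y [[Oy Ay] By]|y [[Oy Ay] [_ By]]] //.
    by split => //; split => //; exact: mO.
  apply: open_preimage_on; first exact: openI.
    exact: open_preimage_on.
  by move=> y [_ Ay]; exact: smooth_on_continuous sm Ay.
pose V := (O `&` A) `&` (fun z => jh (m z)) @^-1` (B' : set M).
have VO : V `<=` O by move=> y [[]].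
have oI : open (jh @` V) := open_param gM oO jc js jr cov oV VO.
have I : (jh @` V) (jh z) by exists z.
apply: (@filterS _ _ (nbhs_filter (jh z))) (open_nbhs_nbhs (conj oI I)).
by move=> _ [y [[Oy Ay] By] <-] /=; apply: B'B; rewrite glue_param.
Qed.

(** Off the image of [S] the chart expression is a transition map, and the statement about forms is
    the transformation law of the components; elsewhere [transport] applies. *)
Lemma glue_local p i j : glue_dom p -> dom i p -> dom j (glue p) ->
  exists W h, [/\ open W, W (coord i p), smooth_on W h,
    forall y, dom i y -> W (coord i y) -> coord j (glue y) = h (coord i y) &
    (forall z u v, A z -> bilin w ('d m z u) ('d m z v) = bilin w u v) ->
    forall u v, bilin (form j (glue p)) ('d h (coord i p) u) ('d h (coord i p) v)
      = bilin (form i p) u v].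
Proof.
move=> [pS|[z [Oz Az <-]]] ip jp; last first.
  move: jp; rewrite glue_param // => jp.
  have [W [h [oW Wz sh Hy Hf]]] := transport gM oO jc ji js jr jf oA sm mO Oz Az ip jp.
  exists W, h; split => //.
    move=> y iy Wy; have [z' [Oz' _ -> _ <-]] := Hy y iy Wy.
    by rewrite glue_param.
  by move=> Hm; apply: Hf => u v; exact: Hm.
move: jp; rewrite glue_out // => jp.
have [oi _ _ Hi] := gM i; have [oj _ _ _] := gM j.
have oU : open (dom i `&` dom j `&` ~` (jh @` S)).
  by apply: openI; [exact: openI|exact: open_out].
exists (coord i @` (dom i `&` dom j `&` ~` (jh @` S))), (local_expr (@idfun M) i j); split.
- by apply: Hi => // x [[]].
- by exists p.
- by apply: smooth_on_sub (trans i j) => _ [x [Hx _] <-]; exists x.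
- move=> y iy [x [[ix jx] xS] E]; have yx : x = y by exact: good_charts_inj E.
  by rewrite yx in jx xS; rewrite glue_out // local_exprE.
- by move=> _ u v; exact: (form_id (conj ip jp)).
Qed.

End Glue.

Variables (phi psi : vec -> vec) (L : set vec).
Hypotheses (LS : L `<=` S) (oL : open (~` L)).
Hypotheses (sphi : smooth_on setT phi) (spsi : smooth_on (~` L) psi).
Hypotheses (phiK : forall z, psi (phi z) = z) (psiK : forall z, ~ L z -> phi (psi z) = z).
Hypotheses (phiL : forall z, ~ L (phi z)) (phiS : forall z, ~ S z -> phi z = z).
Hypotheses (phiO : forall z, O z -> O (phi z)) (psiO : forall z, O z -> ~ L z -> O (psi z)).
Hypothesis phif : forall z u v, bilin w ('d phi z u) ('d phi z v) = bilin w u v.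

Lemma psiS z : ~ S z -> psi z = z.
Proof. by move=> zS; rewrite -{1}(phiS zS) phiK. Qed.

Lemma glue_phi_out p : ~ (jh @` L) (glue phi p).
Proof.
have [[z Oz <-]|pO] := pselect ((jh @` O) p).
  rewrite (glue_param _ Oz) => -[y Ly E].
  have yz : y = phi z by apply: ji E; [exact/SO/LS|exact: phiO].
  by apply: (@phiL z); rewrite -yz.
have pS : ~ (jh @` S) p by move=> [z Sz E]; apply: pO; exists z => //; exact: SO.
by rewrite (glue_out phiS pS) => -[z Lz E]; apply: pS; exists z => //; exact: LS.
Qed.

Lemma glue_psiK p : glue psi (glue phi p) = p.
Proof.
have [[z Oz <-]|pO] := pselect ((jh @` O) p).
  by rewrite (glue_param _ Oz) glue_param ?phiK //; exact: phiO.
have pS : ~ (jh @` S) p by move=> [z Sz E]; apply: pO; exists z => //; exact: SO.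
by rewrite (glue_out phiS pS) (glue_out psiS pS).
Qed.

Lemma glue_phiK p : ~ (jh @` L) p -> glue phi (glue psi p) = p.
Proof.
move=> pL; have [[z Oz zp]|pO] := pselect ((jh @` O) p).
  have Lz : ~ L z by move=> Lz; apply: pL; exists z.
  by rewrite -zp (glue_param _ Oz) glue_param ?psiK //; exact: psiO.
have pS : ~ (jh @` S) p by move=> [z Sz E]; apply: pO; exists z => //; exact: SO.
by rewrite (glue_out psiS pS) (glue_out phiS pS).
Qed.

(** The complement is the union of two open sets: the complement of the closed image of [S], and the
    image of [O] minus [L] under the open map [jh]. *)
Lemma closed_param_L : open (~` (jh @` L)).
Proof.
have -> : ~` (jh @` L) = ~` (jh @` S) `|` jh @` (O `&` ~` L).
  apply/seteqP; split => [p pL|p [pS|[z [Oz zL] <-]]].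
  - have [[z Oz zp]|pO] := pselect ((jh @` O) p).
      by right; exists z => //; split => // Lz; apply: pL; exists z.
    by left => -[z Sz E]; apply: pO; exists z => //; exact: SO.
  - by move=> [z Lz E]; apply: pS; exists z => //; exact: LS.
  - by move=> [y Ly E]; apply: zL; rewrite -(ji _ Oz E) //; exact/SO/LS.
apply: openU; first exact: open_out.
apply: (open_param gM oO jc js jr cov); last by move=> z [].
exact: openI.
Qed.

Lemma phi_dom p : glue_dom setT p.
Proof.
have [[z Sz E]|pS] := pselect ((jh @` S) p); last by left.
by right; exists z; split => //; exact: SO.
Qed.

Lemma psi_dom p : ~ (jh @` L) p -> glue_dom (~` L) p.
Proof.
move=> pL; have [[z Sz E]|pS] := pselect ((jh @` S) p); last by left.
by right; exists z; split => //; [exact: SO|move=> Lz; apply: pL; exists z].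
Qed.

Theorem glued_symplectomorphism : symplectomorphic M (restriction (~` (jh @` L))).
Proof.
have oT : open [set: vec] by exact: openT.
have phiO' z : O z -> setT z -> O (phi z) by move=> Oz _; exact: phiO.
have gN := good_charts_restriction gM closed_param_L.
have phi_in p : glue phi p \in ~` (jh @` L) by apply: mem_set; exact: glue_phi_out.
pose F (p : M) : restriction (~` (jh @` L)) := SigSub (phi_in p) : set_type (~` (jh @` L)).
pose G (x : restriction (~` (jh @` L))) : M := glue psi (set_val x).
have cF : continuous F.
  move=> p; apply: set_type_continuous.
  exact: (glue_continuous oT sphi phiO' phiS (phi_dom p)).
have xL (x : restriction (~` (jh @` L))) : ~ (jh @` L) (set_val x) := @set_valP _ _ x.
have cG : continuous G.
  move=> x; apply: (continuous_comp (f := set_val) (g := glue psi)).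
    exact: set_val_continuous.
  exact: (glue_continuous oL spsi psiO psiS (psi_dom (xL x))).
have rF (p : M) (i j : chart M) : dom i p -> dom j (glue phi p) -> exists W h,
    represents F W h i (j : chart (restriction (~` (jh @` L)))) p /\
    forall u v : vec, bilin (form j (glue phi p)) ('d h (coord i p) u) ('d h (coord i p) v)
      = bilin (form i p) u v.
  move=> ip jp; have [W [h [oW Wp sh Hy Hf]]] :=
    glue_local oT sphi phiO' phiS (phi_dom p) ip jp.
  exists W, h; split; last by apply: Hf => z u v _.
  by split => // y iy _ Wy; exact: Hy.
exists F, G; split.
- by move=> p; exact: glue_psiK.
- by move=> x; apply: val_inj; exact: glue_phiK.
- apply: (smooth_map_local gM gN cF) => p i j ip jp.
  by have [W [h [H _]]] := rF p i j ip jp; exists W, h.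
- apply: (smooth_map_local gN gM cG) => x i j ix jx.
  have [W [h [oW Wp sh Hy _]]] := glue_local oL spsi psiO psiS (psi_dom (xL x)) ix jx.
  by exists W, h; split => // y iy _ Wy; exact: Hy.
- move=> i j p [ip jp] u v /=.
  have [W [h [H Hf]]] := rF p i j ip jp.
  have E x : 'd (local_expr F i j) (coord i p) x = 'd h (coord i p) x.
    exact: (represents_diff gM gN cF x ip jp H).
  by apply: etrans (f_equal2 (bilin _) (E u) (E v)) _; exact: Hf.
Qed.

End Gluing.

(** * The embedded cylinder as a parametrization *)

Section CylinderEmbedding.
Context {R : realType} {n : nat} {M : formedSpace R n.*2.+2}.
Local Notation vec := 'rV[R]_(n.*2.+2).
Variables (e : R) (j : standard_cylinder n e -> M).
Hypotheses (gM : good_charts M) (Hj : symplectic_embedding j).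
Local Notation O := (cylinder e : set vec).

Lemma open_cylinder : open O.
Proof.
have := @open_preimage_on _ _ (@transverse R n) setT [set x | x < e ^+ 2] openT (@open_lt _ _).
rewrite setTI; apply => z _.
exact: (smooth_on_continuous (smooth_on_transverse (@openT _)) (I : setT z)).
Qed.

Lemma good_charts_standard : good_charts (standard_space R n).
Proof.
move=> i; split.
- exact: openT.
- by move=> x y _ _.
- by move=> x _; exact: cvg_id.
- by move=> U oU _; rewrite image_id.
Qed.

Lemma good_charts_cylinder : good_charts (standard_cylinder n e).
Proof. apply: good_charts_restriction; [exact: good_charts_standard|exact: open_cylinder]. Qed.

Variable p0 : M.

(* The value [p0] outside the cylinder is junk. *)
Definition total_embedding (z : vec) : M :=
  if pselect (O z) is left h then j (SigSub (mem_set h)) else p0.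
Local Notation jh := total_embedding.

Lemma total_embeddingE (x : standard_cylinder n e) : jh (set_val x) = j x.
Proof.
rewrite /jh; case: pselect => [h|[]]; last exact: set_valP.
by congr j; apply: val_inj.
Qed.

Lemma total_embedding_lift z : O z -> exists2 x : standard_cylinder n e, set_val x = z & jh z = j x.
Proof.
move=> Oz; exists (SigSub (mem_set Oz)) => //.
by rewrite -(total_embeddingE (SigSub (mem_set Oz))).
Qed.

Lemma total_embedding_continuous z : O z -> {for z, continuous jh}.
Proof.
move=> Oz; have [x xz E] := total_embedding_lift Oz; have [[[cj _] _ _] _] := Hj.
move=> B; rewrite E => nB; have := cj x B nB.
rewrite nbhsE /= => -[_ [[C oC <-] Cx] CB].
apply: (@filterS _ _ (nbhs_filter z)) (open_nbhs_nbhs (conj (openI oC open_cylinder) _)).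
  by move=> y [Cy Oy] /=; have [x' x'y ->] := total_embedding_lift Oy; apply: CB; rewrite /= x'y.
by split => //; rewrite -xz.
Qed.

Lemma total_embedding_inj z z' : O z -> O z' -> jh z = jh z' -> z = z'.
Proof.
move=> /total_embedding_lift[x <- ->] /total_embedding_lift[x' <- ->].
by have [[_ _ [ij _ _]] _] := Hj => /ij ->.
Qed.

Lemma local_dom_cylinder b : @coord _ _ (standard_cylinder n e) tt @` local_dom j tt b = chart_dom O jh b.
Proof.
apply/seteqP; split => [_ [x [_ jx] <-]|z [Oz bz]].
  by split; [exact: set_valP|rewrite /= total_embeddingE].
have [x xz E] := total_embedding_lift Oz; exists x => //; split => //=.
by rewrite /= E in bz.
Qed.

Lemma local_expr_cylinder b z : chart_dom O jh b z -> local_expr j tt b z = chart_fun jh b z.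
Proof.
move=> [Oz bz]; have [x xz E] := total_embedding_lift Oz.
rewrite /chart_fun E -xz; apply: (local_exprE good_charts_cylinder) => //.
by rewrite -E.
Qed.

Lemma open_chart_dom_cylinder b : open (chart_dom O jh b).
Proof. exact: (open_chart_dom gM open_cylinder total_embedding_continuous). Qed.

Lemma smooth_chart_fun b : smooth_on (chart_dom O jh b) (chart_fun jh b).
Proof.
have [[[_ sj] _ _] _] := Hj; have := sj tt b; rewrite local_dom_cylinder => H.
exact: (smooth_on_ext (@open_chart_dom_cylinder b) (@local_expr_cylinder b) H).
Qed.

Lemma diff_chart_fun b z u : chart_dom O jh b z ->
  'd (chart_fun jh b) z u = 'd (local_expr j tt b) z u.
Proof.
move=> bz; apply: esym; apply: near_eq_diff.
  apply: (open_near (@open_chart_dom_cylinder b) bz) => y by_.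
  by rewrite local_expr_cylinder.
exact: smooth_on_differentiable (@smooth_chart_fun b) bz.
Qed.

Lemma chart_fun_regular b z : chart_dom O jh b z -> regular_at (chart_fun jh b) z.
Proof.
move=> bz u; rewrite diff_chart_fun // => u0.
have [[_ imm _] _] := Hj; have [Oz jz] := bz; have [x xz E] := total_embedding_lift Oz.
rewrite -xz in u0; apply: (imm tt b x) u0; split => //=.
by rewrite /= E in jz.
Qed.

Lemma chart_fun_form b z u v : chart_dom O jh b z ->
  bilin (form b (jh z)) ('d (chart_fun jh b) z u) ('d (chart_fun jh b) z v) =
  bilin (omega0 R n) u v.
Proof.
move=> bz; have [_ pf] := Hj; have [Oz jz] := bz; have [x xz E] := total_embedding_lift Oz.
have Du := diff_chart_fun u bz; have Dv := diff_chart_fun v bz.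
apply: etrans (f_equal2 (bilin (form b (jh z))) Du Dv) _.
rewrite /= E in jz; rewrite E -xz; exact: (pf tt b x (conj I jz) u v).
Qed.

End CylinderEmbedding.

(** * Thin neighbourhoods of the ray *)

Section LocallyCompact.
Context {T : topologicalType}.

Lemma countable_compact_cover : @second_countable T ->
  (forall p : T, exists2 C, compact C & nbhs p C) ->
  exists C : nat -> set T, (forall m, compact (C m)) /\ forall p : T, exists m, nbhs p (C m).
Proof.
move=> [B cB [Bo Bb]] lc; have /countable_injP[g ginj] := cB.
have H m : exists K : set T, compact K /\
    forall b, B b -> g b = m -> (exists2 K, compact K & b `<=` K) -> b `<=` K.
  have [[b [Bb' bm [K cK bK]]]|H] := pselect (exists b, [/\ B b, g b = m &
      exists2 K, compact K & b `<=` K]).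
    exists K; split => // b' Bb'' b'm _.
    suff -> : b' = b by [].
    by apply: ginj; rewrite ?inE // b'm bm.
  exists set0; split; first exact: compact0.
  by move=> b Bb' bm HK; exfalso; apply: H; exists b.
have [C HC] := choice H; exists C; split=> [m|p]; first by have [] := HC m.
have [K cK nK] := lc p; have [U [BU Up] UK] := Bb p K nK.
exists (g U); have [_ HU] := HC (g U).
have UC : U `<=` C (g U) by apply: HU => //; exists K.
by apply: filterS UC _; apply: open_nbhs_nbhs; split => //; exact: Bo.
Qed.

(** Near a given point only finitely many of the sets matter, and compact sets are closed in a
    Hausdorff space. *)
Lemma closed_locally_finite (B : nat -> set T) : hausdorff_space T ->
  (forall k, compact (B k)) ->
  (forall p : T, exists2 N, nbhs p N & exists K, forall k, (K <= k)%N -> N `&` B k = set0) ->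
  closed (\bigcup_k B k).
Proof.
move=> hT cB lf; rewrite -openC openE => p pB.
have [N nN [K HK]] := lf p.
have cU : closed (\bigcup_(k in `I_K) B k).
  by apply: closed_bigcup => // k _; exact: compact_closed.
have nU : nbhs p (~` \bigcup_(k in `I_K) B k).
  apply: open_nbhs_nbhs; split; first exact: closed_openC.
  by move=> [k _ Bk]; apply: pB; exists k.
apply: filterS (filterI nN nU) => y [Ny yU] [k _ Bk].
have [kK|Kk] := ltnP k K; first by apply: yU; exists k.
by have : (N `&` B k) y by []; rewrite HK.
Qed.

End LocallyCompact.

Lemma nbhs_preimage {S T : topologicalType} (f : S -> T) x (B : set T) :
  {for x, continuous f} -> nbhs (f x) B -> nbhs x (f @^-1` B).
Proof. by move=> cf; exact: cf. Qed.

Section ChartsLocallyCompact.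
Context {R : realType} {d : nat} {M : chartedSpace R d}.

Lemma good_charts_locally_compact : good_charts M ->
  (forall x : M, exists i : chart M, dom i x) -> forall p : M, exists2 C, compact C & nbhs p C.
Proof.
move=> gM cov p; have [i ip] := cov p; have [oi inj_i ci open_i] := gM i.
have oI : open (coord i @` dom i) by apply: open_i.
have nI : nbhs (coord i p) (coord i @` dom i).
  by apply: open_nbhs_nbhs; split => //; exists p.
have /nbhs_ballP[r /= r0 Hr] := nI.
pose s := r / 2; have s0 : 0 < s by rewrite divr_gt0.
pose D := closed_ball (coord i p) s.
have DI : D `<=` coord i @` dom i.
  rewrite /D closed_ballE // => y yD; apply: Hr; rewrite -ball_normE /=.
  by apply: le_lt_trans yD _; rewrite /s ltr_pdivrMr // ltr_pMr // ltr1n.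
have cD : compact D.
  apply: bounded_closed_compact; last exact: closed_ball_closed.
  exists (`|coord i p| + s); split; first exact: num_real.
  move=> m Hm x; rewrite /D closed_ballE // => xD; apply: ltW; apply: le_lt_trans Hm.
  have -> : x = coord i p - (coord i p - x) by rewrite subKr.
  by rewrite (le_trans (ler_normB _ _)) // lerD.
have [k kK] : exists k : 'rV[R]_d -> M, forall x, dom i x -> k (coord i x) = x.
  have H y : exists x : M, (coord i @` dom i) y -> dom i x /\ coord i x = y.
    have [[x ix xy]|yI] := pselect ((coord i @` dom i) y); first by exists x.
    by exists p.
  have [k Hk] := choice H; exists k => x ix.
  have [ikx E] : dom i (k (coord i x)) /\ coord i (k (coord i x)) = coord i x.
    by apply: Hk; exists x.
  exact: good_charts_inj E.
have kc y : (coord i @` dom i) y -> {for y, continuous k}.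
  move=> [x ix <-] B; rewrite kK // nbhsE => -[B' [oB' B'x] B'B].
  have oB : open (coord i @` (B' `&` dom i)) by apply: open_i => [|z []//]; exact: openI.
  apply: (@filterS _ _ (nbhs_filter (coord i x))) (open_nbhs_nbhs (conj oB _)).
    by move=> _ [z [B'z iz] <-]; apply: B'B; rewrite kK.
  by exists x.
exists (k @` D).
  by apply: continuous_compact => //; apply: continuous_in_subspaceT => y; rewrite inE => /DI /kc.
have nD : nbhs (coord i p) D.
  apply/nbhs_ballP; exists s => // y; rewrite -ball_normE /D closed_ballE //.
  by move=> /ltW.
have H : nbhs p (coord i @^-1` D) := nbhs_preimage (ci p ip) nD.
apply: (@filterS _ _ (nbhs_filter p)) (@filterI _ _ (nbhs_filter p) _ _
  (open_nbhs_nbhs (conj oi ip)) H) => y [iy Dy].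
by exists (coord i y) => //; exact: kK.
Qed.

End ChartsLocallyCompact.

Section Boxes.
Context {R : realType} {n : nat}.
Local Notation vec := 'rV[R]_(n.*2.+2).
Implicit Types z : vec.

(** For $r = 0$ this is the segment $k - 1 \le x_n \le k$ of the axis; the segment for $k = 0$
    precedes the ray. *)
Definition box k r : set vec := [set z | k%:R <= axial z <= k.+1%:R /\ radius2 z <= r].

Lemma smooth_continuous (f : vec -> R) : smooth_on setT f -> continuous f.
Proof. by move=> sf z; exact: (smooth_on_continuous sf (I : setT z)). Qed.

Lemma axial_continuous : continuous (@axial R n).
Proof. by apply: smooth_continuous; apply: smooth_on_axial; exact: openT. Qed.

Lemma radius2_continuous : continuous (@radius2 R n).
Proof. by apply: smooth_continuous; apply: smooth_on_radius2; exact: openT. Qed.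

Lemma coordinate_le_radius2 z k : (k <= n)%N ->
  (k != n -> xco z k ^+ 2 <= radius2 z) /\ yco z k ^+ 2 <= radius2 z.
Proof.
rewrite leq_eqVlt => /orP[/eqP ->|kn].
  by rewrite eqxx; split => //; rewrite lerDr transverse_ge0.
have H : xco z k ^+ 2 + yco z k ^+ 2 <= transverse z.
  rewrite /transverse (bigD1 (Ordinal kn)) //= lerDl sumr_ge0 // => i _.
  by rewrite addr_ge0 // sqr_ge0.
have := sqr_ge0 (xco z k); have := sqr_ge0 (yco z k); have := sqr_ge0 (yco z n).
by rewrite /radius2; split => [_|]; lra.
Qed.

Lemma compact_box k r : compact (box k r).
Proof.
apply: bounded_closed_compact; last first.
  have -> : box k r = (@axial R n) @^-1` [set x | k%:R <= x] `&` (@axial R n) @^-1` [set x | x <= k.+1%:R]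
      `&` (@radius2 R n) @^-1` [set x | x <= r].
    by apply/seteqP; split => [z [/andP[a b] c]|z [[a b] c]] //; split => //; rewrite a b.
  apply: closedI; first apply: closedI.
  - apply: preimage_closed (@closed_ge _ k%:R).
    by move=> x _; exact: axial_continuous.
  - apply: preimage_closed (@closed_le _ k.+1%:R).
    by move=> x _; exact: axial_continuous.
  - apply: preimage_closed (@closed_le _ r).
    by move=> x _; exact: radius2_continuous.
exists (k%:R + 2 + `|r|); split; first exact: num_real.
move=> m Hm z [/andP[a b] c]; apply: ltW; apply: le_lt_trans Hm.
have k0 : 0 <= k%:R :> R by exact: ler0n.
have r0 : 0 <= `|r| by [].
have sq (x : R) : x ^+ 2 <= radius2 z -> `|x| <= k%:R + 2 + `|r|.
  move=> H; have : `|x| ^+ 2 <= `|r|.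
    by rewrite real_normK ?num_real // (le_trans H) // (le_trans c) // ler_norm.
  by have : 0 <= `|x| by []; nra.
apply: norm_le_coord => [|i]; first by rewrite !addr_ge0.
have [l ln [->|->]] := pair_index i; have [Hx Hy] := coordinate_le_radius2 z ln.
  have [E|ln'] := eqVneq l n; last exact: sq (Hx ln').
  rewrite E -/(xco z n); move: a b; rewrite /axial -natr1 => a b.
  by rewrite ler_norml; apply/andP; split; lra.
exact: sq.
Qed.

(** Tube lemma: on the compact part of [box k 1] outside [U] the function [radius2] attains a
    positive minimum, and half of it, capped by 1, is a suitable radius. *)
Lemma box_tube k (U : set vec) : open U -> box k 0 `<=` U -> exists2 r, 0 < r & box k r `<=` U.
Proof.
move=> oU U0; pose A := box k 1 `&` ~` U.
have cA : compact A by apply: compact_closedI; [exact: compact_box|exact: open_closedC].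
have [A0|/nonemptyPn A0] := pselect (A !=set0); last first.
  by exists 1 => // z zb; apply: contrapT => zU; have : A z by []; rewrite A0.
have cr2 : {within A, continuous (@radius2 R n)}.
  by apply: continuous_in_subspaceT => z _; exact: radius2_continuous.
have [c] := EVT_min_rV A0 cA cr2; rewrite inE => -[[ck cr] cU] cmin.
have c0 : 0 < radius2 c by rewrite ltNge; apply/negP => c0; apply/cU/U0.
exists (Num.min 1 (radius2 c / 2)); first by rewrite lt_min ltr01 divr_gt0.
move=> z [zk]; rewrite le_min => /andP[z1 z2]; apply: contrapT => zU.
have /cmin : z \in A by rewrite inE.
by apply/negP; rewrite -ltNge (le_lt_trans z2) // ltr_pdivrMr // ltr_pMr // ltr1n.
Qed.

End Boxes.

Section ThinNeighbourhood.
Context {R : realType} {n : nat} {T : topologicalType}.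
Local Notation vec := 'rV[R]_(n.*2.+2).
Hypotheses (hT : hausdorff_space T).
Variable C : nat -> set T.
Hypotheses (cC : forall m, compact (C m)) (Ccov : forall p : T, exists m, nbhs p (C m)).
Variables (O : set vec) (jh : vec -> T).
Hypotheses (oO : open O) (jc : forall z, O z -> {for z, continuous jh}).
Hypothesis O0 : forall z, transverse z = 0 -> O z.
Hypothesis proper : forall K, compact K ->
  exists s, forall z, half_line z -> K (jh z) -> xco z n <= s.

Lemma radius2_le0 (z : vec) : radius2 z <= 0 -> transverse z = 0 /\ yco z n = 0.
Proof.
rewrite /radius2; have T0 := transverse_ge0 z; have Y0 := sqr_ge0 (yco z n) => r0.
split; first by apply/eqP; rewrite eq_le T0 andbT; lra.
by apply/eqP; rewrite -sqrf_eq0 eq_le Y0 andbT; lra.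
Qed.

(* The box k avoids each of the first k compact sets that its core avoids; since the
   curve is proper, this makes the family of images locally finite. *)
Lemma thin_neighbourhood : exists eps : nat -> R, (forall k, 0 < eps k) /\
  forall r : nat -> R, (forall k, r k <= eps k) ->
    (forall k, box k (r k) `<=` O) /\ closed (\bigcup_k (jh @` box k (r k))).
Proof.
pose I k := [set m | (m <= k)%N /\ C m `&` jh @` box k 0 = set0].
have cB k : closed (\bigcup_(m in I k) C m).
  apply: closed_bigcup => [|m _]; last exact: compact_closed.
  by apply: (sub_finite_set (B := `I_k.+1)) => // m [] /=; rewrite ltnS.
pose U k := O `&` jh @^-1` (~` \bigcup_(m in I k) C m).
have oU k : open (U k) by apply: open_preimage_on => //; exact: closed_openC.
have U0 k : box k 0 `<=` U k.
  move=> z zb; have [_ zr] := zb; have [zt _] := radius2_le0 zr.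
  split; first exact: O0.
  move=> [m [_ E] Cm]; have : (C m `&` jh @` box k 0) (jh z) by split => //; exists z.
  by rewrite E.
have H k : exists r, 0 < r /\ box k r `<=` U k.
  by have [r r0 rU] := box_tube (oU k) (U0 k); exists r.
have [eps Heps] := choice H; exists eps; split=> [k|r re].
  by have [] := Heps k.
have bU k : box k (r k) `<=` U k.
  move=> z [za zr]; have [_ HU] := Heps k; apply: HU; split => //; exact: le_trans zr (re k).
split; first by move=> k z zb; have [] := bU k z zb.
apply: closed_locally_finite => // [k|p].
  apply: continuous_compact; last exact: compact_box.
  by apply: continuous_in_subspaceT => z; rewrite inE => zb; have [Oz _] := bU k z zb; exact: jc.
have [m Cm] := Ccov p; have [s Hs] := proper (@cC m).
(* For $k \ge m$ the set [C m] is among those considered for box k, and $k \ge |s| + 2$ places the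
   core, where $x_n \ge k - 1$, beyond the bound [s]. Hence the core avoids [C m], and so does the
   thin box. *)
exists (C m) => //; exists (maxn m (Num.truncn `|s|).+3) => k; rewrite geq_max => /andP[mk sk].
have Ik : I k m.
  split => //; rewrite -subset0 => y [Cz [z [/andP[za _] zr] zE]].
  have [zt zy] := radius2_le0 zr; rewrite -zE in Cz.
  have sk' : `|s| + 2 <= k%:R.
    have h1 : `|s| < (Num.truncn `|s|).+1%:R by exact: truncnS_gt.
    have h2 : (Num.truncn `|s|).+3%:R <= k%:R :> R by rewrite ler_nat.
    move: h2; rewrite -[_.+3]addn2 natrD; lra.
  have s0 : 0 <= `|s| by []; have ss := ler_norm s.
  have xs1 : `|s| + 1 <= xco z n by move: za; rewrite /axial; lra.
  have xs : s < xco z n by lra.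
  have x0 : 0 <= xco z n by lra.
  have hz : half_line z by split.
  by have := Hs z hz Cz; rewrite leNgt xs.
rewrite -subset0 => y [Cz [z zb zE]]; have [_] := bU k z zb; apply; exists m => //.
by rewrite zE.
Qed.

End ThinNeighbourhood.

(** The recursion makes [top i] equal to the least of its required bounds: [eps i], $1/(i+1)$ and,
    for positive [i], the preceding [eta]. *)
Lemma exists_scales {R : realType} (eps : nat -> R) : (forall k, 0 < eps k) ->
  exists eta : nat -> R, [/\ forall i, 0 < eta i, forall i, top eta i.+1 <= eta i,
    forall i, top eta i <= i.+1%:R^-1 & forall i, top eta i <= eps i].
Proof.
move=> eps0; pose c i := expR (@rate R i)^-1.
have c0 i : 0 < c i by exact: expR_gt0.
pose b i := Num.min (eps i) (i.+1%:R^-1).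
have b0 i : 0 < b i by rewrite lt_min eps0 invr_gt0 ltr0n.
pose eta := fix F i := if i is i'.+1 then Num.min (b i) (F i') / c i else b 0%N / c 0%N.
have eta0 i : 0 < eta i.
  by elim: i => [|i IH] /=; rewrite divr_gt0 // lt_min b0.
have tE i : top eta i <= b i /\ (forall i', i = i'.+1 -> top eta i <= eta i').
  rewrite /top -/(c i); case: i => [|i] /=; rewrite divfK ?gt_eqF //.
  by rewrite ge_min lexx; split => // i' [<-]; rewrite ge_min lexx orbT.
exists eta; split => // i.
- by have [_] := tE i.+1; apply.
- by have [h _] := tE i; rewrite (le_trans h) // /b ge_min lexx orbT.
- by have [h _] := tE i; rewrite (le_trans h) // /b ge_min lexx.
Qed.

(** * Removing the ray *)

Section Final.
Context {R : realType} {n : nat}.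
Local Notation vec := 'rV[R]_(n.*2.+2).

Lemma transverse_eq0 (z : vec) : transverse z = 0 ->
  forall k, (k < n)%N -> xco z k = 0 /\ yco z k = 0.
Proof.
move=> z0 k kn; have := z0; rewrite /transverse => /eqP.
rewrite psumr_eq0; last by move=> i _; rewrite addr_ge0 // sqr_ge0.
move=> /allP /(_ (Ordinal kn) (mem_index_enum _)) /=.
rewrite paddr_eq0 ?sqr_ge0 // !sqrf_eq0 => /andP[/eqP-> /eqP->].
by [].
Qed.

Lemma half_line_gamma0 (z : vec) : half_line z -> exists2 s : ray R, z = gamma0 n s & set_val s = xco z n.
Proof.
move=> [z0 [y0 x0]]; have x0' : xco z n \in [set s : R | 0 <= s] by exact: mem_set.
exists (SigSub x0') => //; apply: pairs_ext => k.
  rewrite leq_eqVlt => /orP[/eqP ->|kn].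
    by rewrite /gamma0 /xco !mxE !eqxx mulr1.
  have [-> _] := transverse_eq0 z0 kn.
  rewrite /gamma0 /xco !mxE; have -> : (ix n k == ix n n) = false.
    by rewrite -val_eqE /= !inordK; lia.
  by rewrite mulr0.
move=> kn; have -> : yco z k = 0.
  move: kn; rewrite leq_eqVlt => /orP[/eqP -> //|kn].
  by have [_ ->] := transverse_eq0 z0 kn.
rewrite /gamma0 /yco !mxE; have -> : (iy n k == ix n n) = false.
  by rewrite -val_eqE /= !inordK; lia.
by rewrite mulr0.
Qed.

Lemma gamma0_half_line (s : ray R) : half_line (gamma0 n s).
Proof.
have ne (i : 'I_(n.*2.+2)) : i != ix n n -> gamma0 n s 0 i = 0.
  by move=> /negbTE H; rewrite /gamma0 !mxE H andbF mulr0.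
have nx k : (k < n)%N -> ix n k != ix n n by move=> kn; rewrite -val_eqE /= !inordK; lia.
have ny k : (k <= n)%N -> iy n k != ix n n by move=> kn; rewrite -val_eqE /= !inordK; lia.
split; [|split].
- apply: big1 => k _; have kn := ltn_ord k.
  by rewrite /xco /yco !ne ?nx ?ny ?(ltnW kn) // expr0n addr0.
- by rewrite /yco ne // ny.
- by rewrite /xco /gamma0 !mxE !eqxx mulr1; exact: (set_valP s).
Qed.

Lemma wide_embedding (M : formedSpace R n.*2.+2) (gamma : ray R -> M) : wide gamma ->
  exists (e : {posnum R}) (j : standard_cylinder n e%:num -> M),
    symplectic_embedding j /\ j \o gamma0_in n e = gamma.
Proof. by rewrite /wide /width => /ereal_sup_gt[_ [e [j Hj] _] _]; exists e, j. Qed.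

End Final.

Local Close Scope ring_scope.

Theorem corollary1p2 (R : realType) (n : nat) (M : formedSpace R n.*2.+2)
    (gamma : ray R -> M) :
  symplectic_manifold M ->
  ~ compact [set: M] ->
  proper_embedding gamma ->
  wide gamma ->
  symplectomorphic M (restriction (~` range gamma)).
Proof.
move=> [[hM scM cov gM trans] [form_id _ _ _ _]] _ [_ proper] /wide_embedding[e [j [Hj jgamma]]].
(* The starting point of [gamma] serves as the value of the extended embedding outside the
   cylinder. *)
have zero_ray : (0 : R)%R \in [set s : R | (0 <= s)%R] by apply: mem_set => /=.
pose s0 : ray R := SigSub zero_ray.
pose jh := total_embedding j (gamma s0).
have oO := @open_cylinder R n e%:num.
have jc := total_embedding_continuous Hj (p0 := gamma s0).
have ji := total_embedding_inj Hj (p0 := gamma s0).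
have jgammaE s : gamma s = jh (gamma0 n s).
  apply: etrans (esym (congr1 (fun f => f s) jgamma)) _.
  exact: esym (total_embeddingE j (gamma s0) (gamma0_in n e s)).
have rangeE : range gamma = jh @` @half_line R n.
  apply/seteqP; split => [_ [s _ <-]|_ [z /half_line_gamma0[s -> _] <-]].
    by exists (gamma0 n s); [exact: gamma0_half_line|rewrite jgammaE].
  by exists s => //; rewrite jgammaE.
have [C [cC Ccov]] := countable_compact_cover scM (good_charts_locally_compact gM cov).
have O0 (z : 'rV[R]_(n.*2.+2)) : transverse z = 0%R -> cylinder e%:num z.
  move=> z0; change (transverse z < e%:num ^+ 2)%R; by rewrite z0 exprn_gt0.
(* Properness in the form used for thin neighbourhoods: the parameters at which [gamma] meets a
   compact set form a compact, hence bounded, set of reals. *)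
have jproper K : compact K ->
    exists s, forall z, half_line z -> K (jh z) -> (xco z n <= s)%R.
  move=> /proper cK; have : compact (set_val @` (gamma @^-1` K)).
    apply: continuous_compact cK; apply: continuous_subspaceT => x; exact: set_val_continuous.
  move=> /compact_bounded [s [_ Hs]]; exists (s + 1)%R => z zl Kz.
  have [t zt xt] := half_line_gamma0 zl.
  rewrite (le_trans (ler_norm _)) // -xt; apply: Hs; first by rewrite ltrDl.
  by exists t => //=; rewrite jgammaE -zt.
have [eps [eps0 thin]] := thin_neighbourhood hM cC Ccov oO jc O0 jproper.
have [eta [eta0 top_eta top_le top_eps]] := exists_scales eps0.
have [boxO boxC] := thin (top eta) top_eps.
have [phi [psi [[phiK psiK phiL phit phiS] [sphi [oL spsi] phif]]]] :=
  model_symplectomorphism n eta0 top_eta top_le.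
have SE : @support R n eta = \bigcup_k box k (top eta k).
  by apply/seteqP; split => [z [k Hk]|z [k _ Hk]]; exists k.
have SO : @support R n eta `<=` cylinder e%:num by rewrite SE => z [k _ Hk]; exact: boxO Hk.
have cS : closed (jh @` @support R n eta) by rewrite SE image_bigcup.
have LS : @half_line R n `<=` @support R n eta.
  move=> z [z0 [y0 x0]]; have a0 : (0 <= axial z)%R by rewrite addr_ge0.
  have [k Hk] := nat_interval a0; exists k; split => //.
  rewrite /radius2 z0 y0 expr0n addr0; exact/ltW/(lt_le_trans (eta0 k))/eta_top.
have cylE (z : 'rV[R]_(n.*2.+2)) : cylinder e%:num z = (transverse z < e%:num ^+ 2)%R by [].
(* The cylinder is a sublevel set of [transverse], which the model map leaves invariant, so the
   conjugation stays inside the embedded cylinder. *)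
have phiO (z : 'rV[R]_(n.*2.+2)) : cylinder e%:num z -> cylinder e%:num (phi z) by rewrite !cylE phit.
have psiO (z : 'rV[R]_(n.*2.+2)) : cylinder e%:num z -> ~ half_line z -> cylinder e%:num (psi z).
  by move=> Oz zl; rewrite cylE -phit psiK.
rewrite rangeE; exact: (glued_symplectomorphism gM cov trans form_id oO jc ji
  (smooth_chart_fun gM Hj (gamma s0)) (chart_fun_regular gM Hj (p0 := gamma s0))
  (chart_fun_form gM Hj (p0 := gamma s0)) SO cS LS oL
  sphi spsi phiK psiK phiL phiS phiO psiO phif).
Qed.
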